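(* Let \[ T := \frac{\eta(\tau)^2\eta(4\tau)^2\eta(10\tau)^{8}}{\eta(5\tau)^2\eta(20\tau)^{10}},\quad H := \frac{\eta(4\tau)\eta(5\tau)^5}{\eta(\tau)\eta(20\tau)^5},\quad G := \frac{\eta(4\tau)^4\eta(10\tau)^2}{\eta(2\tau)^2\eta(20\tau)^4}, \] $G_0=1$, $G_1=G$, $G_2=H-G$, $G_3=G^2$, $G_4=(H-G)^2$, and $A := q\cdot \mathrm{C}(q)/\mathrm{C}(q^{25})$ where $\mathrm{C}(q) := \frac{(q^2;q^2)^5_{\infty}}{(q;q)^3_{\infty}(q^4;q^4)^2_{\infty}}$. Then for any $(i,j,k)\in\{0,1\}\times\mathbb{Z}\times\{0,1,2,3,4\}$, \[ T^{m(i,j,k)}\,U_5\left(A^iT^jG_k\right)\in\mathcal{M}^{\infty}(20), \] where $m(i,j,k) = 2i + 5|j| + m_k$ with $m_0=0$, $m_1 = 2$, $m_2 = 3$, $m_3 = 4$, $m_4 = 6$.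
   Context: Let $\tau\in\mathbb{H}$, $q=e^{2\pi i\tau}$, $(q^a;q^b)_\infty := \prod_{m\ge 0}(1-q^{a+bm})$, and $\eta(\tau)=q^{1/24}(q;q)_\infty$. A modular function over $\Gamma_0(N)=\{\begin{pmatrix}a&b\\c&d\end{pmatrix}\in \mathrm{SL}(2,\mathbb{Z}): N\mid c\}$ is a function holomorphic on $\mathbb{H}$, invariant under the action of $\Gamma_0(N)$ by Möbius transformations, with finite order at every cusp. $\mathcal{M}^{\infty}(N)$ denotes the set of modular functions over $\Gamma_0(N)$ with nonnegative order at every cusp not equivalent to $\infty$ (so poles occur only at the cusp $\infty$). For a series $f=\sum_{m\ge M}a(m)q^m$, $U_5(f) := \sum_{5m\ge M} a(5m)q^m$. *)

(* Defs.v *)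
From Stdlib Require Export Reals ZArith.
From Coquelicot Require Export Coquelicot.

Open Scope R_scope.
Open Scope C_scope.

Definition Cexp (z : C) : C :=
  ((exp (Re z) * cos (Im z))%R, (exp (Re z) * sin (Im z))%R).

Definition Cpowz (z : C) (n : Z) : C :=
  match n with
  | Z0 => 1
  | Zpos p => z ^ Pos.to_nat p
  | Zneg p => / z ^ Pos.to_nat p
  end.

(* Meaningful only when u converges; otherwise the value is junk. *)
Definition Clim_seq (u : nat -> C) : C :=
  (real (Lim_seq (fun n => Re (u n))), real (Lim_seq (fun n => Im (u n)))).

Fixpoint Cprod_n (u : nat -> C) (n : nat) : C :=
  match n with
  | O => 1
  | S p => Cprod_n u p * u p
  end.

(* (q^a; q^b)_oo *)
Definition qpoch (q : C) (a b : nat) : C :=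
  Clim_seq (Cprod_n (fun m => 1 - q ^ (a + b * m))).

(* The upper half-plane; functions on it are represented by total functions
   C -> C whose values elsewhere are irrelevant. *)
Definition UHP (tau : C) : Prop := (0 < Im tau)%R.

(* q^r for q = exp (2 pi i tau), with the branch exp (2 pi i r tau). *)
Definition qpow (r : R) (tau : C) : C := Cexp (2 * PI * Ci * r * tau).

Definition q (tau : C) : C := qpow 1 tau.

Definition eta (tau : C) : C := qpow (/ 24) tau * qpoch (q tau) 1 1.

(* f = sum_(n >= M) a(n) q^(n/w) on the upper half-plane. *)
Definition has_qexp (w : Z) (f : C -> C) (M : Z) (a : Z -> C) : Prop :=
  forall tau : C, UHP tau ->
    is_series
      (fun l : nat =>
         let n := (M + Z.of_nat l)%Z in a n * qpow (IZR n / IZR w) tau)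
      (f tau).

(* g = U_5(f).  The summation range 5 m >= M is m >= - ((- M) / 5), the
   ceiling of M / 5, since Z.div rounds down. *)
Definition is_U5 (f g : C -> C) : Prop :=
  exists (M : Z) (a : Z -> C),
    has_qexp 1 f M a /\
    has_qexp 1 g (- ((- M) / 5)) (fun m => a (5 * m)%Z).

Record SL2Z : Type := mkSL2Z {
  ga : Z; gb : Z; gc : Z; gd : Z;
  gdet : (ga * gd - gb * gc = 1)%Z
}.

Definition moebius (g : SL2Z) (tau : C) : C :=
  (IZR (ga g) * tau + IZR (gb g)) / (IZR (gc g) * tau + IZR (gd g)).

Definition Gamma0 (N : Z) (g : SL2Z) : Prop := (N | gc g)%Z.

(* A cusp is represented by any g in SL(2,Z) sending oo to it, so that g
   stands for the cusp ga g / gc g (oo if gc g = 0). *)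
Definition same_cusp (g h : SL2Z) : Prop := (ga g * gc h = ga h * gc g)%Z.

(* The orbit of oo under Gamma0 N. *)
Definition cusp_equiv_infty (N : Z) (g : SL2Z) : Prop :=
  exists h : SL2Z, Gamma0 N h /\ same_cusp h g.

(* The width of the cusp ga g / gc g for Gamma0 N. *)
Definition cusp_width (N : Z) (g : SL2Z) : Z :=
  (N / Z.gcd (gc g * gc g) N)%Z.

(* The order of f at the cusp of g: the exponent of the leading term of
   f(g tau) in powers of q^(1/w), w the cusp width.  [None] is +oo, the order
   of the zero function. There is no order when the principal part is
   infinite. *)
Inductive cusp_order (N : Z) (f : C -> C) (g : SL2Z) : option Z -> Prop :=
  | cusp_order_Some (n : Z) (a : Z -> C) :
      has_qexp (cusp_width N g) (fun tau => f (moebius g tau)) n a ->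
      a n <> 0 ->
      cusp_order N f g (Some n)
  | cusp_order_None :
      (forall tau, UHP tau -> f tau = 0) ->
      cusp_order N f g None.

Definition order_nonneg (o : option Z) : Prop :=
  match o with Some n => (0 <= n)%Z | None => True end.

Record modular_function (N : Z) (f : C -> C) : Prop := {
  modular_holomorphic : forall tau, UHP tau -> ex_derive f tau;
  modular_invariant : forall g, Gamma0 N g ->
    forall tau, UHP tau -> f (moebius g tau) = f tau;
  modular_cusps : forall g : SL2Z, exists o, cusp_order N f g o
}.

Definition Minfty (N : Z) (f : C -> C) : Prop :=
  modular_function N f /\
  forall g : SL2Z, ~ cusp_equiv_infty N g ->
    exists o, cusp_order N f g o /\ order_nonneg o.

Definition fT (tau : C) : C :=
  (eta tau ^ 2 * eta (4 * tau) ^ 2 * eta (10 * tau) ^ 8)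
  / (eta (5 * tau) ^ 2 * eta (20 * tau) ^ 10).

Definition fH (tau : C) : C :=
  (eta (4 * tau) * eta (5 * tau) ^ 5) / (eta tau * eta (20 * tau) ^ 5).

Definition fG (tau : C) : C :=
  (eta (4 * tau) ^ 4 * eta (10 * tau) ^ 2)
  / (eta (2 * tau) ^ 2 * eta (20 * tau) ^ 4).

(* G_0, ..., G_4; indices k > 4 are never used. *)
Definition Gk (k : nat) (tau : C) : C :=
  match k with
  | 0%nat => 1
  | 1%nat => fG tau
  | 2%nat => fH tau - fG tau
  | 3%nat => fG tau ^ 2
  | 4%nat => (fH tau - fG tau) ^ 2
  | _ => 0
  end.

Definition Cq (x : C) : C :=
  qpoch x 2 2 ^ 5 / (qpoch x 1 1 ^ 3 * qpoch x 4 4 ^ 2).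

Definition fA (tau : C) : C := q tau * (Cq (q tau) / Cq (q tau ^ 25)).

Definition mk (k : nat) : Z :=
  match k with
  | 0%nat => 0
  | 1%nat => 2
  | 2%nat => 3
  | 3%nat => 4
  | 4%nat => 6
  | _ => 0
  end%Z.

Definition mexp (i : nat) (j : Z) (k : nat) : Z :=
  (2 * Z.of_nat i + 5 * Z.abs j + mk k)%Z.

(* Main.v *)
Require Import Defs.
From Stdlib Require Import Lra Lia Psatz List.
Import ListNotations.

(** U_5 f is the average of f((tau + r)/5) over 0 <= r < 5, and for g in
    SL(2,Z) the matrix (1 r; 0 5) g is again an integral matrix of determinant 5.
    The expansion of U_5 f at the cusp of g is therefore controlled by
    eta(delta m tau) for integral matrices m.  Writing delta m as an element of
    SL(2,Z) times an upper triangular (A B; 0 D), with A the gcd of the first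
    column, turns an eta quotient of weight 0 into a constant times the
    corresponding quotient of the eta((A tau + B)/D), whose q-order is a sum of
    terms r A / (24 D).  All orders depend only on c modulo 100, and already the
    orders of the individual factors A, T^j, G, H add up to a nonnegative number
    after multiplication by T^m, away from the cusps with 20 | c: no cancellation
    in H - G is used.

    The transformation of eta is obtained from that of its logarithmic
    derivative, a multiple of sum_m pi^2 / sin^2(pi m tau), by Eisenstein's
    argument: the two orders of summation of sum 1/(m tau + n)^2 differ by a
    telescoping sum, evaluated with the partial fractions of the cotangent.
    The squares eta^2 transform by a character of SL(2,Z) given by a polynomial
    modulo 12, which settles the invariance of T and G.  For H and A, where odd
    powers occur, H(tau) = h(tau)/h(5 tau)^5 and A(tau) = c(tau)/c(25 tau) with
    h = eta(4 tau)/eta(tau) and c = eta(2 tau)^5/(eta(tau)^3 eta(4 tau)^2), whose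
    characters on Gamma0(4) are computed on the generators T, (1 0; 4 1), -1. *)

Implicit Types (z w tau : C) (f g F G : C -> C).

(** * Sequences and series in C *)

(** The multiplier system of eta itself, with Dedekind sums and a branch of the square root of c tau
    + d, is never established. A logarithmic derivative determines a nonvanishing function up to a
    constant, and constants do not affect orders at cusps; so the expansions there need only the
    weight 2 law of the logarithmic derivative. Constants matter for the invariance alone, where
    finite congruences settle them.

    Orders in powers of q^(1/w) are obtained without uniqueness of coefficients. At each cusp
    everything is first expanded in q^(1/12000); invariance under Gamma0(20) then gives the period
    w, and averaging over shifts by w deletes the other exponents.

    The exponent m(i,j,k) is additive in i, |j| and k. It is therefore enough to bound the orders of
    A, T, 1/T and the G_k separately, which leaves a finite check although j is arbitrary. Cusps
    with 20 | c are equivalent to infinity, and there any finite lower bound will do.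

    Of complex analysis only two principles are used: interchange of limits under a summable
    majorant, and constancy of a function with zero derivative on the half-plane. *)

Fixpoint psum (a : nat -> C) (n : nat) : C :=
  match n with O => 0 | S p => psum a p + a p end.

Fixpoint rsum (b : nat -> R) (n : nat) : R :=
  match n with O => 0%R | S p => (rsum b p + b p)%R end.

Definition cvg (u : nat -> C) (l : C) : Prop :=
  forall eps : R, (0 < eps)%R ->
  exists N : nat, forall n, (N <= n)%nat -> (Cmod (u n - l) < eps)%R.

Definition csum (a : nat -> C) (l : C) : Prop := cvg (psum a) l.

Definition bsum (b : nat -> R) : Prop :=
  exists B : R, forall n, (rsum b n <= B)%R.

Lemma Cmod_sub_sym x y : Cmod (x - y) = Cmod (y - x).
Proof. rewrite <- Cmod_opp. f_equal. ring. Qed.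

Lemma Cmod_sub_triangle x y z : (Cmod (x - z) <= Cmod (x - y) + Cmod (y - z))%R.
Proof. replace (x - z) with ((x - y) + (y - z)) by ring. apply Cmod_triangle. Qed.

Lemma Cmod_triangle_rev x y : (Cmod x - Cmod y <= Cmod (x - y))%R.
Proof.
  pose proof (Cmod_triangle (x - y) y). replace (x - y + y) with x in H by ring. lra.
Qed.

Lemma Cmod_RtoC_nonneg (x : R) : (0 <= x)%R -> Cmod x = x.
Proof. intros; rewrite Cmod_R; apply Rabs_pos_eq; auto. Qed.

Lemma Cmod_pos z : z <> 0 -> (0 < Cmod z)%R.
Proof. apply (proj1 (Cmod_gt_0 z)). Qed.

(** Holds at 0 as well, because the inverse of 0 is 0 both in C and in R. *)
Lemma Cmod_Cinv z : Cmod (/ z) = (/ Cmod z)%R.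
Proof.
  destruct (Ceq_dec z 0) as [->|H].
  - replace (/ 0) with (RtoC 0). { rewrite Cmod_0, Rinv_0. auto. }
    unfold Cinv, RtoC; cbn. unfold Rdiv. f_equal; ring.
  - apply Cmod_inv; auto.
Qed.

Lemma Cinv_0 : / 0 = 0.
Proof. unfold Cinv, RtoC; cbn. unfold Rdiv. f_equal; ring. Qed.

Lemma cvg_ext u v (l : C) : (forall n, u n = v n) -> cvg u l -> cvg v l.
Proof.
  intros E H eps He. destruct (H eps He) as [N HN]. exists N. intros n Hn.
  rewrite <- E. auto.
Qed.

Lemma cvg_ext_loc N u v (l : C) :
  (forall n, (N <= n)%nat -> u n = v n) -> cvg u l -> cvg v l.
Proof.
  intros E H eps He. destruct (H eps He) as [M HM]. exists (max N M). intros n Hn.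
  rewrite <- E by lia. apply HM; lia.
Qed.

Lemma cvg_const (c : C) : cvg (fun _ => c) c.
Proof.
  intros eps He. exists O. intros. replace (c - c) with (RtoC 0) by ring.
  rewrite Cmod_0; auto.
Qed.

Lemma cvg_unique u (l : C) m : cvg u l -> cvg u m -> l = m.
Proof.
  intros H1 H2. destruct (Ceq_dec l m) as [|N]; auto. exfalso.
  assert (0 < Cmod (l - m))%R as P.
  { apply Cmod_gt_0. intros E. apply N. replace l with (l - m + m) by ring.
    rewrite E; ring. }
  destruct (H1 (Cmod (l - m) / 2)%R) as [N1 K1]. lra.
  destruct (H2 (Cmod (l - m) / 2)%R) as [N2 K2]. lra.
  specialize (K1 (max N1 N2) ltac:(lia)). specialize (K2 (max N1 N2) ltac:(lia)).
  pose proof (Cmod_sub_triangle l (u (max N1 N2)) m).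
  rewrite (Cmod_sub_sym l (u _)) in H. lra.
Qed.

Lemma cvg_plus u v (l : C) m : cvg u l -> cvg v m -> cvg (fun n => u n + v n) (l + m).
Proof.
  intros H1 H2 eps He.
  destruct (H1 (eps / 2)%R) as [N1 K1]. lra.
  destruct (H2 (eps / 2)%R) as [N2 K2]. lra.
  exists (max N1 N2). intros n Hn.
  specialize (K1 n ltac:(lia)). specialize (K2 n ltac:(lia)).
  replace (u n + v n - (l + m)) with ((u n - l) + (v n - m)) by ring.
  pose proof (Cmod_triangle (u n - l) (v n - m)). lra.
Qed.

Lemma cvg_scal (c : C) u (l : C) : cvg u l -> cvg (fun n => c * u n) (c * l).
Proof.
  intros H eps He.
  assert (0 <= Cmod c)%R as P by apply Cmod_ge_0.
  destruct (H (eps / (Cmod c + 1))%R) as [N K]. { apply Rdiv_lt_0_compat; lra. }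
  exists N. intros n Hn. replace (c * u n - c * l) with (c * (u n - l)) by ring.
  rewrite Cmod_mult. specialize (K n Hn).
  apply Rle_lt_trans with (Cmod c * (eps / (Cmod c + 1)))%R.
  { apply Rmult_le_compat_l; lra. }
  apply Rmult_lt_reg_r with (Cmod c + 1)%R. lra. field_simplify; lra.
Qed.

Lemma cvg_bounded u (l : C) : cvg u l -> exists B, forall n, (Cmod (u n) <= B)%R.
Proof.
  intros H. destruct (H 1%R ltac:(lra)) as [N HN].
  assert (forall M, exists B, forall n, (n < M)%nat -> (Cmod (u n) <= B)%R) as F.
  { induction M. exists 0%R; intros; lia.
    destruct IHM as [B HB]. exists (Rmax B (Cmod (u M))). intros n Hn.
    destruct (Nat.eq_dec n M) as [->|]. apply Rmax_r.
    eapply Rle_trans; [apply HB; lia | apply Rmax_l]. }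
  destruct (F N) as [B HB]. exists (Rmax B (Cmod l + 1)). intros n.
  destruct (Nat.lt_ge_cases n N) as [Hn|Hn].
  - eapply Rle_trans; [apply HB; lia | apply Rmax_l].
  - eapply Rle_trans; [|apply Rmax_r]. specialize (HN n Hn).
    pose proof (Cmod_triangle_rev (u n) l). lra.
Qed.

Lemma cvg_squeeze u (l : C) (b : nat -> R) :
  (forall n, (Cmod (u n - l) <= Cmod (b n))%R) -> cvg b 0 -> cvg u l.
Proof.
  intros H Hb eps He. destruct (Hb eps He) as [N K]. exists N. intros n Hn.
  specialize (K n Hn). replace (b n - 0) with (RtoC (b n)) in K by ring.
  eapply Rle_lt_trans; eauto.
Qed.

Lemma cvg_mult u v (l : C) m : cvg u l -> cvg v m -> cvg (fun n => u n * v n) (l * m).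
Proof.
  intros H1 H2. destruct (cvg_bounded _ _ H1) as [B HB].
  assert (cvg (fun n => u n * (v n - m)) 0) as H3.
  { intros eps He. assert (0 <= B)%R as PB.
    { eapply Rle_trans; [apply Cmod_ge_0|apply (HB O)]. }
    destruct (H2 (eps / (B + 1))%R) as [N K]. { apply Rdiv_lt_0_compat; lra. }
    exists N. intros n Hn. replace (u n * (v n - m) - 0) with (u n * (v n - m)) by ring.
    rewrite Cmod_mult. specialize (K n Hn).
    apply Rle_lt_trans with (B * (eps / (B + 1)))%R.
    { apply Rmult_le_compat; auto; try apply Cmod_ge_0; lra. }
    apply Rmult_lt_reg_r with (B + 1)%R. lra. field_simplify; lra. }
  pose proof (cvg_plus _ _ _ _ H3 (cvg_scal m _ _ H1)) as H4.
  replace (0 + m * l) with (l * m) in H4 by ring.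
  eapply cvg_ext; [|exact H4]. intros n; simpl; ring.
Qed.

Lemma cvg_opp u (l : C) : cvg u l -> cvg (fun n => - u n) (- l).
Proof.
  intros H. replace (- l) with ((-1) * l) by ring.
  eapply cvg_ext; [|apply cvg_scal, H]. intros; simpl; ring.
Qed.

Lemma cvg_minus u v (l : C) m : cvg u l -> cvg v m -> cvg (fun n => u n - v n) (l - m).
Proof. intros. apply cvg_plus; auto using cvg_opp. Qed.

Lemma cvg_inv u (l : C) : l <> 0 -> cvg u l -> cvg (fun n => / u n) (/ l).
Proof.
  intros Hl H eps He. assert (0 < Cmod l)%R as P by (apply Cmod_pos; auto).
  destruct (H (Cmod l / 2)%R) as [N1 K1]. lra.
  destruct (H (eps * (Cmod l * Cmod l / 2))%R) as [N2 K2]. { apply Rmult_lt_0_compat; [lra|]. apply Rdiv_lt_0_compat; [|lra]. apply Rmult_lt_0_compat; auto. }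
  exists (max N1 N2). intros n Hn.
  specialize (K1 n ltac:(lia)). specialize (K2 n ltac:(lia)).
  assert (Cmod l / 2 < Cmod (u n))%R as Q.
  { pose proof (Cmod_triangle_rev l (u n)). rewrite Cmod_sub_sym in H0. lra. }
  assert (u n <> 0) as U. { apply (proj2 (Cmod_gt_0 (u n))). lra. }
  replace (/ u n - / l) with ((l - u n) / (u n * l)).
  2: { field; auto. }
  rewrite Cmod_div by (apply Cmult_neq_0; auto). rewrite Cmod_mult, Cmod_sub_sym.
  assert (0 < Cmod (u n) * Cmod l)%R by nra. apply Rmult_lt_reg_r with (Cmod (u n) * Cmod l)%R. auto.
  unfold Rdiv. rewrite Rmult_assoc, Rinv_l by nra.
  rewrite Rmult_1_r. eapply Rlt_le_trans; [apply K2|].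
  apply Rmult_le_compat_l; nra.
Qed.

Lemma cvg_subseq u (l : C) (s : nat -> nat) :
  (forall n, (n <= s n)%nat) -> cvg u l -> cvg (fun n => u (s n)) l.
Proof.
  intros Hs H eps He. destruct (H eps He) as [N K]. exists N. intros n Hn.
  apply K. specialize (Hs n). lia.
Qed.

Lemma cvg_shift_inv u (l : C) k : cvg (fun n => u (n + k)%nat) l -> cvg u l.
Proof.
  intros H eps He. destruct (H eps He) as [N K]. exists (N + k)%nat. intros n Hn.
  specialize (K (n - k)%nat ltac:(lia)). replace (n - k + k)%nat with n in K by lia. auto.
Qed.

Lemma cvg_le u (l : C) B : (forall n, (Cmod (u n) <= B)%R) -> cvg u l -> (Cmod l <= B)%R.
Proof.
  intros H Hu. apply Rnot_lt_le. intros L. destruct (Hu (Cmod l - B)%R) as [N K]. lra.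
  specialize (K N ltac:(lia)). specialize (H N).
  pose proof (Cmod_triangle_rev l (u N)). rewrite Cmod_sub_sym in H0. lra.
Qed.

Lemma cvg_cauchy u :
  (forall eps, (0 < eps)%R -> exists N, forall n, (N <= n)%nat -> (Cmod (u n - u N) < eps)%R) ->
  exists l, cvg u l.
Proof.
  intros H.
  (* Completeness of R is applied to an arbitrary coordinate that is 1-Lipschitz for the modulus; Re
     and Im are the two instances. *)
  assert (forall p : C -> R, (forall x y, Rabs (p x - p y) <= Cmod (x - y))%R ->
          exists l : R, Un_cv (fun n => p (u n)) l) as A.
  { intros p Hp. destruct (Rcomplete.R_complete (fun n => p (u n))) as [l Hl]; [|exists l; auto].
    intros eps He. destruct (H (eps / 2)%R ltac:(lra)) as [N K]. exists N. intros n m Hn Hm.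
    unfold Rdist. specialize (Hp (u n) (u m)).
    pose proof (Cmod_sub_triangle (u n) (u N) (u m)). rewrite (Cmod_sub_sym (u N)) in H0.
    pose proof (K n Hn). pose proof (K m Hm). lra. }
  destruct (A Re) as [l1 H1].
  { intros. replace (Re x - Re y)%R with (Re (x - y)) by reflexivity. apply re_le_Cmod. }
  destruct (A Im) as [l2 H2].
  { intros. replace (Im x - Im y)%R with (snd (x - y)) by reflexivity.
    eapply Rle_trans; [apply Rmax_r|apply Rmax_Cmod]. }
  exists (l1, l2). intros eps He.
  destruct (H1 (eps / 2)%R ltac:(lra)) as [N1 K1]. destruct (H2 (eps / 2)%R ltac:(lra)) as [N2 K2].
  exists (max N1 N2). intros n Hn. specialize (K1 n ltac:(lia)). specialize (K2 n ltac:(lia)).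
  unfold Rdist in *. eapply Rle_lt_trans; [apply Cmod_2Rmax|].
  change (sqrt 2 * Rmax (Rabs (Re (u n) - l1)) (Rabs (Im (u n) - l2)) < eps)%R.
  assert (Rmax (Rabs (Re (u n) - l1)) (Rabs (Im (u n) - l2)) < eps / 2)%R
    by (apply Rmax_lub_lt; auto).
  assert (0 <= Rmax (Rabs (Re (u n) - l1)) (Rabs (Im (u n) - l2)))%R.
  { eapply Rle_trans; [apply Rabs_pos|apply Rmax_l]. }
  assert (sqrt 2 <= 2)%R. { replace 2%R with (sqrt (2 * 2)) at 2. apply sqrt_le_1; lra.
    rewrite sqrt_square; lra. }
  pose proof (sqrt_pos 2). nra.
Qed.

Lemma psum_ext a b n : (forall k, (k < n)%nat -> a k = b k) -> psum a n = psum b n.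
Proof. induction n; intros H; simpl; auto. rewrite IHn, H; auto. Qed.

Lemma psum_plus a b n : psum (fun k => a k + b k) n = psum a n + psum b n.
Proof. induction n; simpl; [ring|rewrite IHn; ring]. Qed.

Lemma psum_scal (c : C) a n : psum (fun k => c * a k) n = c * psum a n.
Proof. induction n; simpl; [ring|rewrite IHn; ring]. Qed.

Lemma psum_0 n : psum (fun _ => 0) n = 0.
Proof. induction n; simpl; [ring|rewrite IHn; ring]. Qed.

Lemma psum_split a n m : psum a (n + m) = psum a n + psum (fun k => a (n + k)%nat) m.
Proof.
  induction m. { rewrite Nat.add_0_r; simpl; ring. }
  rewrite Nat.add_succ_r; simpl. rewrite IHm; ring.
Qed.

Lemma psum_S_l a n : psum a (S n) = a O + psum (fun k => a (S k)) n.
Proof. change (S n) with (1 + n)%nat. rewrite psum_split. simpl. ring. Qed.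

Lemma psum_rev a n : psum a n = psum (fun k => a (n - 1 - k)%nat) n.
Proof.
  induction n; auto. rewrite psum_S_l.
  assert (psum (fun k => a (S n - 1 - k)%nat) (S n) = a n + psum (fun k => a (n - 1 - k)%nat) n) as ->.
  { rewrite psum_S_l. f_equal. f_equal. lia. apply psum_ext. intros; f_equal; lia. }
  rewrite <- IHn, <- psum_S_l. simpl. ring.
Qed.

Lemma rsum_ext a b n : (forall k, (k < n)%nat -> a k = b k) -> rsum a n = rsum b n.
Proof. induction n; intros H; simpl; auto. rewrite IHn, H; auto. Qed.

Lemma rsum_le a b n : (forall k, (k < n)%nat -> (a k <= b k)%R) -> (rsum a n <= rsum b n)%R.
Proof.
  induction n; intros H; simpl. lra. apply Rplus_le_compat; auto.
Qed.

Lemma rsum_nonneg b n : (forall k, (0 <= b k)%R) -> (0 <= rsum b n)%R.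
Proof. intros H; induction n; simpl. lra. specialize (H n); lra. Qed.

Lemma rsum_scal (c : R) a n : rsum (fun k => c * a k)%R n = (c * rsum a n)%R.
Proof. induction n; simpl; [ring|rewrite IHn; ring]. Qed.

Lemma rsum_plus a b n : rsum (fun k => a k + b k)%R n = (rsum a n + rsum b n)%R.
Proof. induction n; simpl; [ring|rewrite IHn; ring]. Qed.

Lemma rsum_split a n m : rsum a (n + m) = (rsum a n + rsum (fun k => a (n + k)%nat) m)%R.
Proof.
  induction m. { rewrite Nat.add_0_r; simpl; ring. }
  rewrite Nat.add_succ_r; simpl. rewrite IHm; ring.
Qed.

Lemma rsum_mono b n m : (forall k, (0 <= b k)%R) -> (n <= m)%nat -> (rsum b n <= rsum b m)%R.
Proof.
  intros H L. replace m with (n + (m - n))%nat by lia. rewrite rsum_split.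
  assert (0 <= rsum (fun k => b (n + k)%nat) (m - n))%R by (apply rsum_nonneg; auto). lra.
Qed.

Lemma Cmod_psum_le a b n :
  (forall k, (k < n)%nat -> (Cmod (a k) <= b k)%R) -> (Cmod (psum a n) <= rsum b n)%R.
Proof.
  induction n; intros H; simpl. rewrite Cmod_0; lra.
  eapply Rle_trans; [apply Cmod_triangle|]. apply Rplus_le_compat; auto.
Qed.

Lemma psum_RtoC b n : psum (fun k => RtoC (b k)) n = RtoC (rsum b n).
Proof. induction n; simpl; auto. rewrite IHn, RtoC_plus; auto. Qed.

Lemma bsum_le a b : (forall k, (a k <= b k)%R) -> bsum b -> bsum a.
Proof.
  intros H [B HB]. exists B. intros n. eapply Rle_trans; [apply rsum_le; auto|apply HB].
Qed.

Lemma bsum_scal (c : R) b : (0 <= c)%R -> bsum b -> bsum (fun k => c * b k)%R.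
Proof.
  intros Hc [B HB]. exists (c * B)%R. intros n. rewrite rsum_scal.
  apply Rmult_le_compat_l; auto.
Qed.

Lemma bsum_plus a b : bsum a -> bsum b -> bsum (fun k => a k + b k)%R.
Proof.
  intros [A HA] [B HB]. exists (A + B)%R. intros n. rewrite rsum_plus.
  apply Rplus_le_compat; auto.
Qed.

Lemma bsum_shift_inv b k : bsum (fun n => b (k + n)%nat) -> bsum b.
Proof.
  intros [B HB]. exists (Rmax (rsum (fun n => Rabs (b n)) k) (rsum b k + B))%R. intros n.
  destruct (Nat.le_gt_cases n k).
  - eapply Rle_trans; [|apply Rmax_l]. eapply Rle_trans.
    apply rsum_le. intros; apply Rle_abs. apply rsum_mono; auto. intros; apply Rabs_pos.
  - eapply Rle_trans; [|apply Rmax_r]. replace n with (k + (n - k))%nat by lia.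
    rewrite rsum_split. apply Rplus_le_compat_l, HB.
Qed.

Lemma bsum_tail b : (forall k, (0 <= b k)%R) -> bsum b ->
  forall eps, (0 < eps)%R -> exists N, forall n m, (N <= n)%nat ->
  (rsum (fun k => b (n + k)%nat) m < eps)%R.
Proof.
  intros Hb [B HB] eps He.
  destruct (growing_cv (rsum b)) as [l Hl].
  { intros n. simpl. specialize (Hb n). lra. }
  { exists B. intros x [n ->]. apply HB. }
  destruct (Hl (eps / 2)%R ltac:(lra)) as [N K]. exists N. intros n m Hn.
  pose proof (K n ltac:(lia)) as K1. pose proof (K (n + m)%nat ltac:(lia)) as K2.
  unfold Rdist in *. pose proof (rsum_split b n m).
  apply Rabs_def2 in K1. apply Rabs_def2 in K2. lra.
Qed.

Lemma bsum_csum a b : (forall k, (Cmod (a k) <= b k)%R) -> bsum b -> exists l, csum a l.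
Proof.
  intros H Hb. apply cvg_cauchy. intros eps He.
  destruct (bsum_tail b) with (eps := eps) as [N K]; auto.
  { intros; eapply Rle_trans; [apply Cmod_ge_0|apply H]. }
  exists N. intros n Hn. replace n with (N + (n - N))%nat by lia. rewrite psum_split.
  replace (psum a N + _ - psum a N) with (psum (fun k => a (N + k)%nat) (n - N)) by ring.
  eapply Rle_lt_trans; [apply Cmod_psum_le; intros; apply H|]. apply K. lia.
Qed.

Lemma csum_unique a (l : C) m : csum a l -> csum a m -> l = m.
Proof. apply cvg_unique. Qed.

Lemma csum_ext a b (l : C) : (forall k, a k = b k) -> csum a l -> csum b l.
Proof. intros E. apply cvg_ext. intros n. apply psum_ext; auto. Qed.

Lemma csum_plus a b (l : C) m : csum a l -> csum b m -> csum (fun k => a k + b k) (l + m).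
Proof.
  intros H1 H2. eapply cvg_ext; [|apply cvg_plus; [apply H1|apply H2]].
  intros; rewrite psum_plus; auto.
Qed.

Lemma csum_scal (c : C) a (l : C) : csum a l -> csum (fun k => c * a k) (c * l).
Proof.
  intros H1. eapply cvg_ext; [|apply cvg_scal, H1].
  intros; simpl; rewrite psum_scal; auto.
Qed.

Lemma csum_minus a b (l : C) m : csum a l -> csum b m -> csum (fun k => a k - b k) (l - m).
Proof.
  intros H1 H2. apply csum_plus; auto. replace (- m) with ((-1) * m) by ring.
  eapply csum_ext; [|apply csum_scal, H2]. intros; simpl; ring.
Qed.

Lemma csum_shift a (l : C) n : csum a l -> csum (fun k => a (n + k)%nat) (l - psum a n).
Proof.
  intros H. eapply cvg_ext.
  2: { apply cvg_minus; [|apply cvg_const].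
    apply (cvg_subseq _ _ (fun k => n + k)%nat) in H. exact H. intros; lia. }
  intros m; simpl. rewrite psum_split. ring.
Qed.

Lemma csum_shift_inv a (l : C) n : csum (fun k => a (n + k)%nat) l -> csum a (psum a n + l).
Proof.
  intros H. apply cvg_shift_inv with (k := n).
  eapply cvg_ext; [|apply cvg_plus; [apply cvg_const|apply H]].
  intros m; simpl. rewrite (Nat.add_comm m), psum_split; auto.
Qed.

Lemma csum_le a b (l : C) B :
  (forall k, (Cmod (a k) <= b k)%R) -> (forall n, (rsum b n <= B)%R) -> csum a l ->
  (Cmod l <= B)%R.
Proof.
  intros H HB. apply cvg_le. intros n. eapply Rle_trans; [apply Cmod_psum_le; auto|apply HB].
Qed.

Lemma csum_finite (a : nat -> C) n : (forall k, (n <= k)%nat -> a k = 0) -> csum a (psum a n).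
Proof.
  intros H. apply cvg_ext_loc with (N := n) (u := fun _ => psum a n); [|apply cvg_const].
  intros m Hm. replace m with (n + (m - n))%nat by lia. rewrite psum_split.
  rewrite (psum_ext (fun k => a (n + k)%nat) (fun _ => 0)), psum_0; [ring|].
  intros; apply H; lia.
Qed.

(** [sum_n a n] has n + 1 terms while [psum a n] has n, whence the shifts by one. *)
Lemma csum_is_series (a : nat -> C) (l : C) : csum a l <-> is_series a l.
Proof.
  assert (forall n, sum_n a n = psum a (S n)) as E.
  { induction n. rewrite sum_O. simpl. rewrite Cplus_0_l; auto.
    rewrite sum_Sn, IHn. auto. }
  split.
  - intros H P [eps HP]. destruct (H eps (cond_pos eps)) as [N K].
    exists N. intros n Hn. apply HP. rewrite E.
    apply C_NormedModule_mixin_compat1. apply K. lia.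
  - intros H. apply cvg_shift_inv with (k := 1%nat). intros eps He.
    (* A ball of radius r for the product structure of C only bounds the modulus by sqrt 2 times r,
       so half of eps is asked for. *)
    assert (0 < eps / 2)%R as He2 by lra.
    destruct (H (ball l (mkposreal _ He2))) as [N K].
    { exists (mkposreal _ He2); auto. }
    exists N. intros n Hn. specialize (K n Hn). rewrite E in K.
    apply C_NormedModule_mixin_compat2 in K. rewrite Nat.add_1_r.
    eapply Rlt_le_trans; [apply K|]. simpl.
    assert (sqrt 2 <= 2)%R. { replace 2%R with (sqrt (2 * 2)) at 2. apply sqrt_le_1; lra.
      rewrite sqrt_square; lra. }
    nra.
Qed.

Lemma psum_cvg (f : nat -> nat -> C) (g : nat -> C) m :
  (forall k, cvg (fun n => f n k) (g k)) -> cvg (fun n => psum (f n) m) (psum g m).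
Proof. intros H. induction m; simpl. apply cvg_const. apply cvg_plus; auto. Qed.

(** Dominated convergence for series. The majorant makes the tails of all [f n] and of [g] small
    beyond one common index, and the finite heads converge term by term. *)
Lemma tannery (f : nat -> nat -> C) (g S : nat -> C) (b : nat -> R) :
  (forall k, cvg (fun n => f n k) (g k)) ->
  (forall n k, (Cmod (f n k) <= b k)%R) -> bsum b ->
  (forall n, csum (f n) (S n)) ->
  exists l, csum g l /\ cvg S l.
Proof.
  intros Hc Hb HB HS.
  assert (forall k, (0 <= b k)%R) as b0.
  { intros; eapply Rle_trans; [apply Cmod_ge_0|apply (Hb O)]. }
  assert (forall k, (Cmod (g k) <= b k)%R) as gb by (intros; eapply cvg_le; [|apply Hc]; intros; apply Hb).
  destruct (bsum_csum g b gb HB) as [l Hl]. exists l. split; auto.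
  intros eps He. destruct (bsum_tail b b0 HB (eps / 4)%R ltac:(lra)) as [N K].
  destruct (psum_cvg f g N Hc (eps / 4)%R ltac:(lra)) as [M HM].
  exists M. intros n Hn. specialize (HM n Hn).
  assert (Cmod (S n - psum (f n) N) <= eps / 4)%R as A1.
  { eapply csum_le; [|intros m; left; apply (K N m); auto|apply csum_shift, HS].
    intros; apply Hb. }
  assert (Cmod (l - psum g N) <= eps / 4)%R as A2.
  { eapply csum_le; [|intros m; left; apply (K N m); auto|apply csum_shift, Hl].
    intros; apply gb. }
  pose proof (Cmod_sub_triangle (S n) (psum (f n) N) l).
  pose proof (Cmod_sub_triangle (psum (f n) N) (psum g N) l).
  rewrite (Cmod_sub_sym (psum g N)) in H0. lra.
Qed.

(** The version for partial fractions, whose terms are dominated only once the pole is far from the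
    point. *)
Lemma tannery_loc (f : nat -> nat -> C) (g S : nat -> C) (b : nat -> R) k0 :
  (forall k, cvg (fun n => f n k) (g k)) ->
  (forall n k, (k0 <= k)%nat -> (Cmod (f n k) <= b k)%R) -> bsum b ->
  (forall n, csum (f n) (S n)) ->
  exists l, csum g l /\ cvg S l.
Proof.
  intros Hc Hb HB HS.
  assert (forall k, (k0 <= k)%nat -> (0 <= b k)%R) as b0.
  { intros; eapply Rle_trans; [apply Cmod_ge_0|apply (Hb O)]; auto. }
  destruct (tannery (fun n k => f n (k0 + k)%nat) (fun k => g (k0 + k)%nat)
     (fun n => S n - psum (f n) k0) (fun k => b (k0 + k)%nat)) as [l [H1 H2]].
  - auto.
  - intros; apply Hb; lia.
  - destruct HB as [B HB]. exists (B - rsum b k0)%R. intros n. 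
    pose proof (rsum_split b k0 n). specialize (HB (k0 + n)%nat). lra.
  - intros n. apply csum_shift, HS.
  - exists (psum g k0 + l). split. { apply csum_shift_inv, H1. }
    pose proof (cvg_plus _ _ _ _ (psum_cvg f g k0 Hc) H2) as H3.
    eapply cvg_ext; [|exact H3]. intros; simpl; ring.
Qed.

(** Tannery's theorem applied to the column sums truncated at row N, with N as the parameter; the
    product majorant bounds them by a multiple of [be]. *)
Lemma fubini (f : nat -> nat -> C) (R1 C1 : nat -> C) (al be : nat -> R) :
  (forall m n, (Cmod (f m n) <= al m * be n)%R) ->
  (forall m, (0 <= al m)%R) -> (forall m, (0 <= be m)%R) -> bsum al -> bsum be ->
  (forall m, csum (f m) (R1 m)) -> (forall n, csum (fun m => f m n) (C1 n)) ->
  exists l, csum R1 l /\ csum C1 l.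
Proof.
  intros H a0 b0 [A HA] HB HR HC.
  destruct (tannery (fun N n => psum (fun m => f m n) N) C1 (psum R1) (fun n => A * be n)%R)
    as [l [H1 H2]].
  - exact HC.
  - intros N n. eapply Rle_trans. apply Cmod_psum_le with (b := fun m => (be n * al m)%R).
    intros; rewrite Rmult_comm; auto. rewrite rsum_scal, Rmult_comm.
    apply Rmult_le_compat_r; auto.
  - apply bsum_scal; auto. specialize (HA O). simpl in HA. lra.
  - intros N. induction N. { apply (csum_finite (fun _ => RtoC 0) O). auto. } simpl.
    apply csum_plus; auto.
  - exists l. split; auto.
Qed.

(** * Cauchy products *)

Definition cauchy (a b : nat -> C) (n : nat) : C := psum (fun k => a k * b (n - k)%nat) (S n).

Lemma psum_cauchy a b n :
  psum (cauchy a b) n = psum (fun k => a k * psum b (n - k)) n.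
Proof.
  induction n; auto. simpl psum at 1. rewrite IHn. unfold cauchy.
  assert (psum (fun k => a k * psum b (n - k)) n = psum (fun k => a k * psum b (n - k)) (S n)) as ->.
  { simpl. rewrite Nat.sub_diag. simpl. ring. }
  rewrite <- psum_plus. apply psum_ext. intros k Hk.
  replace (S n - k)%nat with (S (n - k)) by lia. simpl. ring.
Qed.

(** Mertens' theorem: the n-th partial sum of the product is the sum over k < n of a_k times a
    partial sum of b, and partial sums of b are bounded, so a multiple of |a_k| dominates. *)
Lemma csum_cauchy a b (l : C) m :
  bsum (fun k => Cmod (a k)) -> csum a l -> csum b m -> csum (cauchy a b) (l * m).
Proof.
  intros Ha Hl Hm. destruct (cvg_bounded _ _ Hm) as [B HB].
  destruct (tannery (fun n k => if (k <? n)%nat then a k * psum b (n - k) else 0)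
     (fun k => a k * m) (psum (cauchy a b)) (fun k => B * Cmod (a k))%R) as [t [H1 H2]].
  - intros k. apply cvg_shift_inv with (k := S k).
    eapply cvg_ext with (u := fun n => a k * psum b (S n)).
    + intros n. replace (k <? n + S k)%nat with true by (symmetry; apply Nat.ltb_lt; lia).
      do 2 f_equal; lia.
    + apply cvg_scal. apply (cvg_subseq _ _ S) in Hm; auto.
  - intros n k. assert (0 <= B)%R. { eapply Rle_trans; [apply Cmod_ge_0|apply (HB O)]. }
    destruct (k <? n)%nat. rewrite Cmod_mult, Rmult_comm.
    apply Rmult_le_compat_r; auto using Cmod_ge_0.
    rewrite Cmod_0. apply Rmult_le_pos; auto using Cmod_ge_0.
  - apply bsum_scal; auto. eapply Rle_trans; [apply Cmod_ge_0|apply (HB O)].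
  - intros n. rewrite psum_cauchy.
    rewrite (psum_ext _ (fun k => if (k <? n)%nat then a k * psum b (n - k) else 0)).
    apply csum_finite. intros k Hk.
    replace (k <? n)%nat with false by (symmetry; apply Nat.ltb_ge; lia); auto.
    intros k Hk. replace (k <? n)%nat with true by (symmetry; apply Nat.ltb_lt; lia); auto.
  - replace (l * m) with t; auto. apply (csum_unique (fun k => a k * m)); auto.
    rewrite Cmult_comm. eapply csum_ext; [|apply csum_scal, Hl]. intros; simpl; ring.
Qed.

Lemma bsum_cauchy a b :
  bsum (fun k => Cmod (a k)) -> bsum (fun k => Cmod (b k)) ->
  bsum (fun k => Cmod (cauchy a b k)).
Proof.
  intros [A HA] [B HB]. exists (A * B)%R. intros n.
  set (a' := fun k => RtoC (Cmod (a k))). set (b' := fun k => RtoC (Cmod (b k))).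
  assert (forall k, cauchy a' b' k = RtoC (rsum (fun i => Cmod (a i) * Cmod (b (k - i)%nat))%R (S k))) as E.
  { intros k. unfold cauchy. rewrite <- psum_RtoC. apply psum_ext. intros.
    unfold a', b'. rewrite RtoC_mult; auto. }
  apply Rle_trans with (Cmod (psum (cauchy a' b') n)).
  { rewrite (psum_ext _ _ n (fun k _ => E k)), psum_RtoC, Cmod_RtoC_nonneg.
    2: { apply rsum_nonneg. intros. apply rsum_nonneg. intros.
         apply Rmult_le_pos; apply Cmod_ge_0. }
    apply rsum_le. intros k _. apply Cmod_psum_le. intros. rewrite Cmod_mult. lra. }
  rewrite psum_cauchy. eapply Rle_trans. apply Cmod_psum_le with (b := fun k => (B * Cmod (a k))%R).
  { intros k _. unfold a'. rewrite Cmod_mult, Rmult_comm.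
    rewrite (Cmod_RtoC_nonneg (Cmod _)) by apply Cmod_ge_0.
    apply Rmult_le_compat_r. apply Cmod_ge_0.
    unfold b'. rewrite psum_RtoC, Cmod_RtoC_nonneg; auto.
    apply rsum_nonneg. intros; apply Cmod_ge_0. }
  rewrite rsum_scal, Rmult_comm. apply Rmult_le_compat_r; auto.
  specialize (HB O). simpl in HB. auto.
Qed.

(** * Complex derivatives and the exponential *)

(** The form without a quotient allows h = 0, so the chain rule needs no case distinction on whether
    the inner increment vanishes. *)
Definition cder (f : C -> C) (l z : C) : Prop :=
  forall eps : R, (0 < eps)%R -> exists d : R, (0 < d)%R /\
  forall h : C, (Cmod h < d)%R -> (Cmod (f (z + h)%C - f z - l * h) <= eps * Cmod h)%R.

Lemma cder_eq f (l : C) m z : cder f l z -> l = m -> cder f m z.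
Proof. intros H <-; auto. Qed.

Lemma cder_ex_derive (f : C -> C) (l : C) z : cder f l z -> ex_derive f z.
Proof.
  intros H. exists l. split. { apply is_linear_scal_l. }
  intros x Hx eps.
  assert (z = x) as <-.
  { apply (is_filter_lim_locally_unique (V := AbsRing_NormedModule C_AbsRing)) in Hx. auto. }
  destruct (H eps (cond_pos eps)) as [d [Hd K]].
  exists (mkposreal d Hd). intros y Hy.
  specialize (K (y - z) Hy). replace (z + (y - z)) with (y : C) in K by (change ((y : C) = z + (y - z)); ring).
  change (Cmod (f y - f z - (y - z) * l) <= eps * Cmod (y - z))%R.
  rewrite (Cmult_comm (y - z)). exact K.
Qed.

Lemma cder_const (c : C) z : cder (fun _ => c) 0 z.
Proof.
  intros eps He. exists 1%R. split. lra. intros h _.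
  replace (c - c - 0 * h) with (RtoC 0) by ring. rewrite Cmod_0.
  apply Rmult_le_pos. lra. apply Cmod_ge_0.
Qed.

Lemma cder_id z : cder (fun x => x) 1 z.
Proof.
  intros eps He. exists 1%R. split. lra. intros h _.
  replace (z + h - z - 1 * h) with (RtoC 0) by ring. rewrite Cmod_0.
  apply Rmult_le_pos. lra. apply Cmod_ge_0.
Qed.

Lemma cder_ext_loc f g (l : C) z (d : R) :
  (0 < d)%R -> (forall h : C, (Cmod h < d)%R -> f (z + h) = g (z + h)) ->
  cder f l z -> cder g l z.
Proof.
  intros Hd E H eps He. destruct (H eps He) as [e [P K]].
  exists (Rmin d e). split. { apply Rmin_glb_lt; auto. }
  intros h Hh. rewrite <- E by (eapply Rlt_le_trans; [apply Hh|apply Rmin_l]).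
  replace (g z) with (f z).
  2: { replace z with (z + 0) by ring. apply E. rewrite Cmod_0; auto. }
  apply K. eapply Rlt_le_trans; [apply Hh|apply Rmin_r].
Qed.

Lemma cder_ext f g (l : C) z : (forall x, f x = g x) -> cder f l z -> cder g l z.
Proof. intros E. apply cder_ext_loc with (d := 1%R). lra. auto. Qed.

Lemma cder_plus f g (l : C) m z : cder f l z -> cder g m z -> cder (fun x => f x + g x) (l + m) z.
Proof.
  intros H1 H2 eps He.
  destruct (H1 (eps / 2)%R ltac:(lra)) as [d1 [P1 K1]].
  destruct (H2 (eps / 2)%R ltac:(lra)) as [d2 [P2 K2]].
  exists (Rmin d1 d2). split. { apply Rmin_glb_lt; auto. } intros h Hh.
  specialize (K1 h ltac:(eapply Rlt_le_trans; [apply Hh|apply Rmin_l])).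
  specialize (K2 h ltac:(eapply Rlt_le_trans; [apply Hh|apply Rmin_r])).
  replace (f (z + h) + g (z + h) - (f z + g z) - (l + m) * h) with
    ((f (z + h) - f z - l * h) + (g (z + h) - g z - m * h)) by ring.
  eapply Rle_trans; [apply Cmod_triangle|]. lra.
Qed.

Lemma cder_lip f (l : C) z : cder f l z -> exists d, (0 < d)%R /\
  forall h : C, (Cmod h < d)%R -> (Cmod (f (z + h)%C - f z) <= (Cmod l + 1) * Cmod h)%R.
Proof.
  intros H. destruct (H 1%R ltac:(lra)) as [d [P K]]. exists d. split; auto.
  intros h Hh. specialize (K h Hh).
  replace (f (z + h) - f z) with ((f (z + h) - f z - l * h) + l * h) by ring.
  eapply Rle_trans; [apply Cmod_triangle|]. rewrite Cmod_mult. lra.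
Qed.

Lemma cder_comp f g (l : C) m z : cder f l (g z) -> cder g m z -> cder (fun x => f (g x)) (l * m) z.
Proof.
  intros Hf Hg eps He.
  pose proof (Cmod_ge_0 m) as Pm. pose proof (Cmod_ge_0 l) as Pl.
  destruct (cder_lip _ _ _ Hg) as [d1 [P1 K1]].
  destruct (Hf (eps / 2 / (Cmod m + 1))%R) as [d2 [P2 K2]].
  { apply Rdiv_lt_0_compat; lra. }
  destruct (Hg (eps / 2 / (Cmod l + 1))%R) as [d3 [P3 K3]].
  { apply Rdiv_lt_0_compat; lra. }
  exists (Rmin (Rmin d1 d3) (d2 / (Cmod m + 1))). split.
  { repeat apply Rmin_glb_lt; auto. apply Rdiv_lt_0_compat; lra. }
  intros h Hh.
  assert (Cmod h < d1)%R as L1.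
  { eapply Rlt_le_trans; [apply Hh|]. eapply Rle_trans; apply Rmin_l. }
  assert (Cmod h < d3)%R as L3.
  { eapply Rlt_le_trans; [apply Hh|]. eapply Rle_trans; [apply Rmin_l|apply Rmin_r]. }
  assert (Cmod h < d2 / (Cmod m + 1))%R as L2.
  { eapply Rlt_le_trans; [apply Hh|]. apply Rmin_r. }
  specialize (K1 h L1). specialize (K3 h L3).
  set (k := g (z + h) - g z) in *.
  assert (Cmod k < d2)%R as Lk.
  { eapply Rle_lt_trans; [apply K1|].
    apply Rmult_lt_compat_r with (r := (Cmod m + 1)%R) in L2; [|lra].
    replace (d2 / (Cmod m + 1) * (Cmod m + 1))%R with d2 in L2 by (field; lra). lra. }
  specialize (K2 k Lk). replace (g z + k) with (g (z + h)) in K2 by (unfold k; ring).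
  replace (f (g (z + h)) - f (g z) - l * m * h) with
    ((f (g (z + h)) - f (g z) - l * k) + l * (k - m * h)) by (unfold k; ring).
  eapply Rle_trans; [apply Cmod_triangle|]. rewrite Cmod_mult.
  assert (eps / 2 / (Cmod m + 1) * Cmod k <= eps / 2 * Cmod h)%R.
  { apply Rle_trans with (eps / 2 / (Cmod m + 1) * ((Cmod m + 1) * Cmod h))%R.
    - apply Rmult_le_compat_l; auto. left. apply Rdiv_lt_0_compat; lra.
    - right. field. lra. }
  assert (Cmod l * Cmod (k - m * h) <= eps / 2 * Cmod h)%R.
  { apply Rle_trans with ((Cmod l + 1) * (eps / 2 / (Cmod l + 1) * Cmod h))%R.
    - apply Rmult_le_compat; auto; try lra. apply Cmod_ge_0.
    - right. field. lra. }
  lra.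
Qed.

Lemma cder_sqr z : cder (fun x => x * x) (2 * z) z.
Proof.
  intros eps He. exists eps. split; auto. intros h Hh.
  replace ((z + h) * (z + h) - z * z - 2 * z * h) with (h * h) by ring.
  rewrite Cmod_mult. apply Rmult_le_compat_r. apply Cmod_ge_0. lra.
Qed.

Lemma cder_scal (c : C) f (l : C) z : cder f l z -> cder (fun x => c * f x) (c * l) z.
Proof.
  intros H eps He. pose proof (Cmod_ge_0 c) as P.
  destruct (H (eps / (Cmod c + 1))%R) as [d [Hd K]]. { apply Rdiv_lt_0_compat; lra. }
  exists d. split; auto. intros h Hh. specialize (K h Hh).
  replace (c * f (z + h) - c * f z - c * l * h) with (c * (f (z + h) - f z - l * h)) by ring.
  rewrite Cmod_mult.
  apply Rle_trans with ((Cmod c + 1) * (eps / (Cmod c + 1) * Cmod h))%R.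
  - apply Rmult_le_compat; auto; try lra. apply Cmod_ge_0.
  - right. field. lra.
Qed.

Lemma cder_mult f g (l : C) m z :
  cder f l z -> cder g m z -> cder (fun x => f x * g x) (l * g z + f z * m) z.
Proof.
  intros Hf Hg.
  (* polarization *)
  apply cder_ext with (f := fun x => / 4 * ((f x + g x) * (f x + g x) +
     (-1) * ((f x + (-1) * g x) * (f x + (-1) * g x)))).
  { intros x. field; intros E; apply RtoC_inj in E; lra. }
  eapply cder_eq.
  - apply cder_scal, cder_plus; [|apply cder_scal].
    + apply (cder_comp (fun y => y * y)). apply cder_sqr. apply cder_plus; eauto.
    + apply (cder_comp (fun y => y * y)). apply cder_sqr.
      apply cder_plus; eauto. apply cder_scal; eauto.
  - simpl. field; intros E; apply RtoC_inj in E; lra.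
Qed.

Lemma cder_Cinv z : z <> 0 -> cder Cinv (- / (z * z)) z.
Proof.
  intros Hz eps He. assert (0 < Cmod z)%R as P by (apply Cmod_pos; auto).
  (* The first radius keeps |z + h| above |z| / 2; the second absorbs the exact remainder h^2 / (z^2
     (z + h)). *)
  exists (Rmin (Cmod z / 2) (eps * (Cmod z * Cmod z * Cmod z / 2))). split.
  { apply Rmin_glb_lt. lra. apply Rmult_lt_0_compat; auto. apply Rdiv_lt_0_compat; [|lra].
    repeat apply Rmult_lt_0_compat; auto. }
  intros h Hh.
  assert (Cmod h < Cmod z / 2)%R as L1 by (eapply Rlt_le_trans; [apply Hh|apply Rmin_l]).
  assert (Cmod h < eps * (Cmod z * Cmod z * Cmod z / 2))%R as L2
    by (eapply Rlt_le_trans; [apply Hh|apply Rmin_r]).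
  assert (Cmod z / 2 < Cmod (z + h))%R as L3.
  { pose proof (Cmod_triangle_rev z (- h)). rewrite Cmod_opp in H.
    replace (z - - h) with (z + h) in H by ring. lra. }
  assert (z + h <> 0) as N. { apply (proj2 (Cmod_gt_0 _)). lra. }
  replace (/ (z + h) - / z - - / (z * z) * h) with (h * (h / (z * z * (z + h)))).
  2: { field. auto. }
  rewrite Cmod_mult, Rmult_comm. apply Rmult_le_compat_r. apply Cmod_ge_0.
  rewrite Cmod_div by (repeat apply Cmult_neq_0; auto). rewrite !Cmod_mult.
  assert (0 < Cmod z * Cmod z * Cmod (z + h))%R as Q.
  { repeat apply Rmult_lt_0_compat; auto. lra. }
  apply Rmult_le_reg_r with (Cmod z * Cmod z * Cmod (z + h))%R; auto.
  unfold Rdiv. rewrite Rmult_assoc, Rinv_l by lra. rewrite Rmult_1_r.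
  eapply Rle_trans; [left; apply L2|]. apply Rmult_le_compat_l; [lra|].
  assert (0 < Cmod z * Cmod z)%R by (apply Rmult_lt_0_compat; auto). nra.
Qed.

Lemma cder_inv f (l : C) z : f z <> 0 -> cder f l z -> cder (fun x => / f x) (- l / (f z * f z)) z.
Proof.
  intros Hz H. eapply cder_eq. apply (cder_comp Cinv f); [apply cder_Cinv; exact Hz|exact H].
  field. auto.
Qed.

Lemma cder_pow f (l : C) z n : cder f l z -> cder (fun x => f x ^ n) (INR n * f z ^ (n - 1) * l) z.
Proof.
  intros H. induction n.
  - simpl. eapply cder_eq. apply cder_const. ring.
  - eapply cder_eq. apply (cder_mult f (fun x => f x ^ n)); eauto.
    rewrite S_INR, RtoC_plus. replace (S n - 1)%nat with n by lia. destruct n.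
    + simpl. ring.
    + replace (S n - 1)%nat with n by lia. simpl Cpow. ring.
Qed.

Lemma cder_seq f (l : C) z (h : nat -> C) :
  cder f l z -> cvg h 0 -> (forall n, h n <> 0) ->
  cvg (fun n => (f (z + h n) - f z) / h n) l.
Proof.
  intros H Hh N eps He. destruct (H (eps / 2)%R ltac:(lra)) as [d [P K]].
  destruct (Hh d P) as [M HM]. exists M. intros n Hn. specialize (HM n Hn).
  replace (h n - 0) with (h n) in HM by ring. specialize (K (h n) HM).
  replace ((f (z + h n) - f z) / h n - l) with ((f (z + h n) - f z - l * h n) / h n).
  2: { field; auto. }
  rewrite Cmod_div by auto. assert (0 < Cmod (h n))%R by (apply Cmod_pos; auto).
  apply Rle_lt_trans with (eps / 2)%R; [|lra].
  apply Rmult_le_reg_r with (Cmod (h n)); auto.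
  unfold Rdiv at 1. rewrite Rmult_assoc, Rinv_l by lra. lra.
Qed.

Lemma cder_unique f (l : C) m z : cder f l z -> cder f m z -> l = m.
Proof.
  intros H1 H2. pose (h := fun n => RtoC (/ (INR n + 1))).
  assert (forall n, (0 < INR n + 1)%R) as P by (intros n; pose proof (pos_INR n); lra).
  assert (cvg h 0) as Hh.
  { intros eps He. destruct (archimed_cor1 eps He) as [N [K1 K2]]. exists N. intros n Hn.
    unfold h. replace (RtoC (/ (INR n + 1)) - 0) with (RtoC (/ (INR n + 1))) by ring.
    rewrite Cmod_RtoC_nonneg by (left; apply Rinv_0_lt_compat, P).
    eapply Rlt_trans; [|apply K1]. apply Rinv_lt_contravar.
    - apply Rmult_lt_0_compat; auto. apply lt_0_INR; auto.
    - apply le_INR in Hn. lra. }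
  assert (forall n, h n <> 0) as Hn.
  { intros n E. apply RtoC_inj in E. revert E. apply Rgt_not_eq, Rinv_0_lt_compat, P. }
  eapply cvg_unique; [exact (cder_seq f l z h H1 Hh Hn)|exact (cder_seq f m z h H2 Hh Hn)].
Qed.

(** The mean value theorem fails for complex values, so it is applied to the real and imaginary
    parts along the segment. *)
Lemma cder_line_const (f : C -> C) z w :
  (forall t : R, (0 <= t <= 1)%R -> cder f 0 (z + t * (w - z))) -> f w = f z.
Proof.
  intros H.
  assert (forall p : C -> R, (forall x y : C, p (x - y)%C = (p x - p y)%R) ->
     (forall x : C, Rabs (p x) <= Cmod x)%R -> p (f w) = p (f z)) as A.
  { intros p Hp Bp. pose (phi := fun t : R => p (f (z + t * (w - z)))).
    assert (forall t : R, (0 <= t <= 1)%R -> is_derive phi t 0%R) as D.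
    { intros t Ht. apply is_derive_Reals. intros eps He.
      pose proof (Cmod_ge_0 (w - z)) as P.
      destruct (H t Ht (eps / 2 / (Cmod (w - z) + 1))%R) as [d [Hd K]].
      { apply Rdiv_lt_0_compat; lra. }
      assert (0 < d / (Cmod (w - z) + 1))%R as Q by (apply Rdiv_lt_0_compat; lra).
      exists (mkposreal _ Q). intros h Hh0 Hh. simpl in Hh.
      assert (Cmod (h * (w - z)) < d)%R as L.
      { rewrite Cmod_mult, Cmod_R.
        apply Rmult_lt_compat_r with (r := (Cmod (w - z) + 1)%R) in Hh; [|lra].
        replace (d / (Cmod (w - z) + 1) * (Cmod (w - z) + 1))%R with d in Hh by (field; lra).
        pose proof (Rabs_pos h). nra. }
      specialize (K _ L). rewrite Rminus_0_r. unfold phi. rewrite <- Hp.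
      unfold Rdiv. rewrite Rabs_mult, Rabs_inv.
      assert (0 < Rabs h)%R by (apply Rabs_pos_lt; auto).
      apply Rmult_lt_reg_r with (Rabs h); auto. rewrite Rmult_assoc, Rinv_l by lra.
      rewrite Rmult_1_r. eapply Rle_lt_trans; [apply Bp|].
      replace (z + t * (w - z) + h * (w - z)) with (z + (t + h)%R * (w - z)) in K
        by (rewrite RtoC_plus; ring).
      replace (f (z + (t + h)%R * (w - z)) - f (z + t * (w - z)) - 0 * (h * (w - z)))
        with (f (z + (t + h)%R * (w - z)) - f (z + t * (w - z))) in K by ring.
      eapply Rle_lt_trans; [apply K|]. rewrite Cmod_mult, Cmod_R.
      apply Rle_lt_trans with (eps / 2 * Rabs h)%R; [|nra].
      apply Rle_trans with (eps / 2 / (Cmod (w - z) + 1) * (Rabs h * (Cmod (w - z) + 1)))%R.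
      - apply Rmult_le_compat_l. left; apply Rdiv_lt_0_compat; lra. nra.
      - right; field; lra. }
    destruct (MVT_gen phi 0 1 (fun _ => 0%R)) as [x [_ E]].
    - intros x Hx. rewrite Rmin_left, Rmax_right in Hx by lra. apply D. lra.
    - intros x Hx. rewrite Rmin_left, Rmax_right in Hx by lra.
      apply derivable_continuous_pt. exists 0%R. apply is_derive_Reals. apply D. lra.
    - unfold phi in E. replace (z + 1%R * (w - z)) with w in E by ring.
      replace (z + 0%R * (w - z)) with z in E by ring. lra. }
  pose proof (A Re (fun x y => eq_refl) re_le_Cmod) as ER.
  assert (Im (f w) = Im (f z)) as EI.
  { apply A. reflexivity. intros x. eapply Rle_trans; [apply Rmax_r|apply (Rmax_Cmod x)]. }
  destruct (f w), (f z). unfold Re, Im in *; simpl in *. congruence.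
Qed.

Lemma UHP_near z (h : C) : UHP z -> (Cmod h < Im z)%R -> UHP (z + h).
Proof.
  unfold UHP. intros Hz Hh. replace (Im (z + h)) with (Im z + Im h)%R by reflexivity.
  assert (Rabs (Im h) <= Cmod h)%R by (eapply Rle_trans; [apply Rmax_r|apply (Rmax_Cmod h)]).
  pose proof (Rle_abs (- Im h)). rewrite Rabs_Ropp in H0. lra.
Qed.

(** The half-plane is convex, so the segment from z to w stays inside. *)
Lemma cder_UHP_const (f : C -> C) :
  (forall z, UHP z -> cder f 0 z) -> forall z w, UHP z -> UHP w -> f w = f z.
Proof.
  intros H z w Hz Hw. apply cder_line_const. intros t Ht. apply H.
  unfold UHP in *. destruct z as [a b], w as [c d]. unfold Im in *; simpl in *. nra.
Qed.

Lemma cder_UHP_ext f g (l : C) z :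
  UHP z -> (forall w, UHP w -> f w = g w) -> cder f l z -> cder g l z.
Proof.
  intros Hz H. apply cder_ext_loc with (d := Im z). apply Hz.
  intros h Hh. apply H, UHP_near; auto.
Qed.

(** * The complex exponential and the powers of q *)

Lemma Cexp_plus z (w : C) : Cexp (z + w) = Cexp z * Cexp w.
Proof.
  destruct z as [a b], w as [c d]. unfold Cexp, Cmult, Re, Im; simpl.
  rewrite exp_plus, cos_plus, sin_plus. f_equal; ring.
Qed.

Lemma Cexp_0 : Cexp 0 = 1.
Proof. unfold Cexp, Re, Im; simpl. rewrite exp_0, cos_0, sin_0. unfold RtoC. f_equal; ring. Qed.

Lemma Cmod_Cexp z : Cmod (Cexp z) = exp (Re z).
Proof.
  unfold Cexp, Cmod; simpl fst; simpl snd.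
  replace ((exp (Re z) * cos (Im z)) ^ 2 + (exp (Re z) * sin (Im z)) ^ 2)%R
   with ((exp (Re z)) ^ 2 * (Rsqr (sin (Im z)) + Rsqr (cos (Im z))))%R
   by (unfold Rsqr; ring).
  rewrite sin2_cos2, Rmult_1_r, sqrt_pow2; auto. left; apply exp_pos.
Qed.

Lemma Cexp_neq_0 z : Cexp z <> 0.
Proof.
  intros E. pose proof (Cmod_Cexp z). rewrite E, Cmod_0 in H.
  pose proof (exp_pos (Re z)). lra.
Qed.

Lemma Cexp_opp z : Cexp (- z) = / Cexp z.
Proof.
  assert (Cexp (- z) * Cexp z = 1) as E.
  { rewrite <- Cexp_plus. replace (- z + z) with (RtoC 0) by ring. apply Cexp_0. }
  replace (/ Cexp z) with (1 * / Cexp z) by ring. rewrite <- E. field. apply Cexp_neq_0.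
Qed.

Lemma Cexp_pow z n : Cexp z ^ n = Cexp (INR n * z).
Proof.
  induction n. { simpl. rewrite Cmult_0_l, Cexp_0; auto. }
  rewrite S_INR, RtoC_plus. simpl Cpow. rewrite IHn, <- Cexp_plus. f_equal. ring.
Qed.

Lemma Cexp_Ci (x : R) : Cexp (Ci * x) = (cos x, sin x).
Proof.
  unfold Cexp, Ci, RtoC, Cmult, Re, Im; simpl.
  replace (0 * x - 1 * 0)%R with 0%R by ring. replace (0 * 0 + 1 * x)%R with x by ring.
  rewrite exp_0, !Rmult_1_l. auto.
Qed.

Lemma Cexp_2PI : Cexp (2 * PI * Ci) = 1.
Proof.
  replace (2 * PI * Ci) with (Ci * (2 * PI)%R) by (rewrite RtoC_mult; ring).
  rewrite Cexp_Ci, cos_2PI, sin_2PI. auto.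
Qed.

Lemma Cexp_2PI_nat n : Cexp (2 * PI * Ci * INR n) = 1.
Proof.
  rewrite Cmult_comm, <- Cexp_pow, Cexp_2PI. apply Cpow_1_l.
Qed.

Lemma Cexp_2PI_Z (n : Z) : Cexp (2 * PI * Ci * IZR n) = 1.
Proof.
  destruct (Z_le_gt_dec 0 n) as [H|H].
  - rewrite <- (Z2Nat.id n) by lia. rewrite <- INR_IZR_INZ. apply Cexp_2PI_nat.
  - replace (2 * PI * Ci * IZR n) with (- (2 * PI * Ci * INR (Z.to_nat (- n)))).
    rewrite Cexp_opp, Cexp_2PI_nat. field; intros E; apply RtoC_inj in E; lra.
    rewrite INR_IZR_INZ, Z2Nat.id by lia. rewrite opp_IZR, RtoC_opp. ring.
Qed.

Lemma Rderiv_bound (f : R -> R) (x l : R) : derivable_pt_lim f x l ->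
  forall eps, (0 < eps)%R -> exists d, (0 < d)%R /\ forall h : R, (Rabs h < d)%R ->
   (Rabs (f (x + h) - f x - l * h) <= eps * Rabs h)%R.
Proof.
  intros H eps He. destruct (H eps He) as [d K]. exists d. split. apply cond_pos.
  intros h Hh. destruct (Req_dec h 0) as [->|N].
  - replace (f (x + 0) - f x - l * 0)%R with 0%R by (rewrite Rplus_0_r; ring).
    rewrite Rabs_R0. lra.
  - specialize (K h N Hh).
    replace (f (x + h) - f x - l * h)%R with (((f (x + h) - f x) / h - l) * h)%R by (field; auto).
    rewrite Rabs_mult. apply Rmult_le_compat_r. apply Rabs_pos. lra.
Qed.

Lemma cder_Cexp_0 : cder Cexp 1 0.
Proof.
  intros eps He0.
  (* Each coordinate of the remainder will be at most 4 e |h|, and passing to the modulus costs a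
     factor at most 2; the cap 1 keeps exp x below 2. *)
  set (e := (Rmin eps 1 / 10)%R).
  assert (0 < e <= / 10 /\ 10 * e <= eps)%R as [He Hee].
  { unfold e. pose proof (Rmin_l eps 1). pose proof (Rmin_r eps 1).
    assert (0 < Rmin eps 1)%R by (apply Rmin_glb_lt; lra). lra. }
  destruct (Rderiv_bound exp 0 1) with (eps := e) as [d1 [P1 K1]]; try lra.
  { rewrite <- exp_0. apply derivable_pt_lim_exp. }
  destruct (Rderiv_bound cos 0 0) with (eps := e) as [d2 [P2 K2]]; try lra.
  { replace 0%R with (- sin 0)%R at 2 by (rewrite sin_0; ring). apply derivable_pt_lim_cos. }
  destruct (Rderiv_bound sin 0 1) with (eps := e) as [d3 [P3 K3]]; try lra.
  { rewrite <- cos_0. apply derivable_pt_lim_sin. }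
  exists (Rmin e (Rmin d1 (Rmin d2 d3))). split. { repeat apply Rmin_glb_lt; lra. }
  intros h Hh.
  assert (Cmod h < e /\ Cmod h < d1 /\ Cmod h < d2 /\ Cmod h < d3)%R as [L0 [L1 [L2 L3]]].
  { apply Rmin_Rgt in Hh. destruct Hh as [? Hh]. apply Rmin_Rgt in Hh. destruct Hh as [? Hh].
    apply Rmin_Rgt in Hh. lra. }
  rewrite Cplus_0_l, Cexp_0, Cmult_1_l.
  assert (Rabs (Re h) <= Cmod h)%R as Bx by apply re_le_Cmod.
  assert (Rabs (Im h) <= Cmod h)%R as By
    by (eapply Rle_trans; [apply Rmax_r|apply (Rmax_Cmod h)]).
  specialize (K1 (Re h) ltac:(lra)). specialize (K2 (Im h) ltac:(lra)).
  specialize (K3 (Im h) ltac:(lra)). rewrite Rplus_0_l in *.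
  rewrite exp_0, cos_0, sin_0 in *.
  set (x := Re h) in *. set (y := Im h) in *.
  (* The first-order remainders of exp, cos and sin. Once the product exp x (cos y + i sin y) is
     expanded in them, every term left over is O(e |h|). *)
  set (al := (exp x - 1 - 1 * x)%R) in *. set (be := (cos y - 1 - 0 * y)%R) in *.
  set (ga := (sin y - 0 - 1 * y)%R) in *.
  assert (Cexp h - 1 - h = ((al + (1 + x + al) * be)%R, (x * y + al * y + (1 + x + al) * ga)%R)) as ->.
  { unfold Cexp, Cminus, Cplus, Copp, RtoC; simpl.
    replace (fst h) with x by reflexivity. replace (snd h) with y by reflexivity.
    fold x y. unfold al, be, ga. f_equal; ring. }
  pose proof (Cmod_ge_0 h). pose proof (Rabs_pos x). pose proof (Rabs_pos y).
  assert (Rabs (1 + x + al) <= 2)%R as B2.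
  { eapply Rle_trans; [apply Rabs_triang|].
    assert (Rabs (1 + x) <= 1 + Rabs x)%R.
    { eapply Rle_trans; [apply Rabs_triang|]. rewrite Rabs_R1; lra. } nra. }
  assert (Rabs (al + (1 + x + al) * be) <= 3 * e * Cmod h)%R as C1.
  { eapply Rle_trans; [apply Rabs_triang|]. rewrite Rabs_mult.
    assert (Rabs (1 + x + al) * Rabs be <= 2 * (e * Cmod h))%R.
    { apply Rmult_le_compat; try apply Rabs_pos; auto.
      eapply Rle_trans; [apply K2|]. apply Rmult_le_compat_l; lra. } nra. }
  assert (Rabs (x * y + al * y + (1 + x + al) * ga) <= 4 * e * Cmod h)%R as C2.
  { eapply Rle_trans; [apply Rabs_triang|].
    assert (Rabs ((1 + x + al) * ga) <= 2 * (e * Cmod h))%R.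
    { rewrite Rabs_mult. apply Rmult_le_compat; try apply Rabs_pos; auto.
      eapply Rle_trans; [apply K3|]. apply Rmult_le_compat_l; lra. }
    assert (Rabs (x * y + al * y) <= 2 * (e * Cmod h))%R.
    { eapply Rle_trans; [apply Rabs_triang|]. rewrite !Rabs_mult.
      assert (Rabs x * Rabs y <= e * Cmod h)%R by (apply Rmult_le_compat; lra).
      assert (Rabs al * Rabs y <= e * Cmod h)%R.
      { apply Rmult_le_compat; try apply Rabs_pos; try lra. nra. } lra. }
    lra. }
  eapply Rle_trans; [apply Cmod_2Rmax|]. simpl fst; simpl snd.
  assert (Rmax (Rabs (al + (1 + x + al) * be)) (Rabs (x * y + al * y + (1 + x + al) * ga))
     <= 4 * e * Cmod h)%R as M by (apply Rmax_lub; nra).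
  assert (sqrt 2 <= 2)%R. { replace 2%R with (sqrt (2 * 2)) at 2. apply sqrt_le_1; lra.
    rewrite sqrt_square; lra. }
  assert (0 <= Rmax (Rabs (al + (1 + x + al) * be)) (Rabs (x * y + al * y + (1 + x + al) * ga)))%R.
  { eapply Rle_trans; [apply Rabs_pos|apply Rmax_l]. }
  pose proof (sqrt_pos 2).
  apply Rle_trans with (2 * (4 * e * Cmod h))%R; [apply Rmult_le_compat; auto|].
  nra.
Qed.

Lemma cder_Cexp z : cder Cexp (Cexp z) z.
Proof.
  apply cder_ext with (f := fun x => Cexp z * Cexp (x + (- z))).
  { intros x. rewrite <- Cexp_plus. f_equal. ring. }
  eapply cder_eq. apply cder_scal.
  apply (cder_comp Cexp (fun x => x + - z) 1 1).
  - replace (z + - z) with (RtoC 0) by ring. apply cder_Cexp_0.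
  - eapply cder_eq. apply cder_plus; [apply cder_id|apply cder_const]. ring.
  - ring.
Qed.

Lemma qpow_plus (r s : R) (t : C) : qpow (r + s) t = qpow r t * qpow s t.
Proof. unfold qpow. rewrite <- Cexp_plus, RtoC_plus. f_equal. ring. Qed.

Lemma qpow_neq_0 (r : R) (t : C) : qpow r t <> 0.
Proof. apply Cexp_neq_0. Qed.

Lemma qpow_pow (r : R) (t : C) n : qpow r t ^ n = qpow (INR n * r) t.
Proof. unfold qpow. rewrite Cexp_pow, RtoC_mult. f_equal. ring. Qed.

Lemma Cmod_qpow (r : R) (t : C) : Cmod (qpow r t) = exp (- (2 * PI * r * Im t)).
Proof.
  unfold qpow. rewrite Cmod_Cexp. f_equal. destruct t as [a b].
  unfold Ci, RtoC, Cmult, Re, Im; simpl. ring.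
Qed.

Lemma Cmod_qpow_lt_1 (r : R) (t : C) : (0 < r)%R -> UHP t -> (Cmod (qpow r t) < 1)%R.
Proof.
  intros Hr Ht. rewrite Cmod_qpow, <- exp_0. apply exp_increasing.
  unfold UHP in Ht. pose proof PI_RGT_0.
  assert (0 < 2 * PI * r * Im t)%R. { apply Rmult_lt_0_compat; [apply Rmult_lt_0_compat|]; lra. } lra.
Qed.

Lemma cder_qpow (r : R) (t : C) : cder (qpow r) (2 * PI * Ci * r * qpow r t) t.
Proof.
  unfold qpow. eapply cder_eq. apply (cder_comp Cexp (fun x => 2 * PI * Ci * r * x)).
  apply cder_Cexp. apply cder_scal, cder_id. simpl. ring.
Qed.

(** * Power series on the unit disc *)

(** Absolute convergence is part of the notion because products of series require it. [F] is a
    separate total function, unconstrained off the disc. *)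
Definition disc_series (b : nat -> C) F : Prop := forall x, (Cmod x < 1)%R ->
  bsum (fun k => Cmod (b k * x ^ k)) /\ csum (fun k => b k * x ^ k) (F x).

Lemma disc_series_ext (b : nat -> C) F G : (forall x, (Cmod x < 1)%R -> F x = G x) -> disc_series b F -> disc_series b G.
Proof. intros E H x Hx. rewrite <- E; auto. Qed.

Lemma disc_series_plus (a : nat -> C) (b : nat -> C) F G : disc_series a F -> disc_series b G -> disc_series (fun k => a k + b k) (fun x => F x + G x).
Proof.
  intros H1 H2 x Hx. destruct (H1 x Hx) as [A1 B1]. destruct (H2 x Hx) as [A2 B2]. split.
  - eapply bsum_le; [|apply (bsum_plus _ _ A1 A2)]. intros; simpl.
    rewrite Cmult_plus_distr_r. apply Cmod_triangle.
  - eapply csum_ext; [|apply (csum_plus _ _ _ _ B1 B2)]. intros; simpl; ring.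
Qed.

Lemma disc_series_scal (c : C) (b : nat -> C) F : disc_series b F -> disc_series (fun k => c * b k) (fun x => c * F x).
Proof.
  intros H x Hx. destruct (H x Hx) as [A B]. split.
  - eapply bsum_le; [|apply (bsum_scal (Cmod c) _ (Cmod_ge_0 c) A)]. intros; simpl.
    rewrite <- Cmult_assoc, (Cmod_mult c). lra.
  - eapply csum_ext; [|apply (csum_scal c _ _ B)]. intros; simpl; ring.
Qed.

Lemma cauchy_pow (a : nat -> C) (b : nat -> C) (x : C) n :
  cauchy (fun k => a k * x ^ k) (fun k => b k * x ^ k) n = cauchy a b n * x ^ n.
Proof.
  unfold cauchy. rewrite Cmult_comm, <- psum_scal. apply psum_ext. intros k Hk.
  replace (x ^ n) with (x ^ k * x ^ (n - k)). ring.
  rewrite <- Cpow_add_r. f_equal; lia.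
Qed.

Lemma disc_series_mult (a : nat -> C) (b : nat -> C) F G : disc_series a F -> disc_series b G -> disc_series (cauchy a b) (fun x => F x * G x).
Proof.
  intros H1 H2 x Hx. destruct (H1 x Hx) as [A1 B1]. destruct (H2 x Hx) as [A2 B2]. split.
  - eapply bsum_le; [|apply (bsum_cauchy _ _ A1 A2)]. intros; simpl.
    rewrite cauchy_pow. lra.
  - eapply csum_ext; [|apply (csum_cauchy _ _ _ _ A1 B1 B2)]. intros; simpl.
    apply cauchy_pow.
Qed.

(* The coefficients of F(c x^m). *)
Definition spread (m : nat) (c : C) (b : nat -> C) (k : nat) : C :=
  if (k mod m =? 0)%nat then b (k / m)%nat * c ^ (k / m) else 0.

Lemma div_succ_case k m : (0 < m)%nat ->
  (S k / m = if (S k mod m =? 0)%nat then S (k / m) else k / m)%nat.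
Proof.
  intros Hm. pose proof (Nat.div_mod_eq k m). pose proof (Nat.mod_upper_bound k m ltac:(lia)).
  pose proof (Nat.div_mod_eq (S k) m). pose proof (Nat.mod_upper_bound (S k) m ltac:(lia)).
  destruct (Nat.eqb_spec (S k mod m) 0); nia.
Qed.

Lemma psum_sparse m (b : nat -> C) n : (0 < m)%nat ->
  psum (fun k => if (k mod m =? 0)%nat then b (k / m)%nat else 0) (S n) = psum b (S (n / m)).
Proof.
  intros Hm. induction n.
  - simpl psum. rewrite Nat.Div0.mod_0_l, Nat.Div0.div_0_l. simpl. auto.
  - simpl psum at 1. simpl psum in IHn. rewrite IHn.
    pose proof (div_succ_case n m Hm) as E. destruct (S n mod m =? 0)%nat.
    + rewrite E. simpl. auto.
    + rewrite E. simpl. ring.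
Qed.

Lemma rsum_sparse m (b : nat -> R) n : (0 < m)%nat ->
  rsum (fun k => if (k mod m =? 0)%nat then b (k / m)%nat else 0%R) (S n)
  = rsum b (S (n / m)).
Proof.
  intros Hm. induction n.
  - simpl rsum. rewrite Nat.Div0.mod_0_l, Nat.Div0.div_0_l. simpl. auto.
  - simpl rsum at 1. simpl rsum in IHn. rewrite IHn.
    pose proof (div_succ_case n m Hm) as E. destruct (S n mod m =? 0)%nat.
    + rewrite E. simpl. auto.
    + rewrite E. simpl. ring.
Qed.

Lemma csum_sparse m (b : nat -> C) (l : C) : (0 < m)%nat -> csum b l ->
  csum (fun k => if (k mod m =? 0)%nat then b (k / m)%nat else 0) l.
Proof.
  intros Hm H. apply cvg_shift_inv with (k := 1%nat).
  intros eps He. destruct (H eps He) as [N K]. exists (m * N)%nat. intros n Hn.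
  rewrite Nat.add_1_r, psum_sparse by auto. apply K.
  assert (N <= n / m)%nat by (apply Nat.div_le_lower_bound; lia). lia.
Qed.

Lemma csum_sparse_inv m (b : nat -> C) (l : C) : (0 < m)%nat ->
  csum (fun k => if (k mod m =? 0)%nat then b (k / m)%nat else 0) l -> csum b l.
Proof.
  intros Hm H. apply cvg_shift_inv with (k := 1%nat).
  apply (cvg_subseq _ _ (fun n => S (m * n))) in H; [|intros; nia].
  eapply cvg_ext; [|exact H]. intros n. cbv beta. rewrite psum_sparse by auto.
  rewrite Nat.mul_comm, Nat.div_mul, Nat.add_1_r by lia. reflexivity.
Qed.

(** Needed for q((A tau + B)/D), which is a root of unity times a power of the local parameter: c is
    the root of unity coming from B. *)
Lemma disc_series_spread m (c : C) (b : nat -> C) F : (0 < m)%nat -> Cmod c = 1%R -> disc_series b F ->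
  disc_series (spread m c b) (fun x => F (c * x ^ m)).
Proof.
  intros Hm Hc H x Hx.
  assert (Cmod (c * x ^ m) < 1)%R as Hx'.
  { rewrite Cmod_mult, Hc, Cmod_pow, Rmult_1_l. apply pow_lt_1_compat; [|lia].
    split; [apply Cmod_ge_0|auto]. }
  destruct (H _ Hx') as [A B].
  assert (forall k, spread m c b k * x ^ k =
    if (k mod m =? 0)%nat then b (k / m)%nat * (c * x ^ m) ^ (k / m) else 0) as E.
  { intros k. unfold spread. destruct (Nat.eqb_spec (k mod m) 0) as [e|]; [|ring].
    rewrite Cpow_mult_l, <- Cpow_mult_r. rewrite <- Cmult_assoc. do 3 f_equal.
    pose proof (Nat.div_mod_eq k m). lia. }
  split.
  - destruct A as [M A]. exists M. intros n. destruct n.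
    { specialize (A O). simpl in *. lra. }
    rewrite (rsum_ext _ (fun k => if (k mod m =? 0)%nat then
       Cmod (b (k / m)%nat * (c * x ^ m) ^ (k / m)) else 0%R)).
    rewrite (rsum_sparse m (fun k => Cmod (b k * (c * x ^ m) ^ k))); auto.
    intros k _. rewrite E. destruct (k mod m =? 0)%nat; auto. apply Cmod_0.
  - eapply csum_ext; [|apply (csum_sparse m _ _ Hm B)]. intros k; simpl. rewrite E; auto.
Qed.

Lemma disc_series_const (c : C) : disc_series (fun k => if (k =? 0)%nat then c else 0) (fun _ => c).
Proof.
  intros x Hx.
  assert (forall n, psum (fun k => (if (k =? 0)%nat then c else 0) * x ^ k) (S n) = c) as E.
  { induction n. simpl. ring. simpl psum at 1. simpl psum in IHn. rewrite IHn. simpl. ring. }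
  split.
  - exists (Cmod c). intros n. 
    assert (rsum (fun k => Cmod ((if (k =? 0)%nat then c else 0) * x ^ k)) (S n) = Cmod c) as Er.
    { clear E. induction n. simpl. replace (c * 1) with c by ring. ring.
      simpl rsum at 1. simpl rsum in IHn. rewrite IHn. simpl.
      rewrite Cmult_0_l, Cmod_0. ring. }
    rewrite <- Er. apply rsum_mono; auto. intros; apply Cmod_ge_0.
  - apply cvg_shift_inv with (k := 1%nat). eapply cvg_ext; [|apply cvg_const].
    intros n. rewrite Nat.add_1_r, E. auto.
Qed.

Lemma disc_series_id : disc_series (fun k => if (k =? 1)%nat then 1 else 0) (fun x => x).
Proof.
  intros x Hx.
  assert (forall k, (2 <= k)%nat -> (if (k =? 1)%nat then 1 else 0) * x ^ k = 0) as E0.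
  { intros [|[|k]] Hk; try lia. simpl. ring. }
  split.
  - apply bsum_shift_inv with (k := 2%nat). exists 0%R. intros n.
    rewrite (rsum_ext _ (fun _ => 0%R)).
    + induction n; simpl; lra.
    + intros k _. rewrite E0 by lia. apply Cmod_0.
  - pose proof (csum_finite (fun k => (if (k =? 1)%nat then 1 else 0) * x ^ k) 2 E0) as H.
    simpl in H. replace (0 + 0 * 1 + 1 * (x * 1)) with x in H by ring. exact H.
Qed.

Lemma disc_series_pow (b : nat -> C) F m : disc_series b F -> exists b', disc_series b' (fun x => F x ^ m).
Proof.
  intros H. induction m as [|m [b' IH]].
  - eexists. apply (disc_series_const 1).
  - eexists. simpl. apply (disc_series_mult _ _ _ _ H IH).
Qed.

(** The left side is at most the divided difference (r^n - rho^n)/(r - rho). It makes differentiated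
    power series geometrically dominated. *)
Lemma deriv_coef_bound (r rho : R) n : (0 <= rho < r)%R ->
  (INR n * rho ^ (n - 1) <= r ^ n / (r - rho))%R.
Proof.
  intros H. induction n.
  - simpl. rewrite Rmult_0_l. left. apply Rdiv_lt_0_compat; lra.
  - replace (S n - 1)%nat with n by lia.
    assert (INR (S n) * rho ^ n = rho * (INR n * rho ^ (n - 1)) + rho ^ n)%R as ->.
    { rewrite S_INR. destruct n. simpl; ring. replace (S n - 1)%nat with n by lia. simpl; ring. }
    assert (rho ^ n <= r ^ n)%R by (apply pow_incr; lra).
    apply Rmult_le_compat_l with (r := rho) in IHn; [|lra].
    replace (r ^ S n / (r - rho))%R with (rho * (r ^ n / (r - rho)) + r ^ n)%R.
    lra. simpl. field. lra.
Qed.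

(** A second-order Taylor remainder, geometric in n with the factor |h|^2 split off, so that it can
    be summed against the coefficients of a power series. *)
Lemma pow_taylor_bound (x : C) (h : C) (r rho : R) n :
  (Cmod x <= rho)%R -> (Cmod (x + h) <= rho)%R -> (rho < r)%R ->
  (Cmod ((x + h) ^ n - x ^ n - INR n * x ^ (n - 1) * h)
   <= Cmod h * Cmod h * (r ^ n / ((r - rho) * (r - rho))))%R.
Proof.
  intros H1 H2 H3. pose proof (Cmod_ge_0 x). pose proof (Cmod_ge_0 h). 
  induction n.
  - simpl. replace (1 - 1 - 0 * 1 * h) with (RtoC 0) by ring. rewrite Cmod_0.
    repeat apply Rmult_le_pos; auto. lra. left. apply Rinv_0_lt_compat. nra.
  - replace (S n - 1)%nat with n by lia.
    assert ((x + h) ^ S n - x ^ S n - INR (S n) * x ^ n * h =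
      (x + h) * ((x + h) ^ n - x ^ n - INR n * x ^ (n - 1) * h) + INR n * x ^ (n - 1) * (h * h)) as ->.
    { rewrite S_INR, RtoC_plus. destruct n. simpl; ring.
      replace (S n - 1)%nat with n by lia. simpl. ring. }
    eapply Rle_trans; [apply Cmod_triangle|]. rewrite !Cmod_mult, Cmod_pow.
    rewrite (Cmod_RtoC_nonneg (INR n)) by apply pos_INR.
    assert (INR n * Cmod x ^ (n - 1) <= r ^ n / (r - rho))%R.
    { eapply Rle_trans; [|apply deriv_coef_bound; lra].
      apply Rmult_le_compat_l. apply pos_INR. apply pow_incr. lra. }
    set (A := Cmod (x + h)) in *. set (B := Cmod (_ - _)) in *.
    assert (A * B <= rho * (Cmod h * Cmod h * (r ^ n / ((r - rho) * (r - rho)))))%R.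
    { apply Rmult_le_compat; auto; apply Cmod_ge_0. }
    replace (Cmod h * Cmod h * (r ^ S n / ((r - rho) * (r - rho))))%R with
     (rho * (Cmod h * Cmod h * (r ^ n / ((r - rho) * (r - rho))))
       + r ^ n / (r - rho) * (Cmod h * Cmod h))%R.
    2: { simpl. field. lra. }
    apply Rplus_le_compat; auto. apply Rmult_le_compat_r; auto. nra.
Qed.

Lemma disc_series_bsum_R (b : nat -> C) F (r : R) : disc_series b F -> (0 <= r < 1)%R ->
  bsum (fun n => Cmod (b n) * r ^ n)%R.
Proof.
  intros H Hr. destruct (H (RtoC r)) as [A _]. { rewrite Cmod_RtoC_nonneg; lra. }
  eapply bsum_le; [|apply A]. intros n; simpl.
  rewrite Cmod_mult, Cmod_pow, Cmod_RtoC_nonneg by lra. lra.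
Qed.

Lemma disc_series_cder (b : nat -> C) F (x : C) : disc_series b F -> (Cmod x < 1)%R ->
  exists D, csum (fun n => b n * (INR n * x ^ (n - 1))) D /\ cder F D x.
Proof.
  intros H Hx. pose proof (Cmod_ge_0 x) as P.
  (* The disc of radius rho is to contain x + h; the larger radius r, still below 1, is where the
     coefficients are summed. *)
  set (r := ((1 + Cmod x) / 2)%R). set (rho := ((Cmod x + r) / 2)%R).
  assert (Cmod x < rho < r /\ r < 1)%R as [[L1 L2] L3] by (unfold rho, r; lra).
  pose proof (disc_series_bsum_R b F r H ltac:(lra)) as Hb.
  destruct (bsum_csum (fun n => b n * (INR n * x ^ (n - 1)))
     (fun n => / (r - Cmod x) * (Cmod (b n) * r ^ n))%R) as [D HD].
  { intros n. rewrite !Cmod_mult, Cmod_pow, (Cmod_RtoC_nonneg (INR n)) by apply pos_INR.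
    pose proof (deriv_coef_bound r (Cmod x) n ltac:(lra)).
    apply Rle_trans with (Cmod (b n) * (r ^ n / (r - Cmod x)))%R.
    apply Rmult_le_compat_l; auto. apply Cmod_ge_0. right; field. lra. }
  { apply bsum_scal; auto. left; apply Rinv_0_lt_compat; lra. }
  exists D. split; auto. intros eps He. destruct Hb as [B HB].
  assert (0 <= B)%R as B0 by (apply (HB O)).
  set (K := ((r - rho) * (r - rho))%R). assert (0 < K)%R as K0.
  { unfold K. apply Rmult_lt_0_compat; lra. }
  exists (Rmin (rho - Cmod x) (eps * K / (B + 1))). split.
  { apply Rmin_glb_lt. lra. apply Rdiv_lt_0_compat; [|lra]. apply Rmult_lt_0_compat; auto. }
  intros h Hh. apply Rmin_Rgt in Hh. destruct Hh as [h1 h2].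
  pose proof (Cmod_triangle x h) as T.
  assert (csum (fun n => b n * ((x + h) ^ n - x ^ n - INR n * x ^ (n - 1) * h))
     (F (x + h) - F x - D * h)) as S.
  { rewrite (Cmult_comm D).
    destruct (H (x + h) ltac:(lra)) as [_ S1]. destruct (H x Hx) as [_ S2].
    eapply csum_ext; [|apply (csum_minus _ _ _ _ (csum_minus _ _ _ _ S1 S2) (csum_scal h _ _ HD))].
    intros n; simpl. ring. }
  apply Rle_trans with (Cmod h * Cmod h / K * B)%R.
  - apply (csum_le _ (fun n => (Cmod h * Cmod h / K * (Cmod (b n) * r ^ n))%R) _ _) with (3 := S).
    + intros n. rewrite Cmod_mult.
      eapply Rle_trans. apply Rmult_le_compat_l. apply Cmod_ge_0.
      apply (pow_taylor_bound x h r rho n); lra.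
      apply Req_le. unfold K. field. lra.
    + intros n. rewrite rsum_scal. apply Rmult_le_compat_l; auto.
      apply Rmult_le_pos. apply Rmult_le_pos; apply Cmod_ge_0.
      left; apply Rinv_0_lt_compat; auto.
  - pose proof (Cmod_ge_0 h).
    assert (Cmod h * (B + 1) <= eps * K)%R.
    { apply Rgt_lt, Rmult_lt_compat_r with (r := (B + 1)%R) in h2; [|lra].
      replace (eps * K / (B + 1) * (B + 1))%R with (eps * K)%R in h2 by (field; lra). lra. }
    replace (Cmod h * Cmod h / K * B)%R with (Cmod h * (Cmod h * B / K))%R by (field; lra).
    rewrite (Rmult_comm eps). apply Rmult_le_compat_l; auto.
    apply Rmult_le_reg_r with K; auto. unfold Rdiv. rewrite Rmult_assoc, Rinv_l by lra. nra.
Qed.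

Lemma Clim_seq_cvg (u : nat -> C) (l : C) : cvg u l -> Clim_seq u = l.
Proof.
  intros H. unfold Clim_seq. destruct l as [l1 l2].
  assert (forall (p : C -> R) (m : R), (forall x, p (x - (l1, l2))%C = (p x - m)%R) ->
    (forall x, Rabs (p x) <= Cmod x)%R -> Lim_seq (fun n => p (u n)) = m) as A.
  { intros p m E B. apply is_lim_seq_unique. apply is_lim_seq_Reals.
    intros eps He. destruct (H eps He) as [N K]. exists N. intros n Hn.
    unfold Rdist. rewrite <- E. eapply Rle_lt_trans; [apply B|apply K, Hn]. }
  rewrite (A Re l1), (A Im l2); [reflexivity| | | |].
  - intros x. destruct x; reflexivity.
  - intros x. eapply Rle_trans; [apply Rmax_r|apply (Rmax_Cmod x)].
  - intros x. destruct x; reflexivity.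
  - apply re_le_Cmod.
Qed.

(** * Euler products *)

Lemma cvg_geom_0 (x : C) : (Cmod x < 1)%R -> cvg (fun n => x ^ n) 0.
Proof.
  intros Hx eps He. destruct (pow_lt_1_zero (Cmod x)) with (y := eps) as [N K]; auto.
  { rewrite Rabs_pos_eq; auto. apply Cmod_ge_0. }
  exists N. intros n Hn. specialize (K n Hn).
  replace (x ^ n - 0) with (x ^ n) by ring. rewrite Cmod_pow.
  rewrite Rabs_pos_eq in K; auto. apply pow_le, Cmod_ge_0.
Qed.

Lemma rsum_geom_le (r : R) n : (0 <= r < 1)%R -> (rsum (fun k => r ^ k) n <= / (1 - r))%R.
Proof.
  intros H. assert (rsum (fun k => r ^ k)%R n = (1 - r ^ n) / (1 - r))%R as ->.
  { induction n; simpl. field; lra. rewrite IHn. field; lra. }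
  assert (0 <= r ^ n)%R by (apply pow_le; lra).
  unfold Rdiv. rewrite <- (Rmult_1_l (/ (1 - r))) at 2. apply Rmult_le_compat_r; [|lra].
  left; apply Rinv_0_lt_compat; lra.
Qed.

Lemma one_minus_neq_0 (x : C) : (Cmod x < 1)%R -> 1 - x <> 0.
Proof.
  intros H E. assert (x = 1) as -> by (replace x with (1 - (1 - x)) by ring; rewrite E; ring).
  rewrite Cmod_1 in H. lra.
Qed.

Lemma Cmod_pow_S_lt_1 (x : C) m : (Cmod x < 1)%R -> (Cmod (x ^ S m) < 1)%R.
Proof.
  intros H. rewrite Cmod_pow. apply pow_lt_1_compat; [|lia]. split; auto. apply Cmod_ge_0.
Qed.

Lemma disc_series_geom : disc_series (fun _ => 1) (fun x => / (1 - x)).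
Proof.
  intros x Hx. pose proof (one_minus_neq_0 x Hx) as N. split.
  - exists (/ (1 - Cmod x))%R. intros n. 
    rewrite (rsum_ext _ (fun k => (Cmod x ^ k)%R)).
    apply rsum_geom_le. split; auto; apply Cmod_ge_0.
    intros; rewrite Cmult_1_l, Cmod_pow; auto.
  - apply cvg_ext with (u := fun n => (1 - x ^ n) * / (1 - x)).
    + intros n. induction n; simpl. { field; auto. } rewrite <- IHn. simpl. field; auto.
    + replace (/ (1 - x)) with ((1 - 0) * / (1 - x)) at 1 by (field; auto).
      apply cvg_mult; [|apply cvg_const]. apply cvg_minus. apply cvg_const.
      apply cvg_geom_0; auto.
Qed.

Definition one_minus_coef (k : nat) : C :=
  (if (k =? 0)%nat then 1 else 0) + (-1) * (if (k =? 1)%nat then 1 else 0).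

Lemma disc_series_one_minus : disc_series one_minus_coef (fun x => 1 - x).
Proof.
  eapply disc_series_ext; [|apply (disc_series_plus _ _ _ _ (disc_series_const 1) (disc_series_scal (-1) _ _ disc_series_id))].
  intros; simpl; ring.
Qed.

(* Coefficients of the finite product of the F(x^m), 1 <= m <= N. *)
Fixpoint prod_coef (b : nat -> C) (N : nat) : nat -> C :=
  match N with
  | O => fun k => if (k =? 0)%nat then 1 else 0
  | S p => cauchy (prod_coef b p) (spread N 1 b)
  end.

(** The number of partitions of k into parts of size at most N. These are the coefficients for F(x)
    = 1/(1 - x), and they dominate [prod_coef b N] whenever all b_k have modulus at most 1. *)
Fixpoint prod_coef_R (N : nat) : nat -> R :=
  match N with
  | O => fun k => if (k =? 0)%nat then 1%R else 0%R
  | S p => fun k =>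
     rsum (fun j => prod_coef_R p j * (if ((k - j) mod N =? 0)%nat then 1 else 0))%R (S k)
  end.

Lemma disc_series_prod_coef (b : nat -> C) F N : disc_series b F ->
  disc_series (prod_coef b N) (fun x => Cprod_n (fun m => F (x ^ S m)) N).
Proof.
  intros H. induction N. apply (disc_series_const 1). simpl prod_coef. simpl Cprod_n.
  apply disc_series_mult; auto.
  eapply disc_series_ext; [|apply (disc_series_spread (S N) 1 b F)]; auto; try lia; try apply Cmod_1.
  intros x _. cbv beta. rewrite Cmult_1_l. reflexivity.
Qed.

(** The new factor F(x^(N+1)) is 1 + O(x^(N+1)), so the coefficients up to N are final. *)
Lemma prod_coef_stable (b : nat -> C) N k : b O = 1 -> (k <= N)%nat -> prod_coef b (S N) k = prod_coef b N k.
Proof.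
  intros H0 Hk. simpl. unfold cauchy. simpl psum. rewrite Nat.sub_diag.
  rewrite (psum_ext _ (fun _ => 0)), psum_0.
  - unfold spread. rewrite Nat.Div0.mod_0_l, Nat.Div0.div_0_l, H0. simpl. ring.
  - intros j Hj. unfold spread. rewrite Nat.mod_small by lia.
    destruct (Nat.eqb_spec (k - j) 0). lia. ring.
Qed.

Lemma prod_coef_limit (b : nat -> C) N k : b O = 1 -> (k <= N)%nat -> prod_coef b N k = prod_coef b k k.
Proof.
  intros H0 Hk. induction Hk; auto. rewrite prod_coef_stable; auto.
Qed.

Lemma prod_coef_R_nonneg N k : (0 <= prod_coef_R N k)%R.
Proof.
  revert k; induction N; intros k.
  - simpl. destruct (k =? 0)%nat; lra.
  - cbn [prod_coef_R]. apply rsum_nonneg. intros j. apply Rmult_le_pos; auto.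
    destruct ((k - j) mod S N =? 0)%nat; lra.
Qed.

Lemma prod_coef_le (b : nat -> C) N k : (forall k, (Cmod (b k) <= 1)%R) ->
  (Cmod (prod_coef b N k) <= prod_coef_R N k)%R.
Proof.
  intros H. revert k; induction N; intros k.
  - simpl. destruct (k =? 0)%nat. rewrite Cmod_1; lra. rewrite Cmod_0; lra.
  - cbn [prod_coef]; unfold cauchy. apply Cmod_psum_le. intros j _.
    rewrite Cmod_mult. apply Rmult_le_compat; auto using Cmod_ge_0.
    unfold spread. destruct ((k - j) mod S N =? 0)%nat.
    + rewrite Cpow_1_l, Cmult_1_r. auto.
    + rewrite Cmod_0; lra.
Qed.

Lemma prod_coef_one N k : prod_coef (fun _ => 1) N k = RtoC (prod_coef_R N k).
Proof.
  revert k; induction N; intros k.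
  - simpl. destruct (k =? 0)%nat; auto.
  - cbn [prod_coef prod_coef_R]. unfold cauchy. rewrite <- psum_RtoC.
    apply psum_ext. intros j _. rewrite IHN, RtoC_mult. f_equal.
    unfold spread. destruct ((k - j) mod S N =? 0)%nat; auto.
    rewrite Cpow_1_l. ring.
Qed.

Lemma prod_coef_R_mono N k : (prod_coef_R N k <= prod_coef_R (S N) k)%R.
Proof.
  cbn [prod_coef_R]. cbn [rsum]. rewrite Nat.sub_diag, Nat.Div0.mod_0_l, Nat.eqb_refl, Rmult_1_r.
  match goal with |- (_ <= ?s + _)%R => assert (0 <= s)%R end; [|lra].
  apply rsum_nonneg. intros j. apply Rmult_le_pos. apply prod_coef_R_nonneg.
  destruct ((k - j) mod S N =? 0)%nat; lra.
Qed.

Lemma prod_coef_R_mono_le N M k : (N <= M)%nat -> (prod_coef_R N k <= prod_coef_R M k)%R.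
Proof.
  intros H; induction H. lra. eapply Rle_trans; [apply IHle|apply prod_coef_R_mono].
Qed.

Lemma prod_coef_R_limit N k : (prod_coef_R N k <= prod_coef_R k k)%R.
Proof.
  destruct (Nat.le_ge_cases N k). apply prod_coef_R_mono_le; auto.
  apply Req_le, RtoC_inj. rewrite <- !prod_coef_one. apply prod_coef_limit; auto.
Qed.

(** With t = r^m <= r, each factor is 1/(1 - t) = 1 + t/(1 - t) <= exp(t/(1 - r)). *)
Lemma Cprod_n_le_exp (r : R) N : (0 <= r < 1)%R -> exists y : R,
  Cprod_n (fun m => / (1 - r ^ S m)) N = RtoC y /\
  (0 <= y <= exp (rsum (fun m => r ^ S m / (1 - r))%R N))%R.
Proof.
  intros Hr. induction N.
  - simpl. exists 1%R. rewrite exp_0. split; auto; lra.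
  - destruct IHN as [y [E Hy]].
    assert (0 <= r ^ S N <= r)%R as Hs.
    { split. apply pow_le; lra. assert (r ^ N <= 1)%R by (rewrite <- (pow1 N); apply pow_incr; lra).
      simpl. nra. }
    exists (y * / (1 - r ^ S N))%R. split.
    { cbn [Cprod_n]. rewrite E, RtoC_mult. f_equal. rewrite RtoC_inv by lra.
      rewrite RtoC_minus, RtoC_pow. auto. }
    assert (0 < / (1 - r ^ S N))%R by (apply Rinv_0_lt_compat; lra).
    cbn [rsum]. rewrite exp_plus. split. { apply Rmult_le_pos; lra. }
    apply Rmult_le_compat; try lra.
    eapply Rle_trans; [|apply exp_ineq1_le].
    apply Rle_trans with (1 + r ^ S N / (1 - r ^ S N))%R.
    + right. field. lra.
    + apply Rplus_le_compat_l. apply Rmult_le_compat_l; [lra|].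
      apply Rinv_le_contravar; lra.
Qed.

(** The first n terms are bounded by the whole series of the product of n factors, whose value is
    bounded independently of n. *)
Lemma partition_majorant (r : R) : (0 <= r < 1)%R -> bsum (fun k => prod_coef_R k k * r ^ k)%R.
Proof.
  intros Hr. exists (exp (/ (1 - r) * / (1 - r)))%R. intros n.
  eapply Rle_trans.
  { apply rsum_le with (b := fun k => (prod_coef_R n k * r ^ k)%R). intros k Hk.
    apply Rmult_le_compat_r. apply pow_le; lra. apply prod_coef_R_mono_le. lia. }
  destruct (Cprod_n_le_exp r n Hr) as [y [E Hy]].
  assert (Cmod r < 1)%R as Hr' by (rewrite Cmod_RtoC_nonneg; lra).
  destruct (disc_series_prod_coef _ _ n disc_series_geom r Hr') as [_ Hs]. rewrite E in Hs.
  apply Rle_trans with y.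
  - apply Rnot_lt_le. intros L.
    set (s := rsum (fun k => prod_coef_R n k * r ^ k)%R n) in *.
    destruct (Hs (s - y)%R) as [N K]. lra.
    specialize (K (max n N) ltac:(lia)).
    rewrite (psum_ext _ (fun k => RtoC (prod_coef_R n k * r ^ k))) in K.
    2: { intros k _. rewrite prod_coef_one, RtoC_mult, RtoC_pow; auto. }
    rewrite psum_RtoC, <- RtoC_minus, Cmod_R in K.
    assert (s <= rsum (fun k => prod_coef_R n k * r ^ k)%R (max n N))%R.
    { apply rsum_mono; [|lia]. intros k. apply Rmult_le_pos. apply prod_coef_R_nonneg.
      apply pow_le; lra. }
    rewrite Rabs_pos_eq in K by lra. lra.
  - eapply Rle_trans; [apply Hy|].
    assert (rsum (fun m => r ^ S m / (1 - r)) n <= / (1 - r) * / (1 - r))%R as L.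
    { rewrite (rsum_ext _ (fun m => (r / (1 - r)) * r ^ m)%R) by (intros; simpl; field; lra).
      rewrite rsum_scal. assert (0 < / (1 - r))%R by (apply Rinv_0_lt_compat; lra).
      apply Rmult_le_compat; auto.
      - apply Rmult_le_pos; lra.
      - apply rsum_nonneg. intros; apply pow_le; lra.
      - unfold Rdiv. rewrite <- (Rmult_1_l (/ (1 - r))) at 2. apply Rmult_le_compat_r; lra.
      - apply rsum_geom_le; auto. }
    destruct L as [L| ->]; [left; apply exp_increasing; auto|lra].
Qed.

(** Tannery's theorem in the number N of factors: the coefficients become stationary, and the
    partition numbers dominate them for all N. *)
Lemma euler_product (b : nat -> C) F (x : C) : disc_series b F -> b O = 1 -> (forall k, (Cmod (b k) <= 1)%R) ->
  (Cmod x < 1)%R -> exists l, cvg (Cprod_n (fun m => F (x ^ S m))) l /\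
   csum (fun k => prod_coef b k k * x ^ k) l /\
   bsum (fun k => Cmod (prod_coef b k k * x ^ k)).
Proof.
  intros H H0 H1 Hx.
  assert (forall N k, (Cmod (prod_coef b N k * x ^ k) <= prod_coef_R k k * Cmod x ^ k)%R) as B.
  { intros N k. rewrite Cmod_mult, Cmod_pow. apply Rmult_le_compat_r.
    apply pow_le, Cmod_ge_0. eapply Rle_trans; [apply prod_coef_le; auto|].
    apply prod_coef_R_limit. }
  assert (bsum (fun k => prod_coef_R k k * Cmod x ^ k)%R) as M.
  { apply partition_majorant. split; auto. apply Cmod_ge_0. }
  destruct (tannery (fun N k => prod_coef b N k * x ^ k) (fun k => prod_coef b k k * x ^ k)
    (Cprod_n (fun m => F (x ^ S m))) (fun k => prod_coef_R k k * Cmod x ^ k)%R) as [l [A1 A2]]; auto.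
  - intros k. apply cvg_ext_loc with (N := k) (u := fun _ => prod_coef b k k * x ^ k).
    + intros n Hn. rewrite (prod_coef_limit b n k); auto.
    + apply cvg_const.
  - intros N. apply (disc_series_prod_coef b F N H x Hx).
  - exists l. split; [|split]; auto. eapply bsum_le; [|apply M]. intros; apply B.
Qed.

Lemma qpoch_cvg (x : C) : (Cmod x < 1)%R ->
  cvg (Cprod_n (fun m => 1 - x ^ S m)) (qpoch x 1 1) /\
  csum (fun k => prod_coef one_minus_coef k k * x ^ k) (qpoch x 1 1) /\
  bsum (fun k => Cmod (prod_coef one_minus_coef k k * x ^ k)).
Proof.
  intros Hx.
  destruct (euler_product one_minus_coef (fun x => 1 - x) x) as [l H]; auto.
  - apply disc_series_one_minus.
  - unfold one_minus_coef; simpl. ring.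
  - intros [|[|k]]; unfold one_minus_coef; simpl.
    + replace (1 + -1 * 0) with (RtoC 1) by ring. rewrite Cmod_1; lra.
    + replace (0 + -1 * 1) with (- RtoC 1) by ring. rewrite Cmod_m1; lra.
    + replace (0 + -1 * 0) with (RtoC 0) by ring. rewrite Cmod_0; lra.
  - replace (qpoch x 1 1) with l; auto. symmetry. apply Clim_seq_cvg.
    eapply cvg_ext; [|apply (proj1 H)]. intros n. induction n as [|n IHn]; [reflexivity|].
    cbn [Cprod_n]. rewrite IHn. do 3 f_equal. f_equal. lia.
Qed.

Lemma Cprod_n_inv (u v : nat -> C) n : (forall k, u k * v k = 1) ->
  Cprod_n u n * Cprod_n v n = 1.
Proof.
  intros H. induction n; simpl. ring.
  replace (Cprod_n u n * u n * (Cprod_n v n * v n)) with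
   ((Cprod_n u n * Cprod_n v n) * (u n * v n)) by ring. rewrite IHn, H; ring.
Qed.

(** The product of the reciprocals converges too, and the two limits multiply to 1. This yields the
    nonvanishing and the power series of the reciprocal together. *)
Lemma qpoch_inv (x : C) : (Cmod x < 1)%R -> qpoch x 1 1 <> 0 /\
  csum (fun k => prod_coef (fun _ => 1) k k * x ^ k) (/ qpoch x 1 1) /\
  bsum (fun k => Cmod (prod_coef (fun _ => 1) k k * x ^ k)).
Proof.
  intros Hx. destruct (qpoch_cvg x Hx) as [H1 _].
  destruct (euler_product (fun _ => 1) (fun x => / (1 - x)) x) as [l [H2 [H3 H4]]]; auto.
  { apply disc_series_geom. } { intros; rewrite Cmod_1; lra. }
  assert (qpoch x 1 1 * l = 1) as E.
  { apply (cvg_unique (fun n => Cprod_n (fun m => 1 - x ^ S m) n *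
      Cprod_n (fun m => / (1 - x ^ S m)) n)).
    - apply cvg_mult; auto.
    - eapply cvg_ext; [|apply cvg_const]. intros n. symmetry. apply Cprod_n_inv.
      intros k. apply Cinv_r. apply one_minus_neq_0, Cmod_pow_S_lt_1, Hx. }
  assert (qpoch x 1 1 <> 0) as N.
  { intros E0. rewrite E0 in E. replace (0 * l) with (RtoC 0) in E by ring.
    apply RtoC_inj in E. lra. }
  replace (/ qpoch x 1 1) with l; auto.
  replace l with (qpoch x 1 1 * l * / qpoch x 1 1) by (field; auto). rewrite E; ring.
Qed.

Lemma disc_series_qpoch : disc_series (fun k => prod_coef one_minus_coef k k) (fun x => qpoch x 1 1).
Proof. intros x Hx. destruct (qpoch_cvg x Hx) as [_ [H1 H2]]. auto. Qed.

Lemma disc_series_qpoch_inv : disc_series (fun k => prod_coef (fun _ => 1) k k) (fun x => / qpoch x 1 1).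
Proof. intros x Hx. destruct (qpoch_inv x Hx) as [_ [H1 H2]]. auto. Qed.

Lemma Cprod_n_neq_0 (u : nat -> C) n : (forall k, u k <> 0) -> Cprod_n u n <> 0.
Proof.
  intros H. induction n; simpl. intros E; apply RtoC_inj in E; lra. apply Cmult_neq_0; auto.
Qed.

Lemma cder_finite_product (x : C) N : (Cmod x < 1)%R ->
  cder (fun x => Cprod_n (fun m => 1 - x ^ S m) N)
   (- (Cprod_n (fun m => 1 - x ^ S m) N * psum (fun m => INR (S m) * x ^ m / (1 - x ^ S m)) N)) x.
Proof.
  intros Hx. induction N.
  - simpl. eapply cder_eq. apply cder_const. ring.
  - cbn [Cprod_n psum]. eapply cder_eq.
    + apply cder_mult; [exact IHN|]. apply cder_plus. apply cder_const.
      apply cder_ext with (f := fun x => (-1) * x ^ S N). intros; ring.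
      apply cder_scal, cder_pow, cder_id.
    + cbv beta. replace (S N - 1)%nat with N by lia. field.
      apply (one_minus_neq_0 (x ^ S N)), Cmod_pow_S_lt_1, Hx.
Qed.

(** The derivatives of the finite products, read as power series, converge by Tannery's theorem to
    the termwise derivative of the limit; the product rule gives them a second, explicit form. *)
Lemma qpoch_cder (x : C) : (Cmod x < 1)%R -> exists L,
  csum (fun m => INR (S m) * x ^ m / (1 - x ^ S m)) L /\
  cder (fun x => qpoch x 1 1) (- (qpoch x 1 1 * L)) x.
Proof.
  intros Hx. destruct (qpoch_cvg x Hx) as [H1 _]. destruct (qpoch_inv x Hx) as [N0 _].
  destruct (disc_series_cder _ _ x disc_series_qpoch Hx) as [D [HD1 HD2]].
  pose proof (Cmod_ge_0 x) as P. set (r := ((1 + Cmod x) / 2)%R).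
  assert (Cmod x < r < 1)%R as Hr by (unfold r; lra).
  destruct (tannery (fun N n => prod_coef one_minus_coef N n * (INR n * x ^ (n - 1)))
    (fun n => prod_coef one_minus_coef n n * (INR n * x ^ (n - 1)))
    (fun N => - (Cprod_n (fun m => 1 - x ^ S m) N * psum (fun m => INR (S m) * x ^ m / (1 - x ^ S m)) N))
    (fun k => / (r - Cmod x) * (prod_coef_R k k * r ^ k))%R) as [l [A1 A2]].
  - intros k. apply cvg_ext_loc with (N := k)
      (u := fun _ => prod_coef one_minus_coef k k * (INR k * x ^ (k - 1))).
    + intros n Hn. rewrite (prod_coef_limit one_minus_coef n k); auto.
      unfold one_minus_coef; simpl; ring.
    + apply cvg_const.
  - intros N n. rewrite !Cmod_mult, Cmod_pow, (Cmod_RtoC_nonneg (INR n)) by apply pos_INR.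
    pose proof (deriv_coef_bound r (Cmod x) n ltac:(lra)).
    apply Rle_trans with (prod_coef_R n n * (r ^ n / (r - Cmod x)))%R.
    + apply Rmult_le_compat; auto using Cmod_ge_0.
      * apply Rmult_le_pos. apply pos_INR. apply pow_le; auto.
      * eapply Rle_trans; [apply prod_coef_le|apply prod_coef_R_limit].
        intros [|[|k]]; unfold one_minus_coef; simpl.
        -- replace (1 + -1 * 0) with (RtoC 1) by ring. rewrite Cmod_1; lra.
        -- replace (0 + -1 * 1) with (- RtoC 1) by ring. rewrite Cmod_m1; lra.
        -- replace (0 + -1 * 0) with (RtoC 0) by ring. rewrite Cmod_0; lra.
    + right; field. lra.
  - apply bsum_scal. left; apply Rinv_0_lt_compat; lra. apply partition_majorant; lra.
  (* Uniqueness of the derivative identifies the termwise derivative of the finite product with the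
     product rule. *)
  - intros N. destruct (disc_series_cder _ _ x (disc_series_prod_coef _ _ N disc_series_one_minus) Hx) as [D' [K1 K2]].
    rewrite <- (cder_unique _ _ _ _ K2 (cder_finite_product x N Hx)). exact K1.
  - assert (l = D) as -> by (eapply csum_unique; eauto).
    exists (- D / qpoch x 1 1). split.
    + eapply cvg_ext; [|apply (cvg_mult _ _ _ _ (cvg_opp _ _ A2) (cvg_inv _ _ N0 H1))].
      intros n. cbv beta. field. apply Cprod_n_neq_0.
      intros k. apply one_minus_neq_0, Cmod_pow_S_lt_1, Hx.
    + eapply cder_eq; [exact HD2|]. field. auto.
Qed.

(** * Partial fractions of the cotangent *)

Definition Csin z : C := (Cexp (Ci * z) - Cexp (- (Ci * z))) / (2 * Ci).
Definition Ccos z : C := (Cexp (Ci * z) + Cexp (- (Ci * z))) / 2.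
Definition Ccot z : C := Ccos z / Csin z.

Lemma Ci2 : Ci * Ci = - (1).
Proof. unfold Ci, Cmult, Copp, RtoC; simpl. f_equal; ring. Qed.

Lemma Ci_neq_0 : Ci <> 0.
Proof. intros E. pose proof Ci2 as H. rewrite E in H. injection H. lra. Qed.

Lemma C2_neq_0 : RtoC 2 <> 0.
Proof. intros E; apply RtoC_inj in E; lra. Qed.

Lemma CPI_neq_0 : RtoC PI <> 0.
Proof. intros E; apply RtoC_inj in E. pose proof PI_RGT_0. lra. Qed.

Lemma Csin_plus z w : Csin (z + w) = Csin z * Ccos w + Ccos z * Csin w.
Proof.
  unfold Csin, Ccos.
  replace (Ci * (z + w)) with (Ci * z + Ci * w) by ring.
  replace (- (Ci * z + Ci * w)) with (- (Ci * z) + - (Ci * w)) by ring.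
  rewrite !Cexp_plus. field. apply Ci_neq_0.
Qed.

Lemma Ccos_plus z w : Ccos (z + w) = Ccos z * Ccos w - Csin z * Csin w.
Proof.
  unfold Csin, Ccos.
  replace (Ci * (z + w)) with (Ci * z + Ci * w) by ring.
  replace (- (Ci * z + Ci * w)) with (- (Ci * z) + - (Ci * w)) by ring.
  rewrite !Cexp_plus.
  set (A := Cexp (Ci * z)). set (B := Cexp (Ci * w)).
  set (A' := Cexp (- (Ci * z))). set (B' := Cexp (- (Ci * w))).
  replace ((A - A') / (2 * Ci) * ((B - B') / (2 * Ci))) with
    ((A - A') * (B - B') / (4 * (Ci * Ci))).
  2: { field. apply Ci_neq_0. }
  rewrite Ci2. field.
Qed.

Lemma Csin_opp z : Csin (- z) = - Csin z.
Proof.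
  unfold Csin. replace (Ci * - z) with (- (Ci * z)) by ring.
  replace (- - (Ci * z)) with (Ci * z) by ring. field. apply Ci_neq_0.
Qed.

Lemma Ccos_opp z : Ccos (- z) = Ccos z.
Proof.
  unfold Ccos. replace (Ci * - z) with (- (Ci * z)) by ring.
  replace (- - (Ci * z)) with (Ci * z) by ring. field.
Qed.

Lemma Csin_R (x : R) : Csin x = sin x.
Proof.
  unfold Csin. replace (- (Ci * x)) with (Ci * (- x)%R) by (rewrite RtoC_opp; ring).
  rewrite !Cexp_Ci, cos_neg, sin_neg.
  replace ((cos x, sin x) - (cos x, (- sin x)%R)) with (2 * Ci * sin x).
  field. apply Ci_neq_0.
  unfold Cminus, Cplus, Copp, Cmult, Ci, RtoC; simpl. f_equal; ring.
Qed.

Lemma Ccos_R (x : R) : Ccos x = cos x.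
Proof.
  unfold Ccos. replace (- (Ci * x)) with (Ci * (- x)%R) by (rewrite RtoC_opp; ring).
  rewrite !Cexp_Ci, cos_neg, sin_neg.
  replace ((cos x, sin x) + (cos x, (- sin x)%R)) with (2 * cos x). field.
  unfold Cminus, Cplus, Copp, Cmult, Ci, RtoC; simpl. f_equal; ring.
Qed.

Lemma Csin_0 : Csin 0 = 0.
Proof. rewrite Csin_R, sin_0; auto. Qed.

Lemma Csin2_Ccos2 z : Csin z * Csin z + Ccos z * Ccos z = 1.
Proof.
  pose proof (Ccos_plus z (- z)) as H. rewrite Ccos_opp, Csin_opp in H.
  replace (z + - z) with (RtoC 0) in H by ring. rewrite Ccos_R, cos_0 in H.
  rewrite H. ring.
Qed.

Lemma cder_Csin z : cder Csin (Ccos z) z.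
Proof.
  unfold Csin. apply cder_ext with (f := fun z => / (2 * Ci) * (Cexp (Ci * z) + (-1) * Cexp ((- Ci) * z))).
  { intros x. replace ((- Ci) * x) with (- (Ci * x)) by ring. field. apply Ci_neq_0. }
  eapply cder_eq.
  - apply cder_scal, cder_plus; [|apply cder_scal]; apply (cder_comp Cexp);
      try apply cder_Cexp; apply cder_scal, cder_id.
  - unfold Ccos. replace ((- Ci) * z) with (- (Ci * z)) by ring. field. apply Ci_neq_0.
Qed.

Lemma cder_Ccos z : cder Ccos (- Csin z) z.
Proof.
  unfold Ccos. apply cder_ext with (f := fun z => / 2 * (Cexp (Ci * z) + Cexp ((- Ci) * z))).
  { intros x. replace ((- Ci) * x) with (- (Ci * x)) by ring. field. }
  eapply cder_eq.
  - apply cder_scal, cder_plus; apply (cder_comp Cexp);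
      try apply cder_Cexp; apply cder_scal, cder_id.
  - unfold Csin. replace ((- Ci) * z) with (- (Ci * z)) by ring.
    set (A := Cexp (Ci * z)). set (B := Cexp (- (Ci * z))).
    replace (- ((A - B) / (2 * Ci))) with ((Ci * Ci) * ((A - B) / (2 * Ci))) by (rewrite Ci2; ring).
    field. apply Ci_neq_0.
Qed.

Lemma cder_cvg f (l : C) z (h : nat -> C) : cder f l z -> cvg h 0 -> cvg (fun n => f (z + h n)) (f z).
Proof.
  intros H Hh. destruct (cder_lip _ _ _ H) as [d [Hd K]]. intros eps He.
  pose proof (Cmod_ge_0 l).
  destruct (Hh (Rmin d (eps / (Cmod l + 1)))) as [N HN].
  { apply Rmin_glb_lt; auto. apply Rdiv_lt_0_compat; lra. }
  exists N. intros n Hn. specialize (HN n Hn). replace (h n - 0) with (h n) in HN by ring.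
  apply Rmin_Rgt in HN. destruct HN as [h1 h2]. eapply Rle_lt_trans; [apply K; auto|].
  apply Rgt_lt, Rmult_lt_compat_r with (r := (Cmod l + 1)%R) in h2; [|lra].
  replace (eps / (Cmod l + 1) * (Cmod l + 1))%R with eps in h2 by (field; lra). lra.
Qed.

Lemma Csin_neq_0_half z : Csin z <> 0 -> Csin (z / 2) <> 0 /\ Ccos (z / 2) <> 0.
Proof.
  intros H. replace z with (z / 2 + z / 2) in H by field. rewrite Csin_plus in H.
  split; intros E; apply H; rewrite E; ring.
Qed.

Lemma Csin_shift_PI z : Csin (z + PI) = - Csin z.
Proof. rewrite Csin_plus, Csin_R, Ccos_R, sin_PI, cos_PI. ring. Qed.

Lemma Ccos_shift_PI z : Ccos (z + PI) = - Ccos z.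
Proof. rewrite Ccos_plus, Csin_R, Ccos_R, sin_PI, cos_PI. ring. Qed.

Lemma Ccot_shift_PI z : Ccot (z + PI) = Ccot z.
Proof.
  unfold Ccot. rewrite Csin_shift_PI, Ccos_shift_PI. unfold Cdiv.
  destruct (Ceq_dec (Csin z) 0) as [E|E]; [|field; auto].
  rewrite E. replace (- 0) with (RtoC 0) by ring. rewrite Cinv_0. ring.
Qed.

Lemma Csin_shift_half z : Csin (z + (PI / 2)%R) = Ccos z.
Proof. rewrite Csin_plus, Csin_R, Ccos_R, sin_PI2, cos_PI2. ring. Qed.

Lemma Ccos_shift_half z : Ccos (z + (PI / 2)%R) = - Csin z.
Proof. rewrite Ccos_plus, Csin_R, Ccos_R, sin_PI2, cos_PI2. ring. Qed.

Lemma Ccot_duplication z : Csin z <> 0 ->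
  Ccot (z / 2) + Ccot (z / 2 + (PI / 2)%R) = 2 * Ccot z.
Proof.
  intros H. destruct (Csin_neq_0_half z H) as [H1 H2].
  replace (Ccot z) with (Ccot (z / 2 + z / 2)) by (f_equal; field). unfold Ccot.
  rewrite Csin_shift_half, Ccos_shift_half, Csin_plus, Ccos_plus.
  field. repeat split; auto. rewrite <- Csin_plus. replace (z / 2 + z / 2) with z by field. auto.
Qed.

Lemma Csin_shift_nat z k : Csin z <> 0 -> Csin (z + INR k * PI) <> 0.
Proof.
  intros H. induction k.
  - simpl. replace (z + 0 * PI) with z by ring. auto.
  - rewrite S_INR, RtoC_plus.
    replace (z + (INR k + 1) * PI) with (z + INR k * PI + PI) by ring.
    rewrite Csin_shift_PI. intros E. apply IHk. replace (Csin (z + INR k * PI)) with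
     (- - Csin (z + INR k * PI)) by ring. rewrite E. ring.
Qed.

Lemma C2pow_neq_0 n : RtoC 2 ^ n <> 0.
Proof. apply Cpow_nz, C2_neq_0. Qed.

Lemma Csin_neq_0_pow z n : Csin z <> 0 -> Csin (z / 2 ^ n) <> 0.
Proof.
  revert z; induction n; intros z H.
  - simpl. replace (z / 1) with z by field. auto.
  - replace (z / 2 ^ S n) with (z / 2 ^ n / 2).
    apply Csin_neq_0_half, IHn; auto.
    simpl. field. apply C2pow_neq_0.
Qed.

(** Iterated duplication; a finite identity whose limit, after division by 2^n, is the partial
    fraction expansion. *)
Lemma Ccot_sum_pow z n : Csin z <> 0 ->
  psum (fun k => Ccot ((z + INR k * PI) / 2 ^ n)) (2 ^ n) = 2 ^ n * Ccot z.
Proof.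
  intros H. induction n.
  - simpl. replace ((z + 0 * PI) / 1) with z by field. ring.
  - replace (2 ^ S n)%nat with (2 ^ n + 2 ^ n)%nat by (simpl; lia).
    rewrite psum_split, <- psum_plus.
    rewrite (psum_ext _ (fun k => 2 * Ccot ((z + INR k * PI) / 2 ^ n))).
    + rewrite psum_scal, IHn. simpl. ring.
    + intros k _. rewrite <- Ccot_duplication by (apply Csin_neq_0_pow, Csin_shift_nat, H).
      pose proof (C2pow_neq_0 n). f_equal; f_equal; simpl.
      * field; auto.
      * rewrite plus_INR, RtoC_plus, pow_INR, RtoC_div, RtoC_pow by lra.
        change (INR 2) with 2%R. field; auto.
Qed.

Lemma Csin_prod z w : Csin (z + w) * Csin (z - w) = Csin z * Csin z - Csin w * Csin w.
Proof.
  unfold Cminus at 1. rewrite !Csin_plus, Csin_opp, Ccos_opp.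
  replace (Csin z * Csin z - Csin w * Csin w) with
   (Csin z * Csin z * (Csin w * Csin w + Ccos w * Ccos w)
    - Csin w * Csin w * (Csin z * Csin z + Ccos z * Ccos z)) by (rewrite !Csin2_Ccos2; ring).
  ring.
Qed.

Lemma Ccot_pair z w : Csin (z + w) <> 0 -> Csin (z - w) <> 0 ->
  Ccot (z + w) + Ccot (z - w) = Csin (z + z) / (Csin z * Csin z - Csin w * Csin w).
Proof.
  intros H1 H2. rewrite <- Csin_prod. unfold Ccot.
  replace (z + z) with ((z + w) + (z - w)) by ring. rewrite (Csin_plus (z + w)).
  field. auto.
Qed.

(** Modulo the period pi, the index k is paired with 2^(n+1) - k, leaving 0 and 2^n alone; each pair
    collapses to one fraction by sin(z + w) sin(z - w) = sin^2 z - sin^2 w. *)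
Lemma Ccot_finite_pf z n : Csin z <> 0 ->
  2 ^ S n * Ccot z = Ccot (z / 2 ^ S n) + Ccot (z / 2 ^ S n + (PI / 2)%R) +
   psum (fun j => Csin (2 * z / 2 ^ S n) /
     (Csin (z / 2 ^ S n) * Csin (z / 2 ^ S n)
      - Csin (INR (S j) * PI / 2 ^ S n) * Csin (INR (S j) * PI / 2 ^ S n))) (2 ^ n - 1).
Proof.
  intros H. rewrite <- (Ccot_sum_pow z (S n) H).
  pose proof (C2pow_neq_0 n) as N0. pose proof (C2pow_neq_0 (S n)) as N1.
  assert (1 <= 2 ^ n)%nat as P by (apply Nat.neq_0_lt_0, Nat.pow_nonzero; lia).
  set (g := fun k => Ccot ((z + INR k * PI) / 2 ^ S n)).
  replace (2 ^ S n)%nat with (S (2 ^ n - 1) + S (2 ^ n - 1))%nat by (simpl; lia).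
  rewrite psum_split, (psum_S_l g). rewrite (psum_S_l (fun k => g (S (2 ^ n - 1) + k)%nat)).
  rewrite (psum_rev (fun k => g (S (2 ^ n - 1) + S k)%nat)).
  replace (g 0%nat) with (Ccot (z / 2 ^ S n)).
  2: { unfold g. f_equal. simpl INR. field; auto. }
  replace (g (S (2 ^ n - 1) + 0)%nat) with (Ccot (z / 2 ^ S n + (PI / 2)%R)).
  2: { unfold g. f_equal. replace (S (2 ^ n - 1) + 0)%nat with (2 ^ n)%nat by lia.
       rewrite pow_INR, RtoC_div, RtoC_pow by lra. change (INR 2) with 2%R. simpl Cpow. field; auto. }
  match goal with |- ?a + ?s1 + (?b + ?s2) = ?a + ?b + ?s3 =>
    replace s3 with (s1 + s2); [ring|] end.
  rewrite <- psum_plus. apply psum_ext. intros j Hj.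
  assert (forall k, Csin ((z + INR k * PI) / 2 ^ S n) <> 0) as Q.
  { intros k. apply Csin_neq_0_pow, Csin_shift_nat, H. }
  set (k' := (S (2 ^ n - 1) + S (2 ^ n - 1 - 1 - j))%nat).
  assert ((z + INR k' * PI) / 2 ^ S n = z / 2 ^ S n - INR (S j) * PI / 2 ^ S n + PI) as E.
  { assert (INR k' = 2 * 2 ^ n - INR (S j))%R as ->.
    { unfold k'. replace (S (2 ^ n - 1) + S (2 ^ n - 1 - 1 - j))%nat with (2 * 2 ^ n - S j)%nat by lia.
      rewrite minus_INR by lia. rewrite mult_INR, pow_INR. change (INR 2) with 2%R. ring. }
    rewrite RtoC_minus, RtoC_mult, RtoC_pow. simpl Cpow. field; auto. }
  assert ((z + INR (S j) * PI) / 2 ^ S n = z / 2 ^ S n + INR (S j) * PI / 2 ^ S n) as E2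
    by (field; auto).
  unfold g. rewrite E, Ccot_shift_PI, E2. rewrite Ccot_pair.
  - f_equal. f_equal. field; auto.
  - rewrite <- E2. apply Q.
  - intros E0. apply (Q k'). rewrite E, Csin_shift_PI, E0. ring.
Qed.

Lemma cvg_div_pow2 (c : C) : cvg (fun n => c / 2 ^ n) 0.
Proof.
  replace (RtoC 0) with (c * 0) by ring.
  apply cvg_ext with (u := fun n => c * (/ 2) ^ n).
  - intros n. rewrite Cpow_inv. reflexivity. apply C2_neq_0.
  - apply cvg_scal, cvg_geom_0. rewrite Cmod_inv by apply C2_neq_0.
    rewrite Cmod_RtoC_nonneg; lra.
Qed.

Lemma cvg_div_pow2_S (c : C) : cvg (fun n => c / 2 ^ S n) 0.
Proof. apply (cvg_subseq _ _ S (fun n => Nat.le_succ_diag_r n) (cvg_div_pow2 c)). Qed.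

Lemma cvg_scaled_Csin (c : C) : cvg (fun n => 2 ^ S n * Csin (c / 2 ^ S n)) c.
Proof.
  destruct (Ceq_dec c 0) as [->|H].
  - apply cvg_ext with (u := fun _ => 0); [|apply cvg_const]. intros n.
    replace (0 / 2 ^ S n) with (RtoC 0). rewrite Csin_0; ring. field. apply (C2pow_neq_0 (S n)).
  - assert (forall n, c / 2 ^ S n <> 0) as Hn.
    { intros n E. apply H. replace c with (c / 2 ^ S n * 2 ^ S n).
      rewrite E; ring. field. apply (C2pow_neq_0 (S n)). }
    pose proof (cder_seq _ _ _ _ (cder_Csin 0) (cvg_div_pow2_S c) Hn) as K.
    apply (cvg_scal c) in K. rewrite Ccos_R, cos_0, Cmult_1_r in K.
    eapply cvg_ext; [|exact K]. intros n; cbv beta. rewrite Csin_0, Cplus_0_l.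
    field. split; auto. apply (C2pow_neq_0 (S n)).
Qed.

Lemma Csin_nat_PI k : Csin (INR k * PI) = 0.
Proof.
  induction k. { simpl. rewrite Cmult_0_l. apply Csin_0. }
  rewrite S_INR, RtoC_plus. replace ((INR k + 1) * PI) with (INR k * PI + PI) by ring.
  rewrite Csin_shift_PI, IHk. ring.
Qed.

Lemma Csin_neq_0_factors z k : Csin z <> 0 -> z - INR k * PI <> 0 /\ z + INR k * PI <> 0.
Proof.
  intros H. split; intros E; apply H.
  - replace z with (INR k * PI). apply Csin_nat_PI.
    replace (INR k * PI) with (z - (z - INR k * PI)) by ring. rewrite E; ring.
  - replace z with (- (INR k * PI)). rewrite Csin_opp, Csin_nat_PI; ring.
    replace (- (INR k * PI)) with (z - (z + INR k * PI)) by ring. rewrite E; ring.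
Qed.

Lemma Csin_neq_0_neq_0 z : Csin z <> 0 -> z <> 0.
Proof. intros H ->. apply H, Csin_0. Qed.

(** From sin b >= b - b^3/6 and b^2 <= 4. *)
Lemma sin_ge_third (b : R) : (0 <= b <= 2)%R -> (b / 3 <= sin b)%R.
Proof.
  intros H. pose proof (pre_sin_bound b 0 ltac:(lra) ltac:(lra)) as [K _].
  unfold sin_approx, sum_f_R0, sin_term in K. simpl in K.
  assert (b * b * b <= 4 * b)%R by nra. 
  eapply Rle_trans; [|apply K]. field_simplify. nra.
Qed.

Lemma bsum_inv_sqr : bsum (fun j => / (INR (S j) * INR (S j)))%R.
Proof.
  exists 2%R. intros n.
  assert (rsum (fun j => / (INR (S j) * INR (S j)))%R (S n) <= 2 - / INR (S n))%R as A.
  { induction n.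
    - simpl. lra.
    - cbn [rsum] in *. pose proof (pos_INR n). 
      assert (/ (INR (S (S n)) * INR (S (S n))) <= / INR (S n) - / INR (S (S n)))%R; [|lra].
      rewrite !S_INR in *. apply Rmult_le_reg_r with ((INR n + 1 + 1) * (INR n + 1 + 1) * (INR n + 1))%R.
      { repeat apply Rmult_lt_0_compat; lra. }
      field_simplify; nra. }
  assert (0 < / INR (S n))%R by (apply Rinv_0_lt_compat, lt_0_INR; lia).
  assert (rsum (fun j => / (INR (S j) * INR (S j)))%R n <= rsum (fun j => / (INR (S j) * INR (S j)))%R (S n))%R.
  { apply rsum_mono; auto. intros k. left. apply Rinv_0_lt_compat.
    assert (0 < INR (S k))%R by (apply lt_0_INR; lia). nra. }
  lra.
Qed.

Lemma INR_S_pos j : (0 < INR (S j))%R.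
Proof. apply lt_0_INR; lia. Qed.

Lemma CINR_S_neq_0 j : RtoC (INR (S j)) <> 0.
Proof. intros E. apply RtoC_inj in E. pose proof (INR_S_pos j). lra. Qed.

Lemma nat_ge_R (r : R) : exists n, forall k, (n <= k)%nat -> (r <= INR k)%R.
Proof.
  destruct (INR_unbounded r) as [n Hn]. exists n. intros k Hk. apply le_INR in Hk. lra.
Qed.

(** The argument is below pi/2, hence below 2, and pi/3 >= 1. Being uniform in n, the bound supplies
    the domination in [Ccot_pf]. *)
Lemma scaled_sin_ge j n : (j < 2 ^ n - 1)%nat ->
  (INR (S j) <= 2 ^ S n * sin (INR (S j) * PI / 2 ^ S n))%R.
Proof.
  intros Hj. assert (0 < 2 ^ S n)%R as P by (apply pow_lt; lra).
  pose proof PI2_3_2. pose proof PI_4. pose proof (INR_S_pos j).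
  assert (INR (S j) <= 2 ^ n)%R.
  { replace 2%R with (INR 2) by reflexivity. rewrite <- pow_INR. apply le_INR. lia. }
  assert (0 <= INR (S j) * PI / 2 ^ S n <= 2)%R as B.
  { split.
    - apply Rmult_le_pos. apply Rmult_le_pos; lra. left. apply Rinv_0_lt_compat; auto.
    - apply Rmult_le_reg_r with (2 ^ S n)%R; auto. unfold Rdiv.
      rewrite Rmult_assoc, Rinv_l, Rmult_1_r by lra. cbn [pow].
      assert (INR (S j) * PI <= 2 ^ n * 4)%R by (apply Rmult_le_compat; lra). lra. }
  apply sin_ge_third in B. apply Rmult_le_compat_l with (r := (2 ^ S n)%R) in B; [|lra].
  eapply Rle_trans; [|apply B].
  replace (2 ^ S n * (INR (S j) * PI / 2 ^ S n / 3))%R with (INR (S j) * (PI / 3))%R by (field; lra).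
  nra.
Qed.

Lemma Ccot_pf z : Csin z <> 0 ->
  csum (fun j => 2 * z / (z * z - INR (S j) * PI * (INR (S j) * PI))) (Ccot z - 1 / z).
Proof.
  intros H. pose proof (Csin_neq_0_neq_0 z H) as Hz.
  assert (forall j, z * z - INR j * PI * (INR j * PI) <> 0) as Hd.
  { intros j. destruct (Csin_neq_0_factors z j H).
    replace (z * z - INR j * PI * (INR j * PI)) with ((z - INR j * PI) * (z + INR j * PI)) by ring.
    apply Cmult_neq_0; auto. }
  set (num := fun n => 2 ^ S n * Csin (2 * z / 2 ^ S n)).
  set (den := fun n j => (2 ^ S n * Csin (z / 2 ^ S n)) * (2 ^ S n * Csin (z / 2 ^ S n))
     - (2 ^ S n * Csin (INR (S j) * PI / 2 ^ S n)) * (2 ^ S n * Csin (INR (S j) * PI / 2 ^ S n))).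
  destruct (cvg_bounded _ _ (cvg_scaled_Csin (2 * z))) as [B1 HB1].
  destruct (cvg_bounded _ _ (cvg_scaled_Csin z)) as [B2 HB2].
  assert (0 <= B1)%R as B1p by (eapply Rle_trans; [apply Cmod_ge_0|apply (HB1 O)]).
  assert (0 <= B2)%R as B2p by (eapply Rle_trans; [apply Cmod_ge_0|apply (HB2 O)]).
  (* From this index on, the part of the denominator that depends on z is at most a quarter of
     (j+1)^2, so the denominator is at least (j+1)^2 / 2. *)
  destruct (nat_ge_R (2 * B2)) as [k0 Hk0].
  destruct (tannery_loc (fun n j => if (j <? 2 ^ n - 1)%nat then num n / den n j else 0)
    (fun j => 2 * z / (z * z - INR (S j) * PI * (INR (S j) * PI)))
    (fun n => Ccot z - / 2 ^ S n * (Ccot (z / 2 ^ S n) + Ccot (z / 2 ^ S n + (PI / 2)%R)))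
    (fun j => 2 * B1 * / (INR (S j) * INR (S j)))%R k0) as [l [A1 A2]].
  - intros j. apply cvg_shift_inv with (k := S (S j)).
    apply cvg_ext with (u := fun n => num (n + S (S j))%nat / den (n + S (S j))%nat j).
    { intros n. assert (S (S j) < 2 ^ S (S j))%nat by (apply Nat.pow_gt_lin_r; lia).
      assert (2 ^ S (S j) <= 2 ^ (n + S (S j)))%nat by (apply Nat.pow_le_mono_r; lia).
      destruct (Nat.ltb_spec j (2 ^ (n + S (S j)) - 1)). auto. lia. }
    apply (cvg_subseq (fun n => num n / den n j) _ (fun n => n + S (S j))%nat). intros; lia.
    apply cvg_mult. apply cvg_scaled_Csin. apply cvg_inv. apply Hd.
    apply cvg_minus; apply cvg_mult; apply cvg_scaled_Csin.
  - intros n j Hj. destruct (Nat.ltb_spec j (2 ^ n - 1)) as [L|L].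
    + assert (INR (S j) * INR (S j) / 2 <= Cmod (den n j))%R as Q.
      { unfold den. rewrite Cmod_sub_sym. eapply Rle_trans; [|apply Cmod_triangle_rev].
        rewrite !(Cmod_mult (2 ^ S n * _)).
        specialize (HB2 n). pose proof (Cmod_ge_0 (2 ^ S n * Csin (z / 2 ^ S n))).
        assert (INR (S j) <= Cmod (2 ^ S n * Csin (INR (S j) * PI / 2 ^ S n)))%R.
        { eapply Rle_trans; [apply (scaled_sin_ge j n L)|].
          replace (INR (S j) * PI / 2 ^ S n) with (RtoC (INR (S j) * PI / 2 ^ S n)).
          rewrite Csin_R, <- RtoC_pow, <- RtoC_mult, Cmod_R. apply Rle_abs.
          rewrite RtoC_div, RtoC_mult, RtoC_pow; auto. apply pow_nonzero; lra. }
        pose proof (INR_S_pos j). specialize (Hk0 (S j) ltac:(lia)). nra. }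
      assert (0 < INR (S j) * INR (S j))%R by (pose proof (INR_S_pos j); nra).
      assert (den n j <> 0). { apply (proj2 (Cmod_gt_0 _)). lra. }
      rewrite Cmod_div by auto. apply Rmult_le_reg_r with (Cmod (den n j)). lra.
      unfold Rdiv at 1. rewrite Rmult_assoc, Rinv_l, Rmult_1_r by lra.
      eapply Rle_trans; [apply (HB1 n)|].
      apply Rle_trans with (2 * B1 * / (INR (S j) * INR (S j)) * (INR (S j) * INR (S j) / 2))%R.
      right; field. intros E0; rewrite E0 in *; lra.
      apply Rmult_le_compat_l; auto. apply Rmult_le_pos. lra.
      left; apply Rinv_0_lt_compat; auto.
    + rewrite Cmod_0. apply Rmult_le_pos. lra.
      left; apply Rinv_0_lt_compat. pose proof (INR_S_pos j); nra.
  - apply bsum_scal. lra. apply bsum_inv_sqr.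
  - intros n. pose proof (C2pow_neq_0 (S n)) as N1.
    assert (psum (fun j => if (j <? 2 ^ n - 1)%nat then num n / den n j else 0) (2 ^ n - 1)
      = Ccot z - / 2 ^ S n * (Ccot (z / 2 ^ S n) + Ccot (z / 2 ^ S n + (PI / 2)%R))) as <-.
    {
      pose proof (Ccot_finite_pf z n H) as K.
      replace (Ccot z) with (/ 2 ^ S n * (2 ^ S n * Ccot z)) by (field; auto).
      rewrite K, !Cmult_plus_distr_l, <- psum_scal.
      match goal with |- ?s = ?a + ?b + ?t - (?a + ?b) => replace s with t; [ring|] end.
      apply psum_ext. intros j Hj. replace (j <? 2 ^ n - 1)%nat with true by (symmetry; apply Nat.ltb_lt; auto).
      unfold num, den.
      replace (2 ^ S n * Csin (z / 2 ^ S n) * (2 ^ S n * Csin (z / 2 ^ S n)) -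
        2 ^ S n * Csin (INR (S j) * PI / 2 ^ S n) * (2 ^ S n * Csin (INR (S j) * PI / 2 ^ S n)))
       with (2 ^ S n * 2 ^ S n * (Csin (z / 2 ^ S n) * Csin (z / 2 ^ S n) -
        Csin (INR (S j) * PI / 2 ^ S n) * Csin (INR (S j) * PI / 2 ^ S n))) by ring.
      rewrite <- Csin_prod.
      assert (Csin (z / 2 ^ S n + INR (S j) * PI / 2 ^ S n) <> 0 /\
              Csin (z / 2 ^ S n - INR (S j) * PI / 2 ^ S n) <> 0) as [Q1 Q2].
      { split.
        - replace (z / 2 ^ S n + INR (S j) * PI / 2 ^ S n) with ((z + INR (S j) * PI) / 2 ^ S n) by (field; auto).
          apply Csin_neq_0_pow, Csin_shift_nat, H.
        - replace (z / 2 ^ S n - INR (S j) * PI / 2 ^ S n) with (- ((- z + INR (S j) * PI) / 2 ^ S n)) by (field; auto).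
          rewrite Csin_opp. intros E0.
          apply (Csin_neq_0_pow (- z + INR (S j) * PI) (S n)).
          + apply Csin_shift_nat. rewrite Csin_opp. intros E1. apply H.
            replace (Csin z) with (- - Csin z) by ring. rewrite E1; ring.
          + replace (Csin ((- z + INR (S j) * PI) / 2 ^ S n)) with
              (- - Csin ((- z + INR (S j) * PI) / 2 ^ S n)) by ring. rewrite E0; ring. }
      field. auto. }
    apply csum_finite. intros k Hk.
    replace (k <? 2 ^ n - 1)%nat with false by (symmetry; apply Nat.ltb_ge; auto). auto.
  - replace (Ccot z - 1 / z) with l; auto.
    apply (cvg_unique _ _ _ A2). apply cvg_minus. apply cvg_const.
    assert (forall n, Csin (z / 2 ^ S n) <> 0) as Q by (intros; apply Csin_neq_0_pow; auto).
    assert (forall n, Ccos (z / 2 ^ S n) <> 0) as Q2.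
    { intros n. replace (z / 2 ^ S n) with (z / 2 ^ n / 2).
      apply Csin_neq_0_half, Csin_neq_0_pow; auto.
      simpl. field. apply C2pow_neq_0. }
    assert (cvg (fun n => Ccos (z / 2 ^ S n)) 1) as C1.
    { replace (RtoC 1) with (Ccos 0) by (rewrite Ccos_R, cos_0; auto).
      eapply cvg_ext; [|apply (cder_cvg _ _ _ _ (cder_Ccos 0) (cvg_div_pow2_S z))].
      intros n; cbv beta. rewrite Cplus_0_l; auto. }
    assert (cvg (fun n => Csin (z / 2 ^ S n)) 0) as C2.
    { rewrite <- Csin_0 at 1.
      eapply cvg_ext; [|apply (cder_cvg _ _ _ _ (cder_Csin 0) (cvg_div_pow2_S z))].
      intros n; cbv beta. rewrite Cplus_0_l; auto. }
    (* The two unpaired terms are cot x - tan x at x = z / 2^(n+1); after scaling, the cotangent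
       tends to 1/z and the tangent to 0. *)
    apply cvg_ext with (u := fun n => Ccos (z / 2 ^ S n) * / (2 ^ S n * Csin (z / 2 ^ S n))
      - 1 / 2 ^ S n * (Csin (z / 2 ^ S n) * / Ccos (z / 2 ^ S n))).
    { intros n. unfold Ccot. rewrite Csin_shift_half, Ccos_shift_half.
      field. repeat split; auto. apply (C2pow_neq_0 (S n)). }
    replace (1 / z) with (1 * / z - 0 * (0 * / 1)) by (field; auto).
    apply cvg_minus; apply cvg_mult; auto.
    + apply cvg_inv; auto. apply cvg_scaled_Csin.
    + apply cvg_div_pow2_S.
    + apply cvg_mult; auto. apply cvg_inv; auto.
      intros E; apply RtoC_inj in E; lra.
Qed.

Lemma cder_Ccot z : Csin z <> 0 -> cder Ccot (- / (Csin z * Csin z)) z.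
Proof.
  intros H. unfold Ccot. eapply cder_eq.
  - unfold Cdiv. apply cder_mult. apply cder_Ccos. apply cder_inv; auto. apply cder_Csin.
  - cbv beta.
    replace (/ (Csin z * Csin z)) with
      ((Csin z * Csin z + Ccos z * Ccos z) * / (Csin z * Csin z)) by (rewrite Csin2_Ccos2; ring).
    field. auto.
Qed.

Lemma cvg_eventually_neq_0 (u : nat -> C) (l : C) : cvg u l -> l <> 0 ->
  exists N, forall n, (N <= n)%nat -> u n <> 0.
Proof.
  intros H Hl. destruct (H (Cmod l)) as [N K]. { apply Cmod_pos; auto. }
  exists N. intros n Hn E. specialize (K n Hn). rewrite E in K.
  replace (0 - l) with (- l) in K by ring. rewrite Cmod_opp in K. lra.
Qed.

Lemma cvg_inv_nat : cvg (fun n => RtoC (/ (INR n + 1))) 0.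
Proof.
  intros eps He. destruct (archimed_cor1 eps He) as [N [K1 K2]]. exists N. intros n Hn.
  assert (0 < INR n + 1)%R by (pose proof (pos_INR n); lra).
  replace (RtoC (/ (INR n + 1)) - 0) with (RtoC (/ (INR n + 1))) by ring.
  rewrite Cmod_RtoC_nonneg by (left; apply Rinv_0_lt_compat; auto).
  eapply Rlt_trans; [|apply K1]. apply Rinv_lt_contravar.
  - apply Rmult_lt_0_compat; auto. apply lt_0_INR; auto.
  - apply le_INR in Hn. lra.
Qed.

Lemma Cmod_far z (k : nat) : (Cmod z <= INR k)%R ->
  (INR k <= Cmod (z - INR k * PI) /\ INR k <= Cmod (z + INR k * PI))%R.
Proof.
  intros H. pose proof PI2_3_2. pose proof (pos_INR k).
  assert (Cmod (INR k * PI) = INR k * PI)%R as E.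
  { rewrite <- RtoC_mult, Cmod_RtoC_nonneg; auto. apply Rmult_le_pos; lra. }
  split.
  - rewrite Cmod_sub_sym. eapply Rle_trans; [|apply Cmod_triangle_rev]. rewrite E. nra.
  - replace (z + INR k * PI) with (INR k * PI - - z) by ring.
    eapply Rle_trans; [|apply Cmod_triangle_rev]. rewrite Cmod_opp, E. nra.
Qed.

(** The derivative of [Ccot_pf], obtained by passing to the limit in difference quotients along a
    sequence, so that Tannery's theorem replaces termwise differentiation. *)
Lemma Csin_inv_sqr_pf z : Csin z <> 0 ->
  csum (fun j => / ((z - INR (S j) * PI) * (z - INR (S j) * PI)) +
                 / ((z + INR (S j) * PI) * (z + INR (S j) * PI)))
   (/ (Csin z * Csin z) - / (z * z)).
Proof.
  intros H. pose proof (Csin_neq_0_neq_0 z H) as Hz.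
  (* The increments 1/(n+1) are started at N0 so that the sine does not vanish at any z + h_n. *)
  destruct (cvg_eventually_neq_0 _ _ (cder_cvg _ _ _ _ (cder_Csin z) cvg_inv_nat) H) as [N0 HN0].
  set (h := fun n => RtoC (/ (INR (n + N0) + 1))).
  assert (forall n, Csin (z + h n) <> 0) as Hs by (intros n; apply HN0; lia).
  assert (cvg h 0) as Hh.
  { apply (cvg_subseq _ _ (fun n => n + N0)%nat (fun n => Nat.le_add_r n N0) cvg_inv_nat). }
  assert (forall n, 0 < / (INR (n + N0) + 1) <= 1)%R as Hb.
  { intros n. pose proof (pos_INR (n + N0)). split. apply Rinv_0_lt_compat; lra.
    rewrite <- Rinv_1 at 2. apply Rinv_le_contravar; lra. }
  assert (forall n, h n <> 0) as Hn0.
  { intros n E. apply RtoC_inj in E. specialize (Hb n). lra. }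
  assert (forall n, Cmod (h n) <= 1)%R as Hm.
  { intros n. unfold h. specialize (Hb n). rewrite Cmod_RtoC_nonneg; lra. }
  destruct (nat_ge_R (Cmod z + 1)) as [k0 Hk0].
  (* Minus the difference quotient of the k-th pair of partial fractions. *)
  pose (p := fun n k => / ((z + h n - INR (S k) * PI) * (z - INR (S k) * PI)) +
                 / ((z + h n + INR (S k) * PI) * (z + INR (S k) * PI))).
  destruct (tannery_loc p 
    (fun j => / ((z - INR (S j) * PI) * (z - INR (S j) * PI)) +
                 / ((z + INR (S j) * PI) * (z + INR (S j) * PI)))
    (fun n => - ((Ccot (z + h n) - Ccot z) / h n) - / ((z + h n) * z))
    (fun j => 2 * / (INR (S j) * INR (S j)))%R k0) as [l [A1 A2]].
  - intros k. unfold p. destruct (Csin_neq_0_factors z (S k) H) as [Q1 Q2].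
    assert (cvg (fun n => z + h n) z) as Kz.
    { pose proof (cvg_plus _ _ _ _ (cvg_const z) Hh) as K.
      replace (z + 0) with z in K by ring. exact K. }
    apply cvg_plus; apply cvg_inv; try (apply Cmult_neq_0; auto); apply cvg_mult;
      try apply cvg_const; [apply cvg_minus|apply cvg_plus]; auto; apply cvg_const.
  - intros n k Hk. unfold p. pose proof (INR_S_pos k). 
    specialize (Hk0 (S k) ltac:(lia)).
    destruct (Cmod_far z (S k) ltac:(lra)) as [P1 P2].
    destruct (Cmod_far (z + h n) (S k)) as [P3 P4].
    { eapply Rle_trans; [apply Cmod_triangle|]. specialize (Hm n). lra. }
    eapply Rle_trans; [apply Cmod_triangle|]. rewrite !Cmod_Cinv, !Cmod_mult.
    assert (forall s t : R, INR (S k) <= s -> INR (S k) <= t ->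
       / (s * t) <= / (INR (S k) * INR (S k)))%R as Q.
    { intros s t Hs1 Ht1. apply Rinv_le_contravar. nra. nra. }
    pose proof (Q _ _ P3 P1). pose proof (Q _ _ P4 P2). lra.
  - apply bsum_scal. lra. apply bsum_inv_sqr.
  - intros n. pose proof (csum_minus _ _ _ _ (Ccot_pf z H) (Ccot_pf _ (Hs n))) as K.
    apply (csum_scal (/ h n)) in K.
    pose proof (Csin_neq_0_neq_0 _ (Hs n)) as Hzn.
    replace (- ((Ccot (z + h n) - Ccot z) / h n) - / ((z + h n) * z)) with
     (/ h n * (Ccot z - 1 / z - (Ccot (z + h n) - 1 / (z + h n)))) by (field; auto).
    eapply csum_ext; [|exact K]. intros k; cbv beta. unfold p.
    destruct (Csin_neq_0_factors z (S k) H) as [Q1 Q2].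
    destruct (Csin_neq_0_factors (z + h n) (S k) (Hs n)) as [Q3 Q4].
    replace (z * z - INR (S k) * PI * (INR (S k) * PI)) with
      ((z - INR (S k) * PI) * (z + INR (S k) * PI)) by ring.
    replace ((z + h n) * (z + h n) - INR (S k) * PI * (INR (S k) * PI)) with
      ((z + h n - INR (S k) * PI) * (z + h n + INR (S k) * PI)) by ring.
    field. auto 10.
  - replace (/ (Csin z * Csin z) - / (z * z)) with l; auto.
    apply (cvg_unique _ _ _ A2).
    replace (/ (Csin z * Csin z) - / (z * z)) with (- - / (Csin z * Csin z) - / (z * z)) by ring.
    apply cvg_minus.
    + apply cvg_opp. apply cder_seq; auto. apply cder_Ccot; auto.
    + apply cvg_inv. apply Cmult_neq_0; auto. apply cvg_mult; [|apply cvg_const].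
      pose proof (cvg_plus _ _ _ _ (cvg_const z) Hh) as K.
      replace (z + 0) with z in K by ring. exact K.
Qed.

Lemma bsum_odd_inv_sqr_aux j : (Cmod (/ (INR (2 * j + 1) * INR (2 * j + 1))) <= / (INR (S j) * INR (S j)))%R.
Proof.
  rewrite Cmod_Cinv, Cmod_mult, Cmod_RtoC_nonneg by apply pos_INR.
  pose proof (INR_S_pos j). assert (INR (S j) <= INR (2 * j + 1))%R by (apply le_INR; lia).
  apply Rinv_le_contravar; nra.
Qed.

Lemma zeta_2 : csum (fun j => / (INR (S j) * INR (S j))) (PI * PI / 6).
Proof.
  pose proof CPI_neq_0 as P0.
  destruct (bsum_csum _ _ bsum_odd_inv_sqr_aux bsum_inv_sqr) as [o Ho].
  destruct (bsum_csum (fun j => / (INR (S j) * INR (S j))) (fun j => / (INR (S j) * INR (S j)))%R) as [Z HZ];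
    [|exact bsum_inv_sqr|].
  { intros j. rewrite Cmod_Cinv, Cmod_mult, Cmod_RtoC_nonneg by apply pos_INR. lra. }
  assert (Csin (PI / 2)%R = 1) as E1 by (rewrite Csin_R, sin_PI2; auto).
  assert (Csin (PI / 2)%R <> 0) as E1'. { rewrite E1. intros E; apply RtoC_inj in E; lra. }
  pose proof (Csin_inv_sqr_pf _ E1') as K. rewrite E1 in K.
  assert (o = PI * PI / 8) as Eo.
  { pose proof (csum_shift _ _ 1 Ho) as Ho1.
    pose proof (csum_scal (4 / (PI * PI)) _ _ (csum_plus _ _ _ _ Ho Ho1)) as K2.
    (* At z = pi/2 the pair of index j gives the inverse squares of 2j - 1 and 2j + 1, times 4 /
       pi^2; hence the odd series o occurs once in full and once without its first term. *)
    assert (4 / (PI * PI) * (o + (o - 1)) = 1 - 4 / (PI * PI)) as E.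
    { replace (4 / (PI * PI) * (o + (o - 1))) with (4 / (PI * PI) * (o + (o - (0 + / (1 * 1))))) by (field; auto).
      replace (1 - 4 / (PI * PI)) with (/ (1 * 1) - / ((PI / 2)%R * (PI / 2)%R)).
      2: { rewrite RtoC_div by lra. field; auto. }
      apply (csum_unique _ _ _ K2). eapply csum_ext; [|exact K]. intros j; cbv beta.
      rewrite RtoC_div by lra.
      assert (RtoC (INR (2 * j + 1)) = 2 * INR (S j) - 1) as ->.
      { rewrite <- RtoC_mult, <- RtoC_minus. f_equal. rewrite plus_INR, mult_INR, !S_INR. simpl (INR 0). ring. }
      assert (RtoC (INR (2 * (1 + j) + 1)) = 2 * INR (S j) + 1) as ->.
      { rewrite <- RtoC_mult, <- RtoC_plus. f_equal.
        rewrite plus_INR, mult_INR, (plus_INR 1 j), !S_INR. simpl (INR 0). ring. }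
      assert (2 * INR (S j) - 1 <> 0) as N1.
      { rewrite <- RtoC_mult, <- RtoC_minus. intros E. apply RtoC_inj in E.
        rewrite S_INR in E. pose proof (pos_INR j). lra. }
      assert (2 * INR (S j) + 1 <> 0) as N2.
      { rewrite <- RtoC_mult, <- RtoC_plus. intros E. apply RtoC_inj in E.
        pose proof (pos_INR (S j)). lra. }
      set (k := RtoC (INR (S j))) in *.
      replace (PI / 2 - k * PI) with (PI * (- (2 * k - 1)) / 2) by field.
      replace (PI / 2 + k * PI) with (PI * (2 * k + 1) / 2) by field.
      field. repeat split; auto. }
    assert (2 * o - 1 = PI * PI / 4 - 1) as E3.
    { replace (2 * o - 1) with (PI * PI / 4 * (4 / (PI * PI) * (o + (o - 1)))) by (field; auto).
      rewrite E. field; auto. }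
    replace o with ((2 * o - 1 + 1) / 2) by field. rewrite E3. field. }
  (* Separation of odd and even indices, on the partial sums of even length. *)
  assert (Z = o + / 4 * Z) as EZ.
  { apply (cvg_unique (fun n => psum (fun j => / (INR (S j) * INR (S j))) (2 * n))).
    - apply (cvg_subseq _ _ (fun n => 2 * n)%nat) in HZ; auto. intros; lia.
    - eapply cvg_ext; [|apply (cvg_plus _ _ _ _ Ho (cvg_scal (/ 4) _ _ HZ))].
      intros n; cbv beta. induction n. simpl. ring.
      replace (2 * S n)%nat with (S (S (2 * n))) by lia. cbn [psum]. rewrite <- IHn.
      replace (S (2 * n)) with (2 * n + 1)%nat by lia.
      replace (S (2 * n + 1))%nat with (2 * S n)%nat by lia.
      rewrite (mult_INR 2 (S n)), RtoC_mult. simpl (INR 2).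
      assert (RtoC (1 + 1) = 2) as -> by (f_equal; lra).
      pose proof (CINR_S_neq_0 n).
      assert (RtoC (INR (2 * n + 1)) <> 0). { rewrite Nat.add_1_r. apply CINR_S_neq_0. }
      field. auto. }
  replace (PI * PI / 6) with Z; auto.
  assert (Z = 4 / 3 * o) as ->.
  { replace (4 / 3 * o) with (4 / 3 * (o + / 4 * Z - / 4 * Z)) by ring. rewrite <- EZ. field. }
  rewrite Eo. field.
Qed.

(** The moduli of e^(iz) and e^(-iz) are exp(- Im z) and exp(Im z), which differ off the real
    axis. *)
Lemma Csin_neq_0 z : Im z <> 0%R -> Csin z <> 0.
Proof.
  intros H E. apply H. unfold Csin in E.
  assert (Cexp (Ci * z) = Cexp (- (Ci * z))) as E2.
  { replace (Cexp (Ci * z)) with ((Cexp (Ci * z) - Cexp (- (Ci * z))) / (2 * Ci) * (2 * Ci)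
      + Cexp (- (Ci * z))) by (field; apply Ci_neq_0). rewrite E. ring. }
  apply (f_equal Cmod) in E2. rewrite !Cmod_Cexp in E2. apply exp_inv in E2.
  destruct z as [x y]. unfold Ci, Cmult, Copp, Re, Im in *; simpl in *. lra.
Qed.

Lemma Im_PI_mult w : Im w <> 0%R -> Im (PI * w) <> 0%R.
Proof.
  intros H. destruct w as [x y]. unfold RtoC, Cmult, Im in *; simpl in *.
  pose proof PI_RGT_0. intros E. apply H.
  apply Rmult_eq_reg_l with PI; [|lra]. lra.
Qed.

Lemma Im_neq_0_nat w k : Im w <> 0%R -> w - INR k <> 0 /\ w + INR k <> 0 /\ w <> 0.
Proof.
  intros H. destruct w as [x y]. unfold RtoC, Cplus, Cminus, Copp, Im in *; simpl in *.
  repeat split; intros E; injection E; intros; apply H; lra.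
Qed.

Lemma PI_Ccot_pf w : Im w <> 0%R ->
  csum (fun j => / (w - INR (S j)) + / (w + INR (S j))) (PI * Ccot (PI * w) - / w).
Proof.
  intros H. pose proof CPI_neq_0 as P0.
  pose proof (Ccot_pf _ (Csin_neq_0 _ (Im_PI_mult _ H))) as K.
  apply (csum_scal PI) in K.
  destruct (Im_neq_0_nat w 0 H) as [_ [_ Hw]].
  replace (PI * Ccot (PI * w) - / w) with (PI * (Ccot (PI * w) - 1 / (PI * w))) by (field; auto).
  eapply csum_ext; [|exact K]. intros j; cbv beta.
  destruct (Im_neq_0_nat w (S j) H) as [N1 [N2 _]].
  replace (PI * w * (PI * w) - INR (S j) * PI * (INR (S j) * PI)) with
   (PI * PI * ((w - INR (S j)) * (w + INR (S j)))) by ring.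
  field. auto.
Qed.

Lemma PI_Csin_pf w : Im w <> 0%R ->
  csum (fun j => / ((w - INR (S j)) * (w - INR (S j))) + / ((w + INR (S j)) * (w + INR (S j))))
    (PI * PI / (Csin (PI * w) * Csin (PI * w)) - / (w * w)).
Proof.
  intros H. pose proof CPI_neq_0 as P0.
  pose proof (Csin_neq_0 _ (Im_PI_mult _ H)) as Hs.
  pose proof (Csin_inv_sqr_pf _ Hs) as K.
  apply (csum_scal (PI * PI)) in K.
  destruct (Im_neq_0_nat w 0 H) as [_ [_ Hw]].
  replace (PI * PI / (Csin (PI * w) * Csin (PI * w)) - / (w * w)) with
    (PI * PI * (/ (Csin (PI * w) * Csin (PI * w)) - / (PI * w * (PI * w)))) by (field; auto).
  eapply csum_ext; [|exact K]. intros j; cbv beta.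
  destruct (Im_neq_0_nat w (S j) H) as [N1 [N2 _]].
  replace (PI * w - INR (S j) * PI) with (PI * (w - INR (S j))) by ring.
  replace (PI * w + INR (S j) * PI) with (PI * (w + INR (S j))) by ring.
  field. auto.
Qed.

(** * The Eisenstein series of weight 2 *)

Lemma UHP_neq_0 tau : UHP tau -> tau <> 0.
Proof. intros H ->. unfold UHP, Im, RtoC in H; simpl in H. lra. Qed.

Lemma Im_Cinv tau : Im (- / tau) = (Im tau / (Re tau ^ 2 + Im tau ^ 2))%R.
Proof. destruct tau as [s t]. unfold Cinv, Copp, Im, Re; simpl. unfold Rdiv. ring. Qed.

Lemma UHP_S tau : UHP tau -> UHP (- / tau).
Proof.
  unfold UHP. intros H. rewrite Im_Cinv. apply Rdiv_lt_0_compat; auto.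
  pose proof (pow2_ge_0 (Re tau)). nra.
Qed.

(** The imaginary part gives the first bound. It also gives the second unless |y| is large against k
    + 1, and then the triangle inequality does. *)
Lemma lattice_lower_bound tau : UHP tau -> exists c : R, (0 < c)%R /\
  forall (k : nat) (y : R), (c * INR (S k) <= Cmod (INR (S k) * tau + y))%R /\
    (c * Rabs y <= Cmod (INR (S k) * tau + y))%R.
Proof.
  intros H. unfold UHP in H. set (b := Im tau) in *. pose proof (Cmod_ge_0 tau) as P.
  assert (0 < b / (Cmod tau + b + 1))%R as Q by (apply Rdiv_lt_0_compat; lra).
  (* Suited to the threshold |y| = K (|tau| + b) that separates the two cases, where K = k + 1. *)
  exists (b / (Cmod tau + b + 1))%R. split; auto. intros k y.
  pose proof (INR_S_pos k) as PK. set (K := INR (S k)) in *.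
  assert (b * K <= Cmod (K * tau + y))%R as B1.
  { apply Rle_trans with (Rabs (Im (K * tau + y))).
    - replace (Im (K * tau + y)) with (b * K)%R. apply Rle_abs.
      unfold b. destruct tau; unfold Im, Cplus, Cmult, RtoC; simpl. ring.
    - eapply Rle_trans; [apply Rmax_r|apply (Rmax_Cmod (K * tau + y))]. }
  set (c := (b / (Cmod tau + b + 1))%R) in *.
  assert (c * (Cmod tau + b + 1) = b)%R as Ec by (unfold c; field; lra).
  assert (c <= b)%R by nra.
  split.
  - apply Rle_trans with (b * K)%R; auto. apply Rmult_le_compat_r; lra.
  - destruct (Rle_or_lt (Rabs y) (K * (Cmod tau + b))) as [L|L].
    + apply Rle_trans with (c * (K * (Cmod tau + b)))%R.
      apply Rmult_le_compat_l; lra. nra.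
    + assert (Rabs y - K * Cmod tau <= Cmod (K * tau + y))%R.
      { pose proof (Cmod_triangle_rev y (- (K * tau))) as T.
        rewrite Cmod_opp, Cmod_mult, Cmod_R, (Cmod_RtoC_nonneg K) in T by lra.
        replace (y - - (K * tau)) with (K * tau + y) in T by ring. lra. }
      assert (c < 1)%R by nra. nra.
Qed.

Section Eisenstein.
Variable tau : C.
Hypothesis Htau : UHP tau.

Let A (m n : nat) : C :=
  / ((INR (S m) * tau - INR (S n)) * (INR (S m) * tau - INR (S n))) +
  / ((INR (S m) * tau + INR (S n)) * (INR (S m) * tau + INR (S n))).

(* Telescopes in n. *)
Let B (m n : nat) : C :=
  / ((INR (S m) * tau - INR (S n) - / 2) * (INR (S m) * tau - INR (S n) + / 2)) +
  / ((INR (S m) * tau + INR (S n) - / 2) * (INR (S m) * tau + INR (S n) + / 2)).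

(** The primitive that makes [B] telescope: [B m n] is its difference between the half-integers n +
    1/2 and n + 3/2. *)
Let u (y : R) (m : nat) : C := / (INR (S m) * tau + y) - / (INR (S m) * tau - y).

(** The value of the sum over m of [u y m], by the partial fractions of the cotangent at y / tau. *)
Let V (y : R) : C := / tau * (PI * Ccot (PI * (y / tau)) - tau / y).

Lemma lattice_neq_0 m (y : R) : INR (S m) * tau + y <> 0.
Proof.
  destruct (lattice_lower_bound tau Htau) as [c [Hc K]]. destruct (K m y) as [K1 _].
  apply (proj2 (Cmod_gt_0 _)). pose proof (INR_S_pos m). nra.
Qed.

Lemma lattice_neq_0_minus m (y : R) : INR (S m) * tau - y <> 0.
Proof.
  pose proof (lattice_neq_0 m (- y)). rewrite RtoC_opp in H. exact H.
Qed.

Lemma B_u m n : B m n = u (INR n + / 2) m - u (INR (S n) + / 2) m.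
Proof.
  unfold B, u.
  pose proof (lattice_neq_0 m (INR n + / 2)). pose proof (lattice_neq_0_minus m (INR n + / 2)).
  pose proof (lattice_neq_0 m (INR (S n) + / 2)). pose proof (lattice_neq_0_minus m (INR (S n) + / 2)).
  set (k := INR (S m) * tau) in *. rewrite (S_INR n), !RtoC_plus, !RtoC_inv in * by lra.
  replace (k - (INR n + 1) - / 2) with (k - (INR n + 1 + / 2)) by field.
  replace (k - (INR n + 1) + / 2) with (k - (INR n + / 2)) by field.
  replace (k + (INR n + 1) - / 2) with (k + (INR n + / 2)) by field.
  replace (k + (INR n + 1) + / 2) with (k + (INR n + 1 + / 2)) by ring.
  set (p := INR n + / 2) in *. replace (INR n + 1 + / 2) with (p + 1) in * by (unfold p; ring).
  replace (/ ((k - (p + 1)) * (k - p))) with (/ (k - (p + 1)) - / (k - p)) by (field; auto).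
  replace (/ ((k + p) * (k + (p + 1)))) with (/ (k + p) - / (k + (p + 1))) by (field; auto).
  ring.
Qed.

Lemma psum_telescope (s : nat -> C) n : psum (fun k => s k - s (S k)) n = s O - s n.
Proof. induction n; simpl. ring. rewrite IHn. ring. Qed.

Lemma u_cvg_0 m : cvg (fun n => u (INR n + / 2) m) 0.
Proof.
  destruct (lattice_lower_bound tau Htau) as [c [Hc K]].
  apply cvg_squeeze with (b := fun n => (2 / c * 2 * / (INR n + 1))%R).
  - intros n. replace (u (INR n + / 2) m - 0) with (u (INR n + / 2) m) by ring.
    pose proof (pos_INR n). set (y := (INR n + / 2)%R).
    destruct (K m y) as [_ K1]. destruct (K m (- y)%R) as [_ K2].
    rewrite Rabs_Ropp in K2. rewrite (Rabs_pos_eq y) in * by (unfold y; lra).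
    rewrite RtoC_opp in K2.
    assert (0 < c * y)%R by (apply Rmult_lt_0_compat; unfold y; lra).
    rewrite Cmod_RtoC_nonneg.
    2: { repeat apply Rmult_le_pos; try lra; left; apply Rinv_0_lt_compat; lra. }
    apply Rle_trans with (2 * / (c * y))%R.
    + unfold u. eapply Rle_trans; [apply Cmod_triangle|]. rewrite Cmod_opp, !Cmod_Cinv.
      assert (/ Cmod (INR (S m) * tau + y) <= / (c * y))%R by (apply Rinv_le_contravar; auto).
      assert (/ Cmod (INR (S m) * tau - y) <= / (c * y))%R by (apply Rinv_le_contravar; auto).
      lra.
    + replace (2 / c * 2 * / (INR n + 1))%R with (2 * / (c * ((INR n + 1) / 2)))%R by (field; lra).
      apply Rmult_le_compat_l. lra. apply Rinv_le_contravar.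
      apply Rmult_lt_0_compat; lra. apply Rmult_le_compat_l; unfold y; lra.
  - apply cvg_ext with (u := fun n => RtoC (2 / c * 2) * RtoC (/ (INR n + 1))).
    { intros. rewrite <- RtoC_mult. auto. }
    replace (RtoC 0) with ((2 / c * 2)%R * 0) by ring. apply cvg_scal, cvg_inv_nat.
Qed.

Lemma B_rows m : csum (B m) (u (/ 2) m).
Proof.
  apply cvg_ext with (u := fun n => u (INR 0 + / 2) m - u (INR n + / 2) m).
  { intros n. rewrite <- (psum_telescope (fun n => u (INR n + / 2) m)).
    apply psum_ext. intros k _. rewrite B_u. auto. }
  replace (u (/ 2) m) with (u (INR 0 + / 2) m - 0).
  apply cvg_minus. apply cvg_const. apply u_cvg_0.
  simpl INR. rewrite Rplus_0_l. ring.
Qed.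

Lemma Im_div_tau (y : R) : (0 < y)%R -> Im (y / tau) <> 0%R.
Proof.
  intros Hy. replace (y / tau) with (- (y * (- / tau))).
  2: { field. apply UHP_neq_0, Htau. }
  pose proof (UHP_S _ Htau) as P. unfold UHP in P.
  destruct (- / tau) as [s t]. unfold Copp, Cmult, RtoC, Im in *; simpl in *. nra.
Qed.

Lemma u_columns (y : R) : (0 < y)%R -> csum (u y) (V y).
Proof.
  intros Hy. pose proof (UHP_neq_0 _ Htau) as N. pose proof (Im_div_tau y Hy) as I.
  pose proof (csum_scal (/ tau) _ _ (PI_Ccot_pf _ I)) as K.
  assert (RtoC y <> 0) as Ny by (intros E; apply RtoC_inj in E; lra).
  unfold V. replace (tau / y) with (/ (y / tau)) by (field; auto).
  eapply csum_ext; [|exact K]. intros m; cbv beta. unfold u.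
  pose proof (lattice_neq_0 m y). pose proof (lattice_neq_0_minus m y).
  field. repeat split; auto.
  intros E. apply H0.
  replace (INR (S m) * tau - y) with (- (y - INR (S m) * tau)) by ring. rewrite E. ring.
Qed.

Lemma B_columns n : csum (fun m => B m n) (V (INR n + / 2) - V (INR (S n) + / 2)).
Proof.
  pose proof (pos_INR n). pose proof (pos_INR (S n)).
  eapply csum_ext; [|apply csum_minus; apply u_columns; lra].
  intros m; cbv beta. rewrite B_u. auto.
Qed.

(** y / tau goes to infinity in the lower half-plane, where the cotangent tends to i; [t n] is the
    power n + 1/2 of q(-1/tau). This nonzero limit is the source of the quasi-modular term. *)
Lemma V_cvg : cvg (fun n => V (INR n + / 2)) (PI * Ci / tau).
Proof.
  pose proof (UHP_neq_0 _ Htau) as N.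
  pose proof (UHP_S _ Htau) as HS.
  pose (t := fun n => qpow (/ 2) (- / tau) * q (- / tau) ^ n).
  assert (Cmod (q (- / tau)) < 1)%R as Q by (apply Cmod_qpow_lt_1; auto; lra).
  assert (Cmod (qpow (/ 2) (- / tau)) < 1)%R as Q2 by (apply Cmod_qpow_lt_1; auto; lra).
  assert (forall n, Cmod (t n) < 1)%R as Ht.
  { intros n. unfold t. rewrite Cmod_mult, Cmod_pow.
    assert (Cmod (q (- / tau)) ^ n <= 1)%R.
    { rewrite <- (pow1 n). apply pow_incr. split. apply Cmod_ge_0. lra. }
    assert (0 <= Cmod (q (- / tau)) ^ n)%R by (apply pow_le, Cmod_ge_0).
    pose proof (Cmod_ge_0 (qpow (/ 2) (- / tau))). nra. }
  assert (cvg t 0) as Ct.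
  { replace (RtoC 0) with (qpow (/ 2) (- / tau) * 0) by ring.
    apply cvg_scal, cvg_geom_0; auto. }
  assert (forall n, Ccot (PI * ((INR n + / 2)%R / tau)) = Ci * ((1 + t n) * / (1 - t n))) as E.
  { intros n. unfold Ccot, Ccos, Csin. set (z := PI * ((INR n + / 2)%R / tau)).
    assert (Cexp (- (Ci * z)) = Cexp (Ci * z) * t n) as ->.
    { unfold t, q, qpow. rewrite Cexp_pow, <- !Cexp_plus. f_equal.
      unfold z. rewrite RtoC_plus, RtoC_inv by lra. field. auto. }
    pose proof (one_minus_neq_0 (t n) (Ht n)). pose proof (Cexp_neq_0 (Ci * z)).
    pose proof Ci_neq_0. field. repeat split; auto.
    replace (Cexp (Ci * z) - Cexp (Ci * z) * t n) with (Cexp (Ci * z) * (1 - t n)) by ring.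
    apply Cmult_neq_0; auto. }
  unfold V. replace (PI * Ci / tau) with (/ tau * (PI * (Ci * ((1 + 0) * / (1 - 0))) - tau * 0)).
  2: { field. auto. }
  apply cvg_scal, cvg_minus.
  - apply cvg_scal. eapply cvg_ext; [intros n; symmetry; apply E|].
    apply cvg_scal, cvg_mult. apply cvg_plus; auto; apply cvg_const.
    apply cvg_inv. { replace (1 - 0) with (RtoC 1) by ring. intros E1; apply RtoC_inj in E1; lra. }
    apply cvg_minus; auto; apply cvg_const.
  - apply cvg_scal. apply cvg_squeeze with (b := fun n => (2 * / (INR n + 1))%R).
    + intros n. pose proof (pos_INR n). rewrite <- RtoC_inv, <- RtoC_minus by lra.
      rewrite !Cmod_RtoC_nonneg.
      * rewrite Rminus_0_r. replace (2 * / (INR n + 1))%R with (/ ((INR n + 1) / 2))%R by (field; lra).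
        apply Rinv_le_contravar; lra.
      * apply Rmult_le_pos. lra. left; apply Rinv_0_lt_compat; lra.
      * rewrite Rminus_0_r. left; apply Rinv_0_lt_compat; lra.
    + apply cvg_ext with (u := fun n => RtoC 2 * RtoC (/ (INR n + 1))).
      { intros. rewrite <- RtoC_mult. auto. }
      replace (RtoC 0) with (RtoC 2 * 0) by ring. apply cvg_scal, cvg_inv_nat.
Qed.

(** Because the shifts by 1/2 in [B] are symmetric, 1/x^2 - 1/(x^2 - 1/4) is of order x^(-4). Using
    one lattice bound in m and one in n for each pair of factors turns this into 1/(m^2 n^2), which
    is summable. *)
Lemma AB_bound : exists M : R, (0 <= M)%R /\ forall m n, (Cmod (A m n - B m n) <=
   (M * / (INR (S m) * INR (S m))) * / (INR (S n) * INR (S n)))%R.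
Proof.
  destruct (lattice_lower_bound tau Htau) as [c [Hc K]].
  set (M := (/ (c * c * (c * c)))%R).
  assert (0 < M)%R as HM. { apply Rinv_0_lt_compat. assert (0 < c * c)%R by nra. nra. }
  exists M. split. lra. intros m n.
  pose proof (INR_S_pos m). pose proof (INR_S_pos n).
  (* s is the sign of y: the factor with y + s/2 is the one that is still bounded below by c |y|. *)
  assert (forall s y : R, Rabs y = INR (S n) -> (s = 1 \/ s = - 1) -> s * y = INR (S n) ->
     Cmod (/ ((INR (S m) * tau + y) * (INR (S m) * tau + y)) -
       / ((INR (S m) * tau + y - / 2) * (INR (S m) * tau + y + / 2)))
     <= / 4 * (M * / (INR (S m) * INR (S m)) * / (INR (S n) * INR (S n))))%R as Q.
  { intros s y Hy Hs Es.
    assert (INR (S m) * tau + y - / 2 = INR (S m) * tau + (y - / 2)%R) as -> by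
      (rewrite RtoC_minus, RtoC_inv by lra; ring).
    assert (INR (S m) * tau + y + / 2 = INR (S m) * tau + (y + / 2)%R) as E2 by
      (rewrite RtoC_plus, RtoC_inv by lra; ring).
    pose proof (lattice_neq_0 m y) as N1. pose proof (lattice_neq_0 m (y - / 2)) as N2.
    pose proof (lattice_neq_0 m (y + / 2)) as N3. rewrite E2.
    replace (/ ((INR (S m) * tau + y) * (INR (S m) * tau + y)) -
       / ((INR (S m) * tau + (y - / 2)%R) * (INR (S m) * tau + (y + / 2)%R))) with
     (- (RtoC (/ 2) * RtoC (/ 2)) * / ((INR (S m) * tau + y) * (INR (S m) * tau + y) *
       ((INR (S m) * tau + (y - / 2)%R) * (INR (S m) * tau + (y + / 2)%R)))).
    2: { rewrite RtoC_plus in N3 |- *. rewrite RtoC_minus in N2 |- *.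
         generalize dependent (RtoC (/ 2)). intros h. intros. field. auto. }
    rewrite Cmod_mult, Cmod_opp, <- RtoC_mult, Cmod_RtoC_nonneg, Cmod_Cinv, !Cmod_mult by lra.
    replace (/ 2 * / 2)%R with (/ 4)%R by lra. apply Rmult_le_compat_l. lra.
    unfold M. rewrite <- !Rinv_mult. apply Rinv_le_contravar.
    { repeat apply Rmult_lt_0_compat; auto. }
    destruct (K m y) as [a1 a2]. rewrite Hy in a2.
    assert (c * INR (S m) * (c * INR (S n)) <= 
       Cmod (INR (S m) * tau + y) * Cmod (INR (S m) * tau + y))%R as P1.
    { apply Rmult_le_compat; auto; apply Rmult_le_pos; lra. }
    assert (c * INR (S m) * (c * INR (S n)) <= 
       Cmod (INR (S m) * tau + (y - / 2)%R) * Cmod (INR (S m) * tau + (y + / 2)%R))%R as P2.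
    { destruct (K m (y - / 2)%R) as [b1 b2]. destruct (K m (y + / 2)%R) as [c1 c2].
      destruct Hs as [-> | ->].
      - assert (c * INR (S n) <= Cmod (INR (S m) * tau + (y + / 2)%R))%R.
        { eapply Rle_trans; [|apply c2]. apply Rmult_le_compat_l; [lra|].
          rewrite Rabs_pos_eq; lra. }
        apply Rmult_le_compat; auto; apply Rmult_le_pos; lra.
      - assert (c * INR (S n) <= Cmod (INR (S m) * tau + (y - / 2)%R))%R.
        { eapply Rle_trans; [|apply b2]. apply Rmult_le_compat_l; [lra|].
          rewrite Rabs_left; lra. }
        rewrite Rmult_comm. apply Rmult_le_compat; auto; apply Rmult_le_pos; lra. }
    set (P := (c * INR (S m) * (c * INR (S n)))%R) in *.
    replace (c * c * (c * c) * (INR (S m) * INR (S m)) * (INR (S n) * INR (S n)))%R with (P * P)%R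
      by (unfold P; ring).
    assert (0 <= P)%R by (unfold P; repeat apply Rmult_le_pos; lra).
    apply Rmult_le_compat; auto. }
  unfold A, B.
  pose proof (Q 1%R (INR (S n)) ltac:(apply Rabs_pos_eq; lra) ltac:(left; auto) ltac:(ring)) as Q1.
  pose proof (Q (-1)%R (- INR (S n))%R ltac:(rewrite Rabs_Ropp; apply Rabs_pos_eq; lra)
     ltac:(right; auto) ltac:(ring)) as Q2.
  rewrite RtoC_opp in Q2.
  match goal with |- (Cmod ?t <= ?r)%R => match type of Q1 with (Cmod ?t1 <= _)%R =>
    match type of Q2 with (Cmod ?t2 <= _)%R =>
     replace t with (t1 + t2) by (unfold Cminus; ring) end end end.
  eapply Rle_trans; [apply Cmod_triangle|].
  match type of Q1 with (_ <= / 4 * ?r)%R => assert (0 <= r)%R end.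
  { repeat apply Rmult_le_pos; try lra; left; apply Rinv_0_lt_compat; nra. }
  lra.
Qed.

(* The failure of absolute convergence of sum 1/(m tau + n)^2 makes the two
   orders of summation differ by - pi i / tau. *)
Lemma eisenstein_exchange (r c : nat -> C) (R1 : C) :
  (forall m, csum (A m) (r m)) -> (forall n, csum (fun m => A m n) (c n)) ->
  csum r R1 -> csum c (R1 - PI * Ci / tau).
Proof.
  intros Hr Hc HR. destruct AB_bound as [M [HM Q]].
  destruct (fubini (fun m n => A m n - B m n) (fun m => r m - u (/ 2) m)
    (fun n => c n - (V (INR n + / 2) - V (INR (S n) + / 2)))
    (fun m => M * / (INR (S m) * INR (S m)))%R (fun n => / (INR (S n) * INR (S n)))%R)
    as [l [L1 L2]]; auto.
  - intros m. apply Rmult_le_pos; auto. left; apply Rinv_0_lt_compat.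
    pose proof (INR_S_pos m). nra.
  - intros m. left; apply Rinv_0_lt_compat. pose proof (INR_S_pos m). nra.
  - apply bsum_scal; auto. apply bsum_inv_sqr.
  - apply bsum_inv_sqr.
  - intros m. apply csum_minus; auto. apply B_rows.
  - intros n. apply csum_minus; auto. apply B_columns.
  - assert (l = R1 - V (/ 2)) as ->.
    { eapply csum_unique; [exact L1|]. apply csum_minus; auto. apply u_columns. lra. }
    (* Summed by rows, [B] gives V(1/2); summed by columns it gives V(1/2) minus the limit of V. The
       difference is the whole defect, since A - B may be summed in either order. *)
    assert (csum (fun n => V (INR n + / 2) - V (INR (S n) + / 2)) (V (/ 2) - PI * Ci / tau)) as K.
    { apply cvg_ext with (u := fun n => V (INR 0 + / 2) - V (INR n + / 2)).
      { intros n. rewrite <- (psum_telescope (fun n => V (INR n + / 2))). auto. }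
      simpl (INR 0). rewrite Rplus_0_l. apply cvg_minus. apply cvg_const. apply V_cvg. }
    replace (R1 - PI * Ci / tau) with (R1 - V (/ 2) + (V (/ 2) - PI * Ci / tau)) by ring.
    eapply csum_ext; [|apply (csum_plus _ _ _ _ L2 K)]. intros n; cbv beta. ring.
Qed.

End Eisenstein.

(** * The transformation of eta under inversion *)

(** This is (pi i / 12) E_2(tau), with E_2 written as a Lambert series. *)
Definition dlog_eta tau : C :=
  PI * Ci / 12 - 2 * PI * Ci *
  Clim_seq (psum (fun m => INR (S m) * q tau ^ S m / (1 - q tau ^ S m))).

Lemma Cmod_q_lt_1 tau : UHP tau -> (Cmod (q tau) < 1)%R.
Proof. intros H. apply Cmod_qpow_lt_1; auto; lra. Qed.

Lemma eta_neq_0 tau : UHP tau -> eta tau <> 0.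
Proof.
  intros H. apply Cmult_neq_0. apply qpow_neq_0. apply qpoch_inv, Cmod_q_lt_1, H.
Qed.

Lemma dlog_eta_csum tau : UHP tau -> exists L,
  csum (fun m => INR (S m) * q tau ^ S m / (1 - q tau ^ S m)) L /\
  dlog_eta tau = PI * Ci / 12 - 2 * PI * Ci * L /\
  cder eta (eta tau * dlog_eta tau) tau.
Proof.
  intros H. pose proof (Cmod_q_lt_1 tau H) as Hq.
  destruct (qpoch_cder _ Hq) as [L [H1 H2]]. exists (q tau * L).
  assert (csum (fun m => INR (S m) * q tau ^ S m / (1 - q tau ^ S m)) (q tau * L)) as K.
  { eapply csum_ext; [|apply (csum_scal (q tau) _ _ H1)]. intros m; cbv beta.
    simpl Cpow. field. apply (one_minus_neq_0 (q tau ^ S m)), Cmod_pow_S_lt_1, Hq. }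
  assert (dlog_eta tau = PI * Ci / 12 - 2 * PI * Ci * (q tau * L)) as E.
  { unfold dlog_eta. rewrite (Clim_seq_cvg _ _ K). auto. }
  split; [|split]; auto. rewrite E. unfold eta. eapply cder_eq.
  - apply cder_mult. apply cder_qpow.
    apply (cder_comp (fun x => qpoch x 1 1) q). exact H2. apply cder_qpow.
  - cbv beta. fold (q tau). rewrite RtoC_inv by lra. field.
Qed.

Lemma csum_geom_deriv y : (Cmod y < 1)%R ->
  csum (fun m => INR (S m) * y ^ S m) (y / ((1 - y) * (1 - y))).
Proof.
  intros H. pose proof (one_minus_neq_0 y H) as N.
  destruct (disc_series_cder _ _ y disc_series_geom H) as [D [H1 H2]].
  assert (D = / ((1 - y) * (1 - y))) as ->.
  { apply (cder_unique _ _ _ _ H2). eapply cder_eq.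
    - apply cder_inv; auto. apply cder_plus. apply cder_const.
      apply cder_ext with (f := fun x => (-1) * x). intros; ring. apply cder_scal, cder_id.
    - field; auto. }
  apply (csum_shift _ _ 1) in H1. apply (csum_scal y) in H1.
  replace (y / ((1 - y) * (1 - y))) with (y * (/ ((1 - y) * (1 - y)) -
    psum (fun n => 1 * (INR n * y ^ (n - 1))) 1)) by (simpl; field; auto).
  eapply csum_ext; [|exact H1]. intros m; cbv beta.
  replace (1 + m - 1)%nat with m by lia. simpl (1 + m)%nat. simpl Cpow. ring.
Qed.

Lemma csum_geom_S y : (Cmod y < 1)%R -> csum (fun k => y ^ S k) (y / (1 - y)).
Proof.
  intros H. destruct (disc_series_geom y H) as [_ K]. apply (csum_scal y) in K.
  eapply csum_ext; [|exact K]. intros k; simpl; ring.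
Qed.

(** Both are the double series of m x^(mk) over m, k >= 1, summed in the two orders. *)
Lemma lambert (x : C) (L : C) : (Cmod x < 1)%R ->
  csum (fun m => INR (S m) * x ^ S m / (1 - x ^ S m)) L ->
  csum (fun k => x ^ S k / ((1 - x ^ S k) * (1 - x ^ S k))) L.
Proof.
  intros Hx HL. pose proof (Cmod_ge_0 x) as P. set (r := Cmod x) in *.
  destruct (fubini (fun m k => INR (S m) * x ^ (S m * S k))
    (fun m => INR (S m) * x ^ S m / (1 - x ^ S m))
    (fun k => x ^ S k / ((1 - x ^ S k) * (1 - x ^ S k)))
    (fun m => INR (S m) * r ^ m)%R (fun k => r ^ S k)%R) as [l [H1 H2]].
  - intros m n. rewrite Cmod_mult, Cmod_pow, Cmod_RtoC_nonneg by apply pos_INR.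
    rewrite Rmult_assoc. apply Rmult_le_compat_l. apply pos_INR.
    rewrite <- pow_add. fold r.
    (* Dropping r^(mn) <= 1 leaves a majorant that is a product. *)
    replace (S m * S n)%nat with (m + S n + m * n)%nat by lia.
    rewrite pow_add. rewrite <- (Rmult_1_r (r ^ (m + S n))) at 2.
    apply Rmult_le_compat_l. apply pow_le; auto. rewrite <- (pow1 (m * n)). apply pow_incr; lra.
  - intros m. apply Rmult_le_pos. apply pos_INR. apply pow_le; auto.
  - intros m. apply pow_le; auto.
  - set (s := ((1 + r) / 2)%R).
    apply bsum_le with (b := fun m => (s / (s - r) * s ^ m)%R).
    + intros m. pose proof (deriv_coef_bound s r (S m) ltac:(unfold s; lra)) as K.
      replace (S m - 1)%nat with m in K by lia. eapply Rle_trans; [apply K|].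
      right. simpl. field. unfold s; lra.
    + apply bsum_scal. { unfold s. apply Rmult_le_pos. lra. left; apply Rinv_0_lt_compat; lra. }
      exists (/ (1 - s))%R. intros n. apply rsum_geom_le. unfold s; lra.
  - apply bsum_le with (b := fun k => (r * r ^ k)%R). intros; simpl; lra.
    apply bsum_scal; [exact P|]. exists (/ (1 - r))%R. intros n. apply rsum_geom_le; lra.
  - intros m. pose proof (csum_scal (INR (S m)) _ _ (csum_geom_S _ (Cmod_pow_S_lt_1 x m Hx))) as K.
    replace (INR (S m) * x ^ S m / (1 - x ^ S m)) with (INR (S m) * (x ^ S m / (1 - x ^ S m))) by (unfold Cdiv; ring).
    eapply csum_ext; [|exact K]. intros k; cbv beta. rewrite <- Cpow_mult_r. auto.
  - intros k. eapply csum_ext; [|apply (csum_geom_deriv _ (Cmod_pow_S_lt_1 x k Hx))].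
    intros m; cbv beta. rewrite <- Cpow_mult_r. do 2 f_equal. lia.
  - rewrite <- (csum_unique _ _ _ H1 HL). exact H2.
Qed.

Lemma PI2_Csin_q tau k : UHP tau -> 
  PI * PI / (Csin (PI * (INR (S k) * tau)) * Csin (PI * (INR (S k) * tau))) =
  - (4 * PI * PI) * (q tau ^ S k / ((1 - q tau ^ S k) * (1 - q tau ^ S k))).
Proof.
  intros H. set (X := q tau ^ S k).
  assert (1 - X <> 0) as N by (apply one_minus_neq_0, Cmod_pow_S_lt_1, Cmod_q_lt_1, H).
  unfold Csin. set (e := Cexp (Ci * (PI * (INR (S k) * tau)))).
  set (e' := Cexp (- (Ci * (PI * (INR (S k) * tau))))).
  assert (e' = / e) as Ee by apply Cexp_opp. rewrite Ee.
  assert (e <> 0) as Ne by apply Cexp_neq_0.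
  assert (X = e * e) as EX.
  { unfold X, e, q, qpow. rewrite Cexp_pow, <- Cexp_plus. f_equal. ring. }
  rewrite EX in *. pose proof Ci_neq_0.
  replace ((e - / e) / (2 * Ci) * ((e - / e) / (2 * Ci))) with
    ((1 - e * e) * (1 - e * e) / (4 * (Ci * Ci) * (e * e))) by (field; auto).
  rewrite Ci2. field. auto.
Qed.

Lemma Im_INR_S_mult tau k : UHP tau -> Im (INR (S k) * tau) <> 0%R.
Proof.
  unfold UHP. destruct tau as [s t]. unfold Cmult, RtoC, Im; cbn [fst snd]. intros H.
  pose proof (INR_S_pos k). set (K := INR (S k)) in *. nra.
Qed.

(** Each term is the sum of 1/((k+1) tau + n)^2 over all integers n, so s is the lattice sum whose
    order is going to be exchanged. *)
Lemma dlog_eta_csc tau : UHP tau -> exists s,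
  csum (fun k => PI * PI / (Csin (PI * (INR (S k) * tau)) * Csin (PI * (INR (S k) * tau)))) s /\
  dlog_eta tau = PI * Ci / 12 + Ci / (2 * PI) * s.
Proof.
  intros H. destruct (dlog_eta_csum tau H) as [L [H1 [H2 _]]].
  exists (- (4 * PI * PI) * L). split.
  - eapply csum_ext; [|apply csum_scal, (lambert _ _ (Cmod_q_lt_1 tau H) H1)].
    intros k; cbv beta. symmetry. apply PI2_Csin_q, H.
  - rewrite H2. field. apply CPI_neq_0.
Qed.

Lemma dlog_eta_S tau : UHP tau ->
  dlog_eta (- / tau) = tau * tau * dlog_eta tau + tau / 2.
Proof.
  intros H. pose proof (UHP_neq_0 _ H) as N. pose proof CPI_neq_0 as NP.
  pose proof (UHP_S _ H) as H'.
  destruct (dlog_eta_csc _ H) as [s [Hs Es]]. destruct (dlog_eta_csc _ H') as [s' [Hs' Es']].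
  assert (csum (fun m => PI * PI / (Csin (PI * (INR (S m) * tau)) * Csin (PI * (INR (S m) * tau)))
    - / (INR (S m) * tau * (INR (S m) * tau))) (s - / (tau * tau) * (PI * PI / 6))) as K1.
  { apply csum_minus; auto. eapply csum_ext; [|apply (csum_scal (/ (tau * tau)) _ _ zeta_2)].
    intros m; cbv beta. pose proof (CINR_S_neq_0 m). field. auto. }
  assert (csum (fun m => / (tau * tau) * (PI * PI / (Csin (PI * (INR (S m) * - / tau)) * Csin (PI * (INR (S m) * - / tau))))
    - / (INR (S m) * INR (S m))) (/ (tau * tau) * s' - PI * PI / 6)) as K2.
  { apply csum_minus; [|apply zeta_2]. apply csum_scal. auto. }
  (* Both sides run over the same lattice terms with m and n nonzero, by columns on the left and by
     rows on the right. The terms on the axes, removed from s and s', are multiples of zeta(2). *)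
  assert (/ (tau * tau) * s' - PI * PI / 6 = s - / (tau * tau) * (PI * PI / 6) - PI * Ci / tau) as E.
  { eapply csum_unique; [exact K2|]. eapply (eisenstein_exchange tau H); [| |exact K1].
    - intros m. apply (PI_Csin_pf _ (Im_INR_S_mult tau m H)).
    - intros n. cbv beta.
      pose proof (csum_scal (/ (tau * tau)) _ _ (PI_Csin_pf _ (Im_INR_S_mult _ n H'))) as K.
      pose proof (CINR_S_neq_0 n).
      replace (/ (tau * tau) * (PI * PI / (Csin (PI * (INR (S n) * - / tau)) * Csin (PI * (INR (S n) * - / tau))))
        - / (INR (S n) * INR (S n))) with
       (/ (tau * tau) * (PI * PI / (Csin (PI * (INR (S n) * - / tau)) * Csin (PI * (INR (S n) * - / tau)))
         - / (INR (S n) * - / tau * (INR (S n) * - / tau)))).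
      + eapply csum_ext; [|exact K]. intros m; cbv beta.
        pose proof (lattice_neq_0 tau H m (INR (S n))) as N1.
        pose proof (lattice_neq_0_minus tau H m (INR (S n))) as N2.
        set (M := RtoC (INR (S m))) in *. set (k := RtoC (INR (S n))) in *.
        replace (k * - / tau - M) with (- / tau * (M * tau + k)) by (field; auto).
        replace (k * - / tau + M) with (/ tau * (M * tau - k)) by (field; auto).
        field. auto.
      + set (y := PI * PI / _). field. auto. }
  rewrite Es', Es.
  replace s' with (tau * tau * (/ (tau * tau) * s' - PI * PI / 6 + PI * PI / 6)) by (field; auto).
  rewrite E.
  replace (tau * tau * (PI * Ci / 12 + Ci / (2 * PI) * s) + tau / 2) with
    (tau * tau * (PI * Ci / 12 + Ci / (2 * PI) * s) - tau * (Ci * Ci) / 2) by (rewrite Ci2; field; auto).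
  field. auto.
Qed.

Lemma Cinv_neq_0 z : z <> 0 -> / z <> 0.
Proof.
  intros H E. assert (z * / z = 1) as K by (field; auto). rewrite E, Cmult_0_r in K.
  apply RtoC_inj in K. lra.
Qed.

(** v is f'/f. Identities between eta quotients are proved at this additive level, where no
    logarithm or root has to be chosen, and lifted up to a constant by [logder_same]. *)
Definition logder f v : Prop := forall z, UHP z -> f z <> 0 /\ cder f (f z * v z) z.

Lemma logder_ext_r f v v' : (forall z, UHP z -> v z = v' z) -> logder f v -> logder f v'.
Proof. intros E H z Hz. rewrite <- E; auto. Qed.

Lemma logder_ext_l f f' v : (forall z, UHP z -> f z = f' z) -> logder f v -> logder f' v.
Proof.
  intros E H z Hz. rewrite <- E by auto. destruct (H z Hz). split; auto.
  apply (cder_UHP_ext f); auto.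
Qed.

Lemma logder_mult f g u v : logder f u -> logder g v -> logder (fun z => f z * g z) (fun z => u z + v z).
Proof.
  intros H1 H2 z Hz. destruct (H1 z Hz), (H2 z Hz). split. { apply Cmult_neq_0; auto. }
  eapply cder_eq. apply cder_mult; eauto. cbv beta. ring.
Qed.

Lemma logder_inv f u : logder f u -> logder (fun z => / f z) (fun z => - u z).
Proof.
  intros H z Hz. destruct (H z Hz). split. { apply Cinv_neq_0; auto. }
  eapply cder_eq. apply cder_inv; eauto. field. auto.
Qed.

Lemma logder_const (c : C) : c <> 0 -> logder (fun _ => c) (fun _ => 0).
Proof.
  intros H z Hz. split; auto. eapply cder_eq. apply cder_const. ring.
Qed.

Lemma logder_pow f u n : logder f u -> logder (fun z => f z ^ n) (fun z => INR n * u z).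
Proof.
  intros H. induction n.
  - simpl. eapply logder_ext_r; [|apply (logder_const 1)]. intros; cbv beta; ring.
    intros E; apply RtoC_inj in E; lra.
  - simpl Cpow. eapply logder_ext_r; [|apply logder_mult; [exact H|exact IHn]].
    intros z _; cbv beta. rewrite S_INR, RtoC_plus. ring.
Qed.

Lemma logder_comp f u (m m' : C -> C) : logder f u -> (forall z, UHP z -> UHP (m z)) ->
  (forall z, UHP z -> cder m (m' z) z) -> logder (fun z => f (m z)) (fun z => u (m z) * m' z).
Proof.
  intros H Hm Hd z Hz. destruct (H _ (Hm z Hz)). split; auto.
  eapply cder_eq. apply cder_comp; eauto. ring.
Qed.

Lemma logder_same f g u : logder f u -> logder g u -> exists k : C, k <> 0 /\ forall z, UHP z -> f z = k * g z.
Proof.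
  intros Hf Hg. assert (UHP Ci) as Hi by (unfold UHP, Im, Ci; simpl; lra).
  pose proof (logder_mult _ _ _ _ Hf (logder_inv _ _ Hg)) as K.
  exists (f Ci * / g Ci). split. { apply (K Ci Hi). }
  intros z Hz. destruct (Hg z Hz) as [N _].
  rewrite <- (cder_UHP_const (fun z => f z * / g z)) with (w := z); auto.
  - field. auto.
  - intros w Hw. eapply cder_eq; [apply (K w Hw)|]. ring.
Qed.

Lemma logder_eta : logder eta dlog_eta.
Proof.
  intros z Hz. split. apply eta_neq_0; auto.
  destruct (dlog_eta_csum z Hz) as [L [_ [_ H]]]. auto.
Qed.

Lemma cder_S tau : tau <> 0 -> cder (fun z => - / z) (/ (tau * tau)) tau.
Proof.
  intros H. apply cder_ext with (f := fun z => (-1) * / z). intros; ring.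
  eapply cder_eq. apply cder_scal, (cder_inv (fun z => z)); auto. apply cder_id. field. auto.
Qed.

(** Squaring removes the branch of the square root of tau / i. *)
Lemma eta_S_sqr tau : UHP tau -> eta (- / tau) ^ 2 = - Ci * tau * eta tau ^ 2.
Proof.
  intros H.
  assert (logder (fun z => eta (- / z) ^ 2) (fun z => 2 * (dlog_eta (- / z) * / (z * z)))) as H1.
  { apply (logder_pow (fun z => eta (- / z)) (fun z => dlog_eta (- / z) * / (z * z)) 2).
    apply (logder_comp eta dlog_eta (fun z => - / z) (fun z => / (z * z)) logder_eta).
    apply UHP_S. intros; apply cder_S, UHP_neq_0; auto. }
  assert (logder (fun z => z * eta z ^ 2) (fun z => / z + 2 * dlog_eta z)) as H2.
  { apply logder_mult; [|apply (logder_pow eta dlog_eta 2 logder_eta)].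
    intros z Hz. pose proof (UHP_neq_0 _ Hz). split; auto.
    eapply cder_eq. apply cder_id. field. auto. }
  destruct (logder_same _ (fun z => z * eta z ^ 2) _ H1) as [k [_ K]].
  { eapply logder_ext_r; [|exact H2]. intros z Hz; cbv beta. rewrite dlog_eta_S by auto.
    field. apply UHP_neq_0; auto. }
  rewrite K by auto.
  assert (k = - Ci) as ->; [|ring].
  (* The constant is read off at tau = i, the fixed point of the inversion, where eta does not
     vanish. *)
  assert (UHP Ci) as Hi by (unfold UHP, Im, Ci; simpl; lra).
  specialize (K Ci Hi). pose proof Ci_neq_0 as NC.
  assert (- / Ci = Ci) as E.
  { replace (- / Ci) with (- (1) * / Ci) by ring. rewrite <- Ci2. field. auto. }
  rewrite E in K. assert (eta Ci ^ 2 <> 0) as Ne by (apply Cpow_nz, eta_neq_0; auto).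
  replace k with (k * (Ci * eta Ci ^ 2) / (Ci * eta Ci ^ 2)) by (field; split; auto; apply eta_neq_0; auto).
  rewrite <- K. replace (- Ci) with (Ci * Ci * / Ci * - (1)) by (field; auto).
  rewrite Ci2. field. split; auto. apply eta_neq_0; auto.
Qed.

Lemma qpow_shift (r : R) tau (s : R) : qpow r (tau + s) = Cexp (2 * PI * Ci * (r * s)%R) * qpow r tau.
Proof.
  unfold qpow. rewrite <- Cexp_plus. f_equal. rewrite RtoC_mult. ring.
Qed.

(** * Integral matrices acting on the half-plane *)

(** Unlike [moebius] this takes matrices of any determinant, as needed for (1 r; 0 5) g and (A B; 0
    D). *)
Definition mob (a b c d : Z) tau : C := (IZR a * tau + IZR b) / (IZR c * tau + IZR d).

Lemma mob_den_neq_0 (a b c d : Z) tau : (0 < a * d - b * c)%Z -> UHP tau -> IZR c * tau + IZR d <> 0.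
Proof.
  intros D H E. destruct tau as [s t]. unfold UHP, Im in H; simpl in H.
  unfold Cplus, Cmult, RtoC in E; simpl in E. injection E; intros E1 E2.
  assert (IZR c = 0)%R as Ec by nra. apply eq_IZR in Ec. subst c.
  assert (IZR d = 0)%R as Ed by nra. apply eq_IZR in Ed. subst d. lia.
Qed.

Lemma Im_mob (a b c d : Z) tau : (0 < a * d - b * c)%Z -> UHP tau ->
  Im (mob a b c d tau) = (IZR (a * d - b * c) * Im tau / Cmod (IZR c * tau + IZR d) ^ 2)%R.
Proof.
  intros D H. pose proof (mob_den_neq_0 a b c d tau D H) as N.
  apply Cmod_pos in N. rewrite Cmod2_alt. 
  assert (Cmod (IZR c * tau + IZR d) ^ 2 > 0)%R as N2 by nra. rewrite Cmod2_alt in N2.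
  unfold mob. destruct tau as [s t]. unfold Cdiv, Cinv, Cplus, Cmult, RtoC, Re, Im in *; simpl in *.
  rewrite minus_IZR, !mult_IZR. field. nra.
Qed.

Lemma UHP_mob (a b c d : Z) tau : (0 < a * d - b * c)%Z -> UHP tau -> UHP (mob a b c d tau).
Proof.
  intros D H. unfold UHP. rewrite Im_mob by auto. unfold UHP in H.
  pose proof (mob_den_neq_0 a b c d tau D H) as N. apply Cmod_pos in N.
  apply IZR_lt in D. apply Rdiv_lt_0_compat; nra.
Qed.

Lemma mob_mob (a b c d a' b' c' d' : Z) tau : 
  (0 < a * d - b * c)%Z -> (0 < a' * d' - b' * c')%Z -> UHP tau ->
  mob a b c d (mob a' b' c' d' tau) =
  mob (a * a' + b * c') (a * b' + b * d') (c * a' + d * c') (c * b' + d * d') tau.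
Proof.
  intros D D' H. pose proof (mob_den_neq_0 _ _ _ _ tau D' H) as N.
  pose proof (mob_den_neq_0 _ _ _ _ _ D (UHP_mob _ _ _ _ _ D' H)) as N2.
  unfold mob in *. rewrite !plus_IZR, !mult_IZR, !RtoC_plus, !RtoC_mult.
  assert (IZR c * (IZR a' * tau + IZR b') + IZR d * (IZR c' * tau + IZR d') <> 0) as N3.
  { intros E. apply N2.
    replace (IZR c * ((IZR a' * tau + IZR b') / (IZR c' * tau + IZR d')) + IZR d) with
     ((IZR c * (IZR a' * tau + IZR b') + IZR d * (IZR c' * tau + IZR d')) / (IZR c' * tau + IZR d')) by (field; auto).
    rewrite E. unfold Cdiv. ring. }
  field. repeat split; auto. intros E. apply N3. rewrite <- E. ring.
Qed.

Lemma cder_mob (a b c d : Z) tau : (0 < a * d - b * c)%Z -> UHP tau ->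
  cder (mob a b c d) (IZR (a * d - b * c) / ((IZR c * tau + IZR d) * (IZR c * tau + IZR d))) tau.
Proof.
  intros D H. pose proof (mob_den_neq_0 a b c d tau D H) as N. unfold mob.
  assert (forall x y : C, cder (fun z => x * z + y) x tau) as L.
  { intros x y. eapply cder_eq. apply cder_plus; [apply cder_scal, cder_id|apply cder_const]. ring. }
  eapply cder_eq. unfold Cdiv. apply cder_mult. apply L. apply cder_inv; [auto|apply L].
  cbv beta. rewrite minus_IZR, !mult_IZR, RtoC_minus, !RtoC_mult. field. auto.
Qed.

(** Generation by T and S as an induction principle for multiplication on the right, where the
    automorphy factor of the new matrix is visible. The proof is Euclid's algorithm on the bottom
    row. *)
Lemma SL2Z_ind (P : Z -> Z -> Z -> Z -> Prop) :
  P 1%Z 0%Z 0%Z 1%Z ->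
  (forall a b c d, a * d - b * c = 1 -> P a b c d -> P a (b + a) c (d + c))%Z ->
  (forall a b c d, a * d - b * c = 1 -> P a b c d -> P a (b - a) c (d - c))%Z ->
  (forall a b c d, a * d - b * c = 1 -> P a b c d -> P b (- a) d (- c))%Z ->
  forall a b c d, (a * d - b * c = 1)%Z -> P a b c d.
Proof.
  intros H1 HT HT' HS.
  assert (forall (n : nat) a b c d, (a * d - b * c = 1)%Z -> P a b c d -> 
     P a (b + Z.of_nat n * a) c (d + Z.of_nat n * c))%Z as HTn.
  { induction n; intros a b c d D K.
    - rewrite !Z.mul_0_l, !Z.add_0_r. auto.
    - replace (b + Z.of_nat (S n) * a)%Z with ((b + Z.of_nat n * a) + a)%Z by lia.
      replace (d + Z.of_nat (S n) * c)%Z with ((d + Z.of_nat n * c) + c)%Z by lia.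
      apply HT; auto. nia. }
  assert (forall (n : nat) a b c d, (a * d - b * c = 1)%Z -> P a b c d -> 
     P a (b - Z.of_nat n * a) c (d - Z.of_nat n * c))%Z as HTn'.
  { induction n; intros a b c d D K.
    - rewrite !Z.mul_0_l, !Z.sub_0_r. auto.
    - replace (b - Z.of_nat (S n) * a)%Z with ((b - Z.of_nat n * a) - a)%Z by lia.
      replace (d - Z.of_nat (S n) * c)%Z with ((d - Z.of_nat n * c) - c)%Z by lia.
      apply HT'; auto. nia. }
  assert (forall n a b c d, (a * d - b * c = 1)%Z -> P a b c d -> P a (b + n * a) c (d + n * c))%Z as HTz.
  { intros n a b c d D K. destruct (Z_le_gt_dec 0 n).
    - rewrite <- (Z2Nat.id n) by lia. apply HTn; auto.
    - replace n with (- Z.of_nat (Z.to_nat (- n)))%Z by lia.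
      replace (b + - Z.of_nat (Z.to_nat (- n)) * a)%Z with (b - Z.of_nat (Z.to_nat (- n)) * a)%Z by ring.
      replace (d + - Z.of_nat (Z.to_nat (- n)) * c)%Z with (d - Z.of_nat (Z.to_nat (- n)) * c)%Z by ring.
      apply HTn'; auto. }
  assert (forall a b c d, (a * d - b * c = 1)%Z -> P a b c d -> P (- b) a (- d) c)%Z as HS3.
  { intros a b c d D K. apply HS in K; auto. apply HS in K; [|lia]. apply HS in K; [|lia].
    rewrite !Z.opp_involutive in K. auto. }
  assert (forall (n : nat) a b c d, (Z.abs c <= Z.of_nat n)%Z -> (a * d - b * c = 1)%Z -> P a b c d) as M.
  { induction n; intros a b c d Hc D.
    - assert (c = 0)%Z as -> by lia.
      assert ((a = 1 /\ d = 1) \/ (a = -1 /\ d = -1))%Z as [[-> ->]|[-> ->]].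
      { assert (a * d = 1)%Z as E by lia. apply Z.eq_mul_1 in E as E2.
        destruct E2 as [-> | ->]; lia. }
      + pose proof (HTz b 1 0 0 1 eq_refl H1)%Z as K.
        replace (0 + b * 1)%Z with b in K by ring. replace (1 + b * 0)%Z with 1%Z in K by ring. auto.
      + assert (P (-1) 0 0 (-1))%Z as K0.
        { apply HS in H1; [|lia]. apply HS in H1; [|lia]. exact H1. }
        pose proof (HTz (- b) (-1) 0 0 (-1) eq_refl K0)%Z as K.
        replace (0 + - b * -1)%Z with b in K by ring.
        replace (-1 + - b * 0)%Z with (-1)%Z in K by ring. auto.
    - destruct (Z.eq_dec c 0) as [->|Nc]. { apply IHn; lia. }
      pose proof (Z.div_mod d c Nc) as E. set (k := (d / c)%Z) in *. set (r := (d mod c)%Z) in *.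
      assert (Z.abs r < Z.abs c)%Z as Hr.
      { unfold r. destruct (Z_le_gt_dec 0 c).
        pose proof (Z.mod_pos_bound d c ltac:(lia)). lia.
        pose proof (Z.mod_neg_bound d c ltac:(lia)). lia. }
      (* The matrix multiplied by T^(-k) S: its lower left entry is the remainder of d by c. *)
      pose proof (IHn (b - k * a) (- a) r (- c) ltac:(lia) ltac:(nia))%Z as K.
      apply HS3 in K; [|nia]. rewrite !Z.opp_involutive in K.
      apply (HTz k) in K; [|nia].
      replace (b - k * a + k * a)%Z with b in K by ring.
      replace (r + k * c)%Z with d in K by lia. auto. }
  intros a b c d. apply (M (Z.to_nat (Z.abs c))). lia.
Qed.

(* Descent on |c| + |d|: as d is odd, |4c| and 2|d| differ, and one of the two
   steps decreases. *)
Lemma Gamma0_4_ind (P : Z -> Z -> Z -> Z -> Prop) :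
  P 1%Z 0%Z 0%Z 1%Z ->
  (forall a b c d, a * d - b * (4 * c) = 1 -> P a b c d -> P (- a) (- b) (- c) (- d))%Z ->
  (forall a b c d, a * d - b * (4 * c) = 1 -> P a b c d -> P a (b + a) c (d + 4 * c))%Z ->
  (forall a b c d, a * d - b * (4 * c) = 1 -> P a b c d -> P a (b - a) c (d - 4 * c))%Z ->
  (forall a b c d, a * d - b * (4 * c) = 1 -> P a b c d -> P (a + 4 * b) b (c + d) d)%Z ->
  (forall a b c d, a * d - b * (4 * c) = 1 -> P a b c d -> P (a - 4 * b) b (c - d) d)%Z ->
  forall a b c d, (a * d - b * (4 * c) = 1)%Z -> P a b c d.
Proof.
  intros H1 HI HT HT' HV HV'.
  assert (forall (n : nat), P 1 (Z.of_nat n) 0 1)%Z as Tp.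
  { induction n; auto. rewrite Nat2Z.inj_succ. unfold Z.succ.
    apply (HT 1 (Z.of_nat n) 0 1)%Z in IHn; [|lia].
    replace (1 + 4 * 0)%Z with 1%Z in IHn by ring. auto. }
  assert (forall (n : nat), P 1 (- Z.of_nat n) 0 1)%Z as Tn.
  { induction n; auto. 
    apply (HT' 1 (- Z.of_nat n) 0 1)%Z in IHn; [|lia].
    replace (1 - 4 * 0)%Z with 1%Z in IHn by ring.
    replace (- Z.of_nat (S n))%Z with (- Z.of_nat n - 1)%Z by lia. auto. }
  assert (forall b, P 1 b 0 1)%Z as Tz.
  { intros b. destruct (Z_le_gt_dec 0 b).
    rewrite <- (Z2Nat.id b) by lia; auto. replace b with (- Z.of_nat (Z.to_nat (- b)))%Z by lia; auto. }
  assert (forall (n : nat) a b c d, (Z.abs c + Z.abs d <= Z.of_nat n)%Z -> (a * d - b * (4 * c) = 1)%Z -> P a b c d) as M.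
  { induction n; intros a b c d Hn D. { assert (c = 0 /\ d = 0)%Z as [-> ->] by lia. lia. }
    destruct (Z.eq_dec c 0) as [->|Nc].
    { assert ((a = 1 /\ d = 1) \/ (a = -1 /\ d = -1))%Z as [[-> ->]|[-> ->]]; auto.
      { assert (a * d = 1)%Z as E by lia. apply Z.eq_mul_1 in E as E2.
        destruct E2 as [-> | ->]; lia. }
      pose proof (HI 1 (- b) 0 1 ltac:(lia) (Tz (- b)))%Z as K. rewrite Z.opp_involutive in K. auto. }
    assert (d <> 0)%Z as Nd by (intros ->; lia).
    assert (2 * Z.abs c <> Z.abs d)%Z as Ne.
    { intros E. assert (exists k, d = 2 * k)%Z as [k ->]; [|nia].
      destruct (Z_le_gt_dec 0 d). exists (Z.abs c); lia. exists (- Z.abs c)%Z; lia. }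
    destruct (Z_lt_le_dec (2 * Z.abs c) (Z.abs d)) as [L|L];
      destruct (Z_lt_le_dec 0 (c * d)) as [S|S].
    - pose proof (IHn a (b - a) c (d - 4 * c) ltac:(nia) ltac:(nia))%Z as K.
      apply HT in K; [|nia]. replace (b - a + a)%Z with b in K by ring.
      replace (d - 4 * c + 4 * c)%Z with d in K by ring. auto.
    - pose proof (IHn a (b + a) c (d + 4 * c) ltac:(nia) ltac:(nia))%Z as K.
      apply HT' in K; [|nia]. replace (b + a - a)%Z with b in K by ring.
      replace (d + 4 * c - 4 * c)%Z with d in K by ring. auto.
    - pose proof (IHn (a - 4 * b) b (c - d) d ltac:(nia) ltac:(nia))%Z as K.
      apply HV in K; [|nia]. replace (a - 4 * b + 4 * b)%Z with a in K by ring.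
      replace (c - d + d)%Z with c in K by ring. auto.
    - pose proof (IHn (a + 4 * b) b (c + d) d ltac:(nia) ltac:(nia))%Z as K.
      apply HV' in K; [|nia]. replace (a + 4 * b - 4 * b)%Z with a in K by ring.
      replace (c + d - d)%Z with c in K by ring. auto. }
  intros a b c d. apply (M (Z.to_nat (Z.abs c + Z.abs d))). lia.
Qed.

(** * The multiplier of the square of eta *)

Definition zeta24 (k : Z) : C := Cexp (2 * PI * Ci * (IZR k / 24)).

Lemma zeta24_add k l : zeta24 (k + l) = zeta24 k * zeta24 l.
Proof.
  unfold zeta24. rewrite <- Cexp_plus, plus_IZR, RtoC_plus. f_equal. field.
Qed.

Lemma zeta24_0 : zeta24 0 = 1.
Proof. unfold zeta24. rewrite <- Cexp_0. f_equal. field. Qed.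

Lemma zeta24_neq_0 k : zeta24 k <> 0.
Proof. apply Cexp_neq_0. Qed.

Lemma zeta24_opp k : zeta24 (- k) = / zeta24 k.
Proof.
  pose proof (zeta24_neq_0 k). replace (/ zeta24 k) with (1 * / zeta24 k) by ring.
  rewrite <- zeta24_0. replace 0%Z with (- k + k)%Z by ring. rewrite zeta24_add. field. auto.
Qed.

Lemma zeta24_cong k l : (24 | k - l)%Z -> zeta24 k = zeta24 l.
Proof.
  intros [m E]. replace k with (l + 24 * m)%Z by lia. rewrite zeta24_add.
  assert (zeta24 (24 * m) = 1) as ->; [|ring].
  unfold zeta24. rewrite mult_IZR, RtoC_mult.
  replace (2 * PI * Ci * (24 * IZR m / 24)) with (2 * PI * Ci * IZR m) by field.
  apply Cexp_2PI_Z.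
Qed.

Lemma zeta24_pow k n : zeta24 k ^ n = zeta24 (Z.of_nat n * k).
Proof.
  induction n. { rewrite Z.mul_0_l, zeta24_0. auto. }
  replace (Z.of_nat (S n) * k)%Z with (k + Z.of_nat n * k)%Z by lia.
  rewrite zeta24_add, <- IHn. auto.
Qed.

Lemma eta_shift tau (n : Z) : eta (tau + IZR n) = zeta24 n * eta tau.
Proof.
  unfold eta, zeta24, q. rewrite !qpow_shift, Rmult_1_l, Cexp_2PI_Z, Cmult_1_l.
  rewrite RtoC_mult, RtoC_inv by lra. replace (/ 24 * IZR n) with (IZR n / 24) by (unfold Cdiv; ring).
  ring.
Qed.

(** * Residue arithmetic by enumeration *)

Definition congr (n x y : Z) : Prop := (n | x - y)%Z.

Lemma congr_refl n x : congr n x x.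
Proof. exists 0%Z. ring. Qed.

Lemma congr_trans n x y t : congr n x y -> congr n y t -> congr n x t.
Proof. intros [k E] [l E2]. exists (k + l)%Z. lia. Qed.

Lemma congr_add n x y x' y' : congr n x x' -> congr n y y' -> congr n (x + y) (x' + y').
Proof. intros [k E] [l E2]. exists (k + l)%Z. lia. Qed.

Lemma congr_sub n x y x' y' : congr n x x' -> congr n y y' -> congr n (x - y) (x' - y').
Proof. intros [k E] [l E2]. exists (k - l)%Z. lia. Qed.

Lemma congr_opp n x x' : congr n x x' -> congr n (- x) (- x').
Proof. intros [k E]. exists (- k)%Z. lia. Qed.

Lemma congr_mul n x y x' y' : congr n x x' -> congr n y y' -> congr n (x * y) (x' * y').
Proof. intros [k E] [l E2]. exists (k * y + x' * l)%Z. nia. Qed.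

Lemma congr_mod n x : (0 < n)%Z -> congr n x (x mod n).
Proof. intros H. exists (x / n)%Z. pose proof (Z.div_mod x n). lia. Qed.

Ltac congr_auto := repeat first
  [assumption | apply congr_refl | apply congr_add | apply congr_sub | apply congr_mul | apply congr_opp].

Fixpoint all_below (n : nat) (P : Z -> bool) : bool :=
  match n with O => true | S m => P (Z.of_nat m) && all_below m P end.

Lemma all_below_spec n P x : all_below n P = true -> (0 <= x < Z.of_nat n)%Z -> P x = true.
Proof.
  induction n; intros H Hx. lia. simpl in H. apply andb_prop in H. destruct H as [H1 H2].
  destruct (Z.eq_dec x (Z.of_nat n)) as [->|]; auto. apply IHn; auto. lia.
Qed.

(** Both functions depend only on residues modulo n, so a computation over n^4 tuples decides the
    congruence; the determinant condition [D] enters only modulo n. *)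
Lemma congr_enum4 (n : nat) (D E : Z -> Z -> Z -> Z -> Z) : (0 < n)%nat ->
  (forall a b c d a' b' c' d', congr (Z.of_nat n) a a' -> congr (Z.of_nat n) b b' ->
    congr (Z.of_nat n) c c' -> congr (Z.of_nat n) d d' ->
    congr (Z.of_nat n) (D a b c d) (D a' b' c' d') /\ congr (Z.of_nat n) (E a b c d) (E a' b' c' d')) ->
  all_below n (fun a => all_below n (fun b => all_below n (fun c => all_below n (fun d =>
    if (D a b c d mod Z.of_nat n =? 0)%Z then (E a b c d mod Z.of_nat n =? 0)%Z else true)))) = true ->
  forall a b c d, D a b c d = 0%Z -> congr (Z.of_nat n) (E a b c d) 0.
Proof.
  intros Hn HC H a b c d HD. set (N := Z.of_nat n) in *. assert (0 < N)%Z as HN by lia.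
  pose proof (all_below_spec n _ (a mod N) H (Z.mod_pos_bound _ _ HN)) as H1.
  pose proof (all_below_spec n _ (b mod N) H1 (Z.mod_pos_bound _ _ HN)) as H2.
  pose proof (all_below_spec n _ (c mod N) H2 (Z.mod_pos_bound _ _ HN)) as H3.
  pose proof (all_below_spec n _ (d mod N) H3 (Z.mod_pos_bound _ _ HN)) as H4.
  cbv beta in H4.
  destruct (HC a b c d (a mod N) (b mod N) (c mod N) (d mod N))%Z as [C1 C2]; try apply congr_mod; auto.
  rewrite HD in C1. assert (D (a mod N) (b mod N) (c mod N) (d mod N) mod N = 0)%Z as E1.
  { destruct C1 as [k C1]. replace (D (a mod N) (b mod N) (c mod N) (d mod N))%Z with (- k * N)%Z by lia.
    apply Z.mod_mul. lia. }
  rewrite E1 in H4. simpl in H4. apply Z.eqb_eq in H4.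
  eapply congr_trans; [apply C2|]. exists (E (a mod N) (b mod N) (c mod N) (d mod N) / N)%Z.
  pose proof (Z.div_mod (E (a mod N) (b mod N) (c mod N) (d mod N))%Z N ltac:(lia)). lia.
Qed.

Ltac congr_enum n D E a b c d :=
  refine (congr_enum4 n D E _ _ _ a b c d _);
  [lia | intros; split; congr_auto | vm_compute; reflexivity | ].

(* The character of SL(2,Z) through which eta^2 transforms, as an exponent modulo 12. *)
Definition e12 (a b c d : Z) : Z :=
  ((1 - c * c) * (b * d + 3 * (c - 1) * d + c + 3) + c * (a + d - 3))%Z.

Lemma e12_T a b c d : (a * d - b * c = 1)%Z -> congr 12 (e12 a (b + a) c (d + c) - e12 a b c d - 1) 0.
Proof.
  intros H. congr_enum 12%nat (fun a b c d => a * d - b * c - 1)%Z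
   (fun a b c d => e12 a (b + a) c (d + c) - e12 a b c d - 1)%Z a b c d. lia.
Qed.

Lemma e12_T' a b c d : (a * d - b * c = 1)%Z -> congr 12 (e12 a (b - a) c (d - c) - e12 a b c d + 1) 0.
Proof.
  intros H. congr_enum 12%nat (fun a b c d => a * d - b * c - 1)%Z
   (fun a b c d => e12 a (b - a) c (d - c) - e12 a b c d + 1)%Z a b c d. lia.
Qed.

(** The exponent -3 is the factor - i of [eta_S_sqr], which is [zeta24 (-6)]. *)
Lemma e12_S a b c d : (a * d - b * c = 1)%Z -> congr 12 (e12 b (- a) d (- c) - e12 a b c d + 3) 0.
Proof.
  intros H. congr_enum 12%nat (fun a b c d => a * d - b * c - 1)%Z
   (fun a b c d => e12 b (- a) d (- c) - e12 a b c d + 3)%Z a b c d. lia.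
Qed.

Lemma zeta24_e12 k l m : congr 12 (k - l - m) 0 -> zeta24 (2 * k) = zeta24 (2 * l) * zeta24 (2 * m).
Proof.
  intros [t E]. rewrite <- zeta24_add. apply zeta24_cong. exists t. lia.
Qed.

Lemma zeta24_6 : zeta24 (-6) = - Ci.
Proof.
  unfold zeta24. replace (2 * PI * Ci * (IZR (-6) / 24)) with (Ci * (- (PI / 2))%R).
  rewrite Cexp_Ci, cos_neg, sin_neg, cos_PI2, sin_PI2.
  unfold Ci, Copp; simpl. f_equal; ring.
  rewrite RtoC_opp, RtoC_div by lra. field.
Qed.

Lemma mob_id tau : mob 1 0 0 1 tau = tau.
Proof. unfold mob. field. Qed.

Lemma mob_S a b c d tau : (a * d - b * c = 1)%Z -> UHP tau ->
  mob a b c d (- / tau) = mob b (- a) d (- c) tau.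
Proof.
  intros D H. assert (- / tau = mob 0 (-1) 1 0 tau) as ->.
  { unfold mob. field. apply UHP_neq_0; auto. }
  rewrite mob_mob by (auto; lia). f_equal; ring.
Qed.

Lemma mob_shift a b c d tau (n : Z) : (a * d - b * c = 1)%Z -> UHP tau ->
  mob a b c d (tau + IZR n) = mob a (b + n * a) c (d + n * c) tau.
Proof.
  intros D H. assert (tau + IZR n = mob 1 n 0 1 tau) as ->.
  { unfold mob. field. }
  rewrite mob_mob by (auto; lia). f_equal; ring.
Qed.

Lemma UHP_shift tau (x : R) : UHP tau -> UHP (tau + x).
Proof. unfold UHP. destruct tau; unfold Im, Cplus, RtoC; simpl. lra. Qed.

Lemma eta_sqr_SL2Z a b c d : (a * d - b * c = 1)%Z -> forall tau, UHP tau ->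
  eta (mob a b c d tau) ^ 2 = zeta24 (2 * e12 a b c d) * (IZR c * tau + IZR d) * eta tau ^ 2.
Proof.
  intros D. revert a b c d D.
  refine (SL2Z_ind _ _ _ _ _).
  - intros tau H. rewrite mob_id. change (2 * e12 1 0 0 1)%Z with 0%Z. rewrite zeta24_0. ring.
  - intros a b c d D K tau H.
    pose proof (mob_shift a b c d tau 1 D H) as E. rewrite !Z.mul_1_l in E. rewrite <- E, K by (apply UHP_shift; auto).
    rewrite eta_shift, (zeta24_e12 (e12 a (b + a) c (d + c)) (e12 a b c d) 1) by (apply e12_T, D).
    replace ((zeta24 1 * eta tau) ^ 2) with (zeta24 1 ^ 2 * eta tau ^ 2) by ring.
    rewrite zeta24_pow, plus_IZR, RtoC_plus. simpl (Z.of_nat 2 * 1)%Z. simpl (2 * 1)%Z. ring.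
  - intros a b c d D K tau H.
    pose proof (mob_shift a b c d tau (-1) D H) as E.
    replace (b + -1 * a)%Z with (b - a)%Z in E by ring. replace (d + -1 * c)%Z with (d - c)%Z in E by ring.
    rewrite <- E, K by (apply UHP_shift; auto).
    rewrite eta_shift, (zeta24_e12 (e12 a (b - a) c (d - c)) (e12 a b c d) (-1)).
    2: { destruct (e12_T' a b c d D) as [t Et]. exists t. lia. }
    replace ((zeta24 (-1) * eta tau) ^ 2) with (zeta24 (-1) ^ 2 * eta tau ^ 2) by ring.
    rewrite zeta24_pow, minus_IZR, RtoC_minus. simpl (Z.of_nat 2 * -1)%Z. simpl (2 * -1)%Z. ring.
  - intros a b c d D K tau H.
    rewrite <- (mob_S a b c d tau D H), K by (apply UHP_S; auto).
    rewrite eta_S_sqr by auto. rewrite (zeta24_e12 (e12 b (- a) d (- c)) (e12 a b c d) (-3)).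
    2: { destruct (e12_S a b c d D) as [t Et]. exists t. lia. }
    simpl (2 * -3)%Z. rewrite zeta24_6, opp_IZR, RtoC_opp. field. apply UHP_neq_0; auto.
Qed.

(** Comes from differentiating the law of eta^2, in which the root of unity is constant, instead of
    a second induction over the group. *)
Lemma dlog_eta_SL2Z a b c d tau : (a * d - b * c = 1)%Z -> UHP tau ->
  dlog_eta (mob a b c d tau) =
  (IZR c * tau + IZR d) * (IZR c * tau + IZR d) * dlog_eta tau + IZR c * (IZR c * tau + IZR d) / 2.
Proof.
  intros D H. assert (0 < a * d - b * c)%Z as D0 by lia.
  pose proof (mob_den_neq_0 a b c d tau D0 H) as N.
  assert (logder (fun z => eta (mob a b c d z) ^ 2)
    (fun z => 2 * (dlog_eta (mob a b c d z) * (IZR (a * d - b * c) / ((IZR c * z + IZR d) * (IZR c * z + IZR d)))))) as H1.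
  { apply (logder_pow (fun z => eta (mob a b c d z)) _ 2).
    apply (logder_comp eta dlog_eta). apply logder_eta.
    intros; apply UHP_mob; auto. intros; apply cder_mob; auto. }
  assert (logder (fun z => zeta24 (2 * e12 a b c d) * (IZR c * z + IZR d) * eta z ^ 2)
    (fun z => 0 + IZR c / (IZR c * z + IZR d) + 2 * dlog_eta z)) as H2.
  { apply logder_mult; [apply logder_mult|].
    - apply logder_const, zeta24_neq_0.
    - intros z Hz. pose proof (mob_den_neq_0 a b c d z D0 Hz). split; auto.
      eapply cder_eq. apply cder_plus. apply cder_scal, cder_id. apply cder_const. field; auto.
    - apply (logder_pow eta dlog_eta 2 logder_eta). }
  destruct (H1 tau H) as [_ K1]. destruct (H2 tau H) as [N2 K2].
  assert (cder (fun z => zeta24 (2 * e12 a b c d) * (IZR c * z + IZR d) * eta z ^ 2)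
     (eta (mob a b c d tau) ^ 2 * (2 * (dlog_eta (mob a b c d tau) * (IZR (a * d - b * c) / ((IZR c * tau + IZR d) * (IZR c * tau + IZR d)))))) tau) as K3.
  { apply (cder_UHP_ext (fun z => eta (mob a b c d z) ^ 2)); auto.
    intros w Hw. apply eta_sqr_SL2Z; auto. }
  pose proof (cder_unique _ _ _ _ K2 K3) as E. cbv beta in E, N2.
  rewrite eta_sqr_SL2Z in E by auto.
  set (X := zeta24 (2 * e12 a b c d) * (IZR c * tau + IZR d) * eta tau ^ 2) in *.
  rewrite D in E.
  assert (0 + IZR c / (IZR c * tau + IZR d) + 2 * dlog_eta tau =
    2 * (dlog_eta (mob a b c d tau) * (1 / ((IZR c * tau + IZR d) * (IZR c * tau + IZR d))))) as E2.
  { match goal with |- ?l = ?r => replace l with (/ X * (X * l)) by (field; auto);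
      replace r with (/ X * (X * r)) by (field; auto) end. rewrite E. auto. }
  match type of E2 with ?l = ?r => 
    replace (dlog_eta (mob a b c d tau)) with
     (r * ((IZR c * tau + IZR d) * (IZR c * tau + IZR d)) / 2) by (field; auto) end.
  rewrite <- E2. field. auto.
Qed.

(** * Two functions on Gamma0(4) *)

Lemma UHP_scale (r : R) tau : (0 < r)%R -> UHP tau -> UHP (r * tau).
Proof. unfold UHP. destruct tau; unfold Im, Cmult, RtoC; simpl. nra. Qed.

Lemma logder_eta_scale (r : R) : (0 < r)%R -> logder (fun z => eta (r * z)) (fun z => dlog_eta (r * z) * r).
Proof.
  intros H. apply (logder_comp eta dlog_eta (fun z => r * z) (fun _ => RtoC r) logder_eta).
  - intros; apply UHP_scale; auto.
  - intros z _. eapply cder_eq. apply cder_scal, cder_id. ring.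
Qed.

Lemma logder_eta_S (r : R) : (0 < r)%R ->
  logder (fun z => eta (- / (r * z))) (fun z => dlog_eta (r * z) * r + / (2 * z)).
Proof.
  intros H.
  assert (RtoC r <> 0) as Nr by (intros E; apply RtoC_inj in E; lra).
  eapply logder_ext_r; [|apply (logder_comp eta dlog_eta (fun z => - / (r * z)) (fun z => / (r * z * z)) logder_eta)].
  - intros z Hz. cbv beta. rewrite dlog_eta_S by (apply UHP_scale; auto).
    field. pose proof (UHP_neq_0 _ Hz). auto.
  - intros; apply UHP_S, UHP_scale; auto.
  - intros z Hz. pose proof (UHP_neq_0 _ Hz) as Nz.
    eapply cder_eq. apply (cder_comp (fun z => - / z) (fun z => r * z)).
    + apply cder_S, Cmult_neq_0; auto.
    + apply cder_scal, cder_id.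
    + field. auto.
Qed.

Definition hq tau : C := eta (4 * tau) / eta tau.
Definition cq tau : C := eta (2 * tau) ^ 5 / (eta tau ^ 3 * eta (4 * tau) ^ 2).

Lemma eta_scale_neq_0 (r : R) tau : (0 < r)%R -> UHP tau -> eta (r * tau) <> 0.
Proof. intros; apply eta_neq_0, UHP_scale; auto. Qed.

Lemma hq_neq_0 tau : UHP tau -> hq tau <> 0.
Proof.
  intros H. apply Cmult_neq_0. apply eta_scale_neq_0; auto; lra. apply Cinv_neq_0, eta_neq_0, H.
Qed.

(** The Fricke involution of level 4. It conjugates translations into powers of (1 0; 4 1), so the
    behaviour under this second generator follows from the behaviour under translation. *)
Definition fricke tau : C := - / (4 * tau).

Lemma UHP_fricke tau : UHP tau -> UHP (fricke tau).
Proof. intros H. apply UHP_S, UHP_scale; auto; lra. Qed.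

Lemma fricke_fricke tau : UHP tau -> fricke (fricke tau) = tau.
Proof. intros H. unfold fricke. field. apply UHP_neq_0, H. Qed.

Lemma eta_1_fricke tau : UHP tau -> eta (4 * fricke tau) = eta (- / (1 * tau)).
Proof. intros H. unfold fricke. f_equal. field. apply UHP_neq_0, H. Qed.

Lemma eta_2_fricke tau : UHP tau -> eta (2 * fricke tau) = eta (- / (2 * tau)).
Proof. intros H. unfold fricke. f_equal. field. apply UHP_neq_0, H. Qed.

(** The involution exchanges eta(tau) and eta(4 tau); the terms 1/(2z) of the logarithmic
    derivatives cancel in weight 0. *)
Lemma hq_fricke : exists k : C, k <> 0 /\ forall tau, UHP tau -> hq (fricke tau) = k * / hq tau.
Proof.
  apply logder_same with (u := fun z => (dlog_eta (1 * z) * 1 + / (2 * z)) + - (dlog_eta (4 * z) * 4 + / (2 * z))).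
  - apply (logder_ext_l (fun z => eta (- / (1 * z)) * / eta (- / (4 * z)))).
    { intros z Hz. rewrite <- (eta_1_fricke z Hz). reflexivity. }
    apply logder_mult. apply logder_eta_S; lra. apply logder_inv, logder_eta_S; lra.
  - apply (logder_ext_l (fun z => / (eta (4 * z) * / eta (1 * z)))).
    { intros z Hz. rewrite Cmult_1_l. reflexivity. }
    eapply logder_ext_r; [|apply logder_inv, logder_mult; [apply (logder_eta_scale 4); lra|apply logder_inv, (logder_eta_scale 1); lra]].
    intros z Hz; cbv beta. field. apply UHP_neq_0, Hz.
Qed.

(** Here [cq] is not mapped to its own inverse or multiple: exchanging eta(tau) and eta(4 tau)
    leaves the extra factor 1/h, so the multiplier of [hq] enters that of [cq]. *)
Lemma cq_fricke : exists k : C, k <> 0 /\ forall tau, UHP tau -> cq (fricke tau) = k * (cq tau * / hq tau).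
Proof.
  apply logder_same with (u := fun z => INR 5 * (dlog_eta (2 * z) * 2 + / (2 * z)) +
     - (INR 3 * (dlog_eta (4 * z) * 4 + / (2 * z)) + INR 2 * (dlog_eta (1 * z) * 1 + / (2 * z)))).
  - apply (logder_ext_l (fun z => eta (- / (2 * z)) ^ 5 * / (eta (- / (4 * z)) ^ 3 * eta (- / (1 * z)) ^ 2))).
    { intros z Hz. rewrite <- (eta_1_fricke z Hz), <- (eta_2_fricke z Hz). reflexivity. }
    apply logder_mult. apply (logder_pow (fun z => eta (- / (2 * z)))), logder_eta_S; lra.
    apply logder_inv, logder_mult.
    apply (logder_pow (fun z => eta (- / (4 * z)))), logder_eta_S; lra.
    apply (logder_pow (fun z => eta (- / (1 * z)))), logder_eta_S; lra.
  - apply (logder_ext_l (fun z => (eta (2 * z) ^ 5 * / (eta (1 * z) ^ 3 * eta (4 * z) ^ 2)) * / (eta (4 * z) * / eta (1 * z)))).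
    { intros z Hz. rewrite Cmult_1_l. reflexivity. }
    eapply logder_ext_r; [|apply logder_mult; [apply logder_mult; [apply (logder_pow (fun z => eta (2 * z))), (logder_eta_scale 2); lra
      |apply logder_inv, logder_mult; [apply (logder_pow (fun z => eta (1 * z))), (logder_eta_scale 1); lra
       |apply (logder_pow (fun z => eta (4 * z))), (logder_eta_scale 4); lra]]
      |apply logder_inv, logder_mult; [apply (logder_eta_scale 4); lra|apply logder_inv, (logder_eta_scale 1); lra]]].
    intros z Hz; cbv beta.
    assert (INR 5 = 5%R) as -> by (simpl; lra). assert (INR 3 = 3%R) as -> by (simpl; lra).
    assert (INR 2 = 2%R) as -> by (simpl; lra). field. apply UHP_neq_0, Hz.
Qed.

Lemma eta_scale_shift (m : Z) tau (n : Z) :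
  eta (IZR m * (tau + IZR n)) = zeta24 (m * n) * eta (IZR m * tau).
Proof.
  rewrite <- eta_shift, mult_IZR, RtoC_mult. f_equal. ring.
Qed.

Lemma hq_shift tau (n : Z) : hq (tau + IZR n) = zeta24 (3 * n) * hq tau.
Proof.
  unfold hq. rewrite (eta_scale_shift 4), eta_shift.
  replace (4 * n)%Z with (3 * n + n)%Z by ring. rewrite zeta24_add.
  destruct (Ceq_dec (eta tau) 0) as [->|N].
  - rewrite Cmult_0_r. unfold Cdiv. rewrite Cinv_0. ring.
  - field. split; auto. apply zeta24_neq_0.
Qed.

Lemma cq_shift tau (n : Z) : UHP tau -> cq (tau + IZR n) = zeta24 (- n) * cq tau.
Proof.
  intros H. unfold cq. rewrite (eta_scale_shift 4), (eta_scale_shift 2), eta_shift.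
  assert (eta (4 * tau) <> 0) by (apply eta_scale_neq_0; auto; lra).
  pose proof (eta_neq_0 tau H).
  replace (4 * n)%Z with (n + n + n + n)%Z by ring. replace (2 * n)%Z with (n + n)%Z by ring.
  rewrite zeta24_opp, !zeta24_add. pose proof (zeta24_neq_0 n). field. auto.
Qed.

Lemma V_fricke tau : UHP tau -> fricke (fricke tau + IZR (-1)) = mob 1 0 4 1 tau.
Proof.
  intros H. pose proof (UHP_neq_0 _ H).
  assert (4 * tau + 1 <> 0). { apply (mob_den_neq_0 1 0 4 1 tau ltac:(lia) H). }
  unfold fricke, mob. field. repeat split; auto.
  intros E. apply H1. replace (4 * tau + 1) with (- (-1 + -1 * (4 * tau))) by ring. rewrite E. ring.
Qed.

Lemma V'_fricke tau : UHP tau -> fricke (fricke tau + IZR 1) = mob 1 0 (-4) 1 tau.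
Proof.
  intros H. pose proof (UHP_neq_0 _ H).
  assert (-4 * tau + 1 <> 0). { apply (mob_den_neq_0 1 0 (-4) 1 tau ltac:(lia) H). }
  unfold fricke, mob. field. repeat split; auto.
  intros E. apply H1. replace (-4 * tau + 1) with (- (-1 + 4 * tau)) by ring. rewrite E. ring.
Qed.

(** The involution is applied twice, so its unknown constant cancels. *)
Lemma hq_V tau (n : Z) : UHP tau -> hq (fricke (fricke tau + IZR n)) = zeta24 (- (3 * n)) * hq tau.
Proof.
  intros H. destruct hq_fricke as [k [Nk K]]. pose proof (UHP_fricke _ H) as H'.
  rewrite K by (apply UHP_shift; auto). rewrite hq_shift, K by auto.
  rewrite zeta24_opp. pose proof (hq_neq_0 _ H). pose proof (zeta24_neq_0 (3 * n)). field. auto.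
Qed.

Lemma cq_V tau (n : Z) : UHP tau -> cq (fricke (fricke tau + IZR n)) = zeta24 (- (4 * n)) * cq tau.
Proof.
  intros H. destruct cq_fricke as [k [Nk K]]. pose proof (UHP_fricke _ H) as H'.
  rewrite K by (apply UHP_shift; auto). rewrite hq_shift, cq_shift by auto.
  replace (- (4 * n))%Z with (- n + - (3 * n))%Z by ring.
  rewrite zeta24_add, (zeta24_opp (3 * n)).
  assert (cq tau = k * (cq (fricke tau) * / hq (fricke tau))) as ->.
  { rewrite <- K, fricke_fricke; auto. }
  pose proof (hq_neq_0 _ H'). pose proof (zeta24_neq_0 (3 * n)). field. auto.
Qed.

(* Exponents of the multipliers of hq and cq on (a, b; 4c, d). *)
Definition eh (a b c d : Z) : Z := (3 * ((b + c) * d))%Z.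
Definition ec (a b c d : Z) : Z :=
  (9 * (4 * c * d - b * d + (d * d - 1) / 2) - 16 * (b * d * (1 - c * c) + c * (a + d)))%Z.

Lemma mob_mul_T a b c d tau n : (a * d - b * c = 1)%Z -> UHP tau ->
  mob a (b + n * a) c (d + n * c) tau = mob a b c d (tau + IZR n).
Proof. intros. symmetry. apply mob_shift; auto. Qed.

Lemma mob_mul_V a b c d tau n : (a * d - b * c = 1)%Z -> UHP tau ->
  mob (a + n * b) b (c + n * d) d tau = mob a b c d (mob 1 0 n 1 tau).
Proof. intros. rewrite mob_mob by (auto; lia). f_equal; ring. Qed.

Lemma mob_opp a b c d tau : mob (- a) (- b) (- c) (- d) tau = mob a b c d tau.
Proof.
  unfold mob. rewrite !opp_IZR, !RtoC_opp.
  replace (- IZR a * tau + - IZR b) with (- (IZR a * tau + IZR b)) by ring.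
  replace (- IZR c * tau + - IZR d) with (- (IZR c * tau + IZR d)) by ring.
  destruct (Ceq_dec (IZR c * tau + IZR d) 0) as [->|N].
  - unfold Cdiv. replace (- 0) with (RtoC 0) by ring. rewrite Cinv_0. ring.
  - set (y := IZR c * tau + IZR d) in *. field. auto.
Qed.

(** t and v are the exponents of T and of V = (1 0; 4 1), where V is the conjugate by [fricke] of
    the translation by -1. The congruences for the inverse generators follow from those for T and V
    at the matrix already multiplied. *)
Lemma Gamma0_4_multiplier f (e : Z -> Z -> Z -> Z -> Z) (t v : Z) :
  (forall tau n, UHP tau -> f (tau + IZR n) = zeta24 (t * n) * f tau) ->
  (forall tau n, UHP tau -> f (fricke (fricke tau + IZR n)) = zeta24 (- (v * n)) * f tau) ->
  congr 24 (e 1 0 0 1)%Z 0 ->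
  (forall a b c d, a * d - b * (4 * c) = 1 -> congr 24 (e (- a) (- b) (- c) (- d)) (e a b c d))%Z ->
  (forall a b c d, a * d - b * (4 * c) = 1 -> congr 24 (e a (b + a) c (d + 4 * c)) (e a b c d + t))%Z ->
  (forall a b c d, a * d - b * (4 * c) = 1 -> congr 24 (e (a + 4 * b) b (c + d) d) (e a b c d + v))%Z ->
  forall a b c d, (a * d - b * (4 * c) = 1)%Z -> forall tau, UHP tau ->
  f (mob a b (4 * c) d tau) = zeta24 (e a b c d) * f tau.
Proof.
  intros HT HV E1 EI ET EV. refine (Gamma0_4_ind _ _ _ _ _ _ _).
  - intros tau H. rewrite mob_id, (zeta24_cong _ 0), zeta24_0 by exact E1. ring.
  - intros a b c d D K tau H. replace (4 * - c)%Z with (- (4 * c))%Z by ring.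
    rewrite mob_opp, K by auto. f_equal. symmetry. apply zeta24_cong, EI; auto.
  - intros a b c d D K tau H.
    rewrite (zeta24_cong _ _ (ET a b c d D)), zeta24_add.
    rewrite <- (Z.mul_1_l a) at 2. rewrite <- (Z.mul_1_l (4 * c)) at 2.
    rewrite mob_mul_T, K, HT by (auto using UHP_shift). rewrite Z.mul_1_r. ring.
  - intros a b c d D K tau H.
    assert (congr 24 (e a b c d) (e a (b - a) c (d - 4 * c) + t)%Z) as Q.
    { pose proof (ET a (b - a) c (d - 4 * c) ltac:(lia))%Z as Q.
      replace (b - a + a)%Z with b in Q by ring. replace (d - 4 * c + 4 * c)%Z with d in Q by ring. auto. }
    rewrite (zeta24_cong (e a (b - a) c (d - 4 * c)) (e a b c d + - t))%Z.
    2: { destruct Q as [x Q]. exists (- x)%Z. lia. }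
    rewrite zeta24_add.
    replace (b - a)%Z with (b + (-1) * a)%Z by ring. replace (d - 4 * c)%Z with (d + (-1) * (4 * c))%Z by ring.
    rewrite mob_mul_T, K, HT by (auto using UHP_shift).
    replace (t * -1)%Z with (- t)%Z by ring. ring.
  - intros a b c d D K tau H.
    rewrite (zeta24_cong _ _ (EV a b c d D)), zeta24_add.
    replace (4 * (c + d))%Z with (4 * c + 4 * d)%Z by ring.
    rewrite mob_mul_V, K by (auto; apply UHP_mob; auto; lia).
    rewrite <- V_fricke, HV by auto. replace (- (v * -1))%Z with v by ring. ring.
  - intros a b c d D K tau H.
    assert (congr 24 (e a b c d) (e (a - 4 * b) b (c - d) d + v)%Z) as Q.
    { pose proof (EV (a - 4 * b) b (c - d) d ltac:(lia))%Z as Q.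
      replace (a - 4 * b + 4 * b)%Z with a in Q by ring. replace (c - d + d)%Z with c in Q by ring. auto. }
    rewrite (zeta24_cong (e (a - 4 * b) b (c - d) d) (e a b c d + - v))%Z.
    2: { destruct Q as [x Q]. exists (- x)%Z. lia. }
    rewrite zeta24_add.
    replace (4 * (c - d))%Z with (4 * c + -4 * d)%Z by ring.
    replace (a - 4 * b)%Z with (a + -4 * b)%Z by ring.
    rewrite mob_mul_V, K by (auto; apply UHP_mob; auto; lia).
    rewrite <- V'_fricke, HV by auto. replace (- (v * 1))%Z with (- v)%Z by ring. ring.
Qed.

Lemma congr_8_24 x y : congr 8 x y -> congr 24 (3 * x) (3 * y).
Proof. intros [k E]. exists k. lia. Qed.

Lemma hq_Gamma0_4 a b c d : (a * d - b * (4 * c) = 1)%Z -> forall tau, UHP tau ->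
  hq (mob a b (4 * c) d tau) = zeta24 (eh a b c d) * hq tau.
Proof.
  revert a b c d. apply (Gamma0_4_multiplier hq eh 3 3).
  - intros; apply hq_shift.
  - intros; apply hq_V; auto.
  - exists 0%Z. reflexivity.
  - intros a b c d H. exists 0%Z. unfold eh. ring.
  - intros a b c d H. unfold eh. replace (3 * ((b + c) * d) + 3)%Z with (3 * ((b + c) * d + 1))%Z by ring.
    apply congr_8_24.
    assert (congr 8 ((b + a + c) * (d + 4 * c) - ((b + c) * d + 1)) 0)%Z as [k K]; [|exists k; lia].
    congr_enum 8%nat (fun a b c d : Z => a * d - b * (4 * c) - 1)%Z
      (fun a b c d : Z => (b + a + c) * (d + 4 * c) - ((b + c) * d + 1))%Z a b c d. lia.
  - intros a b c d H. unfold eh. replace (3 * ((b + c) * d) + 3)%Z with (3 * ((b + c) * d + 1))%Z by ring.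
    apply congr_8_24.
    assert (congr 8 ((b + (c + d)) * d - ((b + c) * d + 1)) 0)%Z as [k K]; [|exists k; lia].
    congr_enum 8%nat (fun a b c d : Z => a * d - b * (4 * c) - 1)%Z
      (fun a b c d : Z => (b + (c + d)) * d - ((b + c) * d + 1))%Z a b c d. lia.
Qed.

(** The Chinese remainder form in which [ec] is written: it allows enumeration modulo 8 and modulo 3
    instead of modulo 24. *)
Lemma congr_24_split x y x' y' : congr 8 x x' -> congr 3 y y' -> congr 24 (9 * x - 16 * y) (9 * x' - 16 * y').
Proof. intros [k K] [l L]. exists (3 * k - 2 * l)%Z. lia. Qed.

(** Eliminates the integer division from [ec]; with d = 2k + 1 the congruences become polynomial and
    can be enumerated in k. *)
Lemma half_odd_sqr k : (((2 * k + 1) * (2 * k + 1) - 1) / 2 = 2 * (k * (k + 1)))%Z.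
Proof.
  replace ((2 * k + 1) * (2 * k + 1) - 1)%Z with ((2 * (k * (k + 1))) * 2)%Z by ring.
  apply Z.div_mul. lia.
Qed.

Lemma Gamma0_4_odd a b c d : (a * d - b * (4 * c) = 1)%Z -> exists k, d = (2 * k + 1)%Z.
Proof.
  intros H. destruct (Z.Even_or_Odd d) as [[k E]|[k E]]; [|exists k; auto].
  exfalso. subst d. assert (2 * (a * k - b * (2 * c)) = 1)%Z by lia. lia.
Qed.

Lemma cq_Gamma0_4 a b c d : (a * d - b * (4 * c) = 1)%Z -> forall tau, UHP tau ->
  cq (mob a b (4 * c) d tau) = zeta24 (ec a b c d) * cq tau.
Proof.
  revert a b c d. apply (Gamma0_4_multiplier cq ec (-1) 4).
  - intros tau n H. rewrite cq_shift by auto. replace (-1 * n)%Z with (- n)%Z by ring. reflexivity.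
  - intros; apply cq_V; auto.
  - exists 0%Z. reflexivity.
  - intros a b c d H. exists 0%Z. unfold ec. replace (- d * - d)%Z with (d * d)%Z by ring. ring.
  - intros a b c d H. destruct (Gamma0_4_odd a b c d H) as [k ->]. unfold ec.
    replace (2 * k + 1 + 4 * c)%Z with (2 * (k + 2 * c) + 1)%Z by ring.
    rewrite !half_odd_sqr.
    (* The increment -1 is split as 9 (-1) - 16 (1) = -25 modulo 24, one summand for each
       modulus. *)
    match goal with |- congr 24 _ (9 * ?x - 16 * ?y + -1)%Z =>
      apply congr_trans with (9 * (x - 1) - 16 * (y + 1))%Z; [apply congr_24_split|exists (-1)%Z; lia] end.
    + match goal with |- congr 8 ?x ?y => assert (congr 8 (x - y) 0)%Z as [m M]; [|exists m; lia] end.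
      congr_enum 8%nat (fun a b c k : Z => a * (2 * k + 1) - b * (4 * c) - 1)%Z
       (fun a b c k : Z => 4 * c * (2 * (k + 2 * c) + 1) - (b + a) * (2 * (k + 2 * c) + 1) +
          2 * ((k + 2 * c) * (k + 2 * c + 1)) - (4 * c * (2 * k + 1) - b * (2 * k + 1) + 2 * (k * (k + 1)) - 1))%Z a b c k.
      lia.
    + match goal with |- congr 3 ?x ?y => assert (congr 3 (x - y) 0)%Z as [m M]; [|exists m; lia] end.
      congr_enum 3%nat (fun a b c k : Z => a * (2 * k + 1) - b * (4 * c) - 1)%Z
       (fun a b c k : Z => (b + a) * (2 * (k + 2 * c) + 1) * (1 - c * c) + c * (a + (2 * (k + 2 * c) + 1)) -
          (b * (2 * k + 1) * (1 - c * c) + c * (a + (2 * k + 1)) + 1))%Z a b c k.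
      lia.
  - intros a b c d H. destruct (Gamma0_4_odd a b c d H) as [k ->]. unfold ec.
    rewrite !half_odd_sqr.
    match goal with |- congr 24 _ (9 * ?x - 16 * ?y + 4)%Z =>
      apply congr_trans with (9 * (x + 4) - 16 * (y - 1))%Z; [apply congr_24_split|exists 2%Z; lia] end.
    + match goal with |- congr 8 ?x ?y => assert (congr 8 (x - y) 0)%Z as [m M]; [|exists m; lia] end.
      congr_enum 8%nat (fun a b c k : Z => a * (2 * k + 1) - b * (4 * c) - 1)%Z
       (fun a b c k : Z => 4 * (c + (2 * k + 1)) * (2 * k + 1) - b * (2 * k + 1) +
          2 * (k * (k + 1)) - (4 * c * (2 * k + 1) - b * (2 * k + 1) + 2 * (k * (k + 1)) + 4))%Z a b c k.
      lia.
    + match goal with |- congr 3 ?x ?y => assert (congr 3 (x - y) 0)%Z as [m M]; [|exists m; lia] end.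
      congr_enum 3%nat (fun a b c k : Z => a * (2 * k + 1) - b * (4 * c) - 1)%Z
       (fun a b c k : Z => b * (2 * k + 1) * (1 - (c + (2 * k + 1)) * (c + (2 * k + 1))) + (c + (2 * k + 1)) * (a + 4 * b + (2 * k + 1)) -
          (b * (2 * k + 1) * (1 - c * c) + c * (a + (2 * k + 1)) - 1))%Z a b c k.
      lia.
Qed.

(** * Expansions of eta quotients *)

(* f is q^(M/12000) times a power series in q^(1/12000) that converges on the
   whole half-plane; 12000 = 24 * 500 is a common denominator for all the
   expansions of eta occurring below. *)
Definition laurent (M : Z) f : Prop := exists b F, disc_series b F /\
  forall tau, UHP tau -> f tau = qpow (IZR M / 12000) tau * F (qpow (/ 12000) tau).

(** [laurent] bounds the order only from below. With the bound for the reciprocal, M is the exact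
    order of a nonvanishing f, and negative powers such as those of T can be treated. *)
Definition laurent_unit (M : Z) f : Prop := laurent M f /\ laurent (- M) (fun tau => / f tau).

Lemma laurent_ext M f g : (forall tau, UHP tau -> f tau = g tau) -> laurent M f -> laurent M g.
Proof. intros E [b [F [H K]]]. exists b, F. split; auto. intros. rewrite <- E; auto. Qed.

Lemma laurent_mult M N f g : laurent M f -> laurent N g -> laurent (M + N) (fun tau => f tau * g tau).
Proof.
  intros [b [F [H1 K1]]] [c [G [H2 K2]]]. exists (cauchy b c), (fun x => F x * G x).
  split. { apply disc_series_mult; auto. } intros tau H. rewrite K1, K2 by auto.
  replace (IZR (M + N) / 12000)%R with (IZR M / 12000 + IZR N / 12000)%R by (rewrite plus_IZR; field).
  rewrite qpow_plus. ring.
Qed.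

Lemma laurent_plus M f g : laurent M f -> laurent M g -> laurent M (fun tau => f tau + g tau).
Proof.
  intros [b [F [H1 K1]]] [c [G [H2 K2]]]. exists (fun k => b k + c k), (fun x => F x + G x).
  split. { apply disc_series_plus; auto. } intros tau H. rewrite K1, K2 by auto. ring.
Qed.

Lemma qpow_0 tau : qpow 0 tau = 1.
Proof. unfold qpow. replace (2 * PI * Ci * 0 * tau) with (RtoC 0) by ring. apply Cexp_0. Qed.

Lemma laurent_const (k : C) : laurent 0 (fun _ => k).
Proof.
  exists (fun j => if (j =? 0)%nat then k else 0), (fun _ => k). split. { apply disc_series_const. }
  intros tau H. unfold Rdiv. rewrite Rmult_0_l, qpow_0. ring.
Qed.

Lemma laurent_scal (k : C) M f : laurent M f -> laurent M (fun tau => k * f tau).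
Proof. intros H. apply (laurent_mult 0 M _ _ (laurent_const k) H). Qed.

Lemma laurent_mono M N f : (N <= M)%Z -> laurent M f -> laurent N f.
Proof.
  intros L [b [F [H K]]]. destruct (disc_series_pow _ _ (Z.to_nat (M - N)) disc_series_id) as [c Hc].
  exists (cauchy c b), (fun x => x ^ Z.to_nat (M - N) * F x). split. { apply disc_series_mult; auto. }
  intros tau Ht. rewrite K, qpow_pow by auto.
  rewrite INR_IZR_INZ, Z2Nat.id, minus_IZR by lia.
  replace (IZR M / 12000)%R with (IZR N / 12000 + (IZR M - IZR N) * / 12000)%R by field.
  rewrite qpow_plus. ring.
Qed.

Lemma laurent_unit_ext M f g : (forall tau, UHP tau -> f tau = g tau) -> laurent_unit M f -> laurent_unit M g.
Proof.
  intros E [H K]. split; eapply laurent_ext; eauto. intros; cbv beta. rewrite E; auto.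
Qed.

Lemma laurent_unit_mult M N f g : laurent_unit M f -> laurent_unit N g -> laurent_unit (M + N) (fun tau => f tau * g tau).
Proof.
  intros [H1 K1] [H2 K2]. split. { apply laurent_mult; auto. }
  replace (- (M + N))%Z with (- M + - N)%Z by ring.
  eapply laurent_ext; [|apply (laurent_mult _ _ _ _ K1 K2)]. intros tau _; cbv beta.
  destruct (Ceq_dec (f tau) 0) as [->|N1]. { rewrite Cmult_0_l, !Cinv_0. ring. }
  destruct (Ceq_dec (g tau) 0) as [->|N2]. { rewrite Cmult_0_r, !Cinv_0. ring. }
  field. auto.
Qed.

Lemma Cinv_involutive z : / / z = z.
Proof.
  destruct (Ceq_dec z 0) as [->|N]. { rewrite !Cinv_0; auto. } field. auto.
Qed.

Lemma laurent_unit_inv M f : laurent_unit M f -> laurent_unit (- M) (fun tau => / f tau).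
Proof.
  intros [H K]. split; auto. rewrite Z.opp_involutive.
  eapply laurent_ext; [|exact H]. intros; symmetry; apply Cinv_involutive.
Qed.

Lemma laurent_unit_const (k : C) : laurent_unit 0 (fun _ => k).
Proof. split; apply laurent_const. Qed.

Lemma laurent_unit_pow M f n : laurent_unit M f -> laurent_unit (Z.of_nat n * M) (fun tau => f tau ^ n).
Proof.
  intros H. induction n. { apply (laurent_unit_const 1). }
  replace (Z.of_nat (S n) * M)%Z with (M + Z.of_nat n * M)%Z by lia. apply laurent_unit_mult; auto.
Qed.

Lemma laurent_unit_Cpowz M f (r : Z) : laurent_unit M f -> laurent_unit (r * M) (fun tau => Cpowz (f tau) r).
Proof.
  intros H. destruct r as [|p|p]; simpl Cpowz.
  - apply (laurent_unit_const 1).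
  - rewrite <- positive_nat_Z. apply laurent_unit_pow; auto.
  - replace (Z.neg p * M)%Z with (- (Z.of_nat (Pos.to_nat p) * M))%Z by (rewrite positive_nat_Z; lia).
    apply laurent_unit_inv, laurent_unit_pow; auto.
Qed.

Lemma Cmod_Cexp_Ci (x : R) : Cmod (Cexp (Ci * x)) = 1%R.
Proof.
  rewrite Cmod_Cexp. replace (Re (Ci * x)) with 0%R. apply exp_0.
  unfold Ci, Cmult, RtoC, Re; simpl. ring.
Qed.

(** In the parameter x = q^(1/12000), q((A tau + B)/D) is a root of unity times x^m with m = 12000 A
    / D, and the prefactor q^r becomes a root of unity times x^M. *)
Lemma laurent_affine (A B D M : Z) (m : nat) b F (r : R) : (0 < D)%Z -> (0 < m)%nat -> disc_series b F ->
  (IZR M * IZR D = 12000 * (r * IZR A))%R -> (INR m * IZR D = 12000 * IZR A)%R ->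
  laurent M (fun tau => qpow r (mob A B 0 D tau) * F (q (mob A B 0 D tau))).
Proof.
  intros HD Hm HF E1 E2. apply IZR_lt in HD.
  assert (RtoC (IZR D) <> 0) as ND by (intros E; apply RtoC_inj in E; lra).
  assert (forall (s t : R) tau, (t * IZR D = s * IZR A)%R -> qpow s (mob A B 0 D tau) =
     Cexp (Ci * (2 * PI * s * IZR B / IZR D)%R) * qpow t tau) as K.
  { intros s t tau E. unfold qpow, mob. rewrite <- Cexp_plus. f_equal.
    replace t with (s * IZR A / IZR D)%R by (rewrite <- E; field; lra).
    rewrite !RtoC_div, !RtoC_mult by lra. field. auto. }
  set (c1 := Cexp (Ci * (2 * PI * r * IZR B / IZR D)%R)).
  set (c2 := Cexp (Ci * (2 * PI * 1 * IZR B / IZR D)%R)).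
  pose proof (disc_series_spread m c2 b F Hm (Cmod_Cexp_Ci _) HF) as HS.
  exists (fun k => c1 * spread m c2 b k), (fun x => c1 * F (c2 * x ^ m)). split.
  { apply disc_series_scal, HS. }
  intros tau Ht. unfold q. rewrite (K r (IZR M / 12000)%R), (K 1%R (INR m / 12000)%R).
  - fold c1 c2. rewrite qpow_pow. replace (INR m * / 12000)%R with (INR m / 12000)%R by reflexivity. ring.
  - lra.
  - lra.
Qed.

Lemma dvd_500_pos D : (D | 500)%Z -> (0 < D)%Z -> (0 < 500 / D)%Z /\ (500 = D * (500 / D))%Z.
Proof.
  intros [k E] H. rewrite E, Z.div_mul by lia. nia.
Qed.

(** The order A / (24 D) in q, times 12000; the factor 24 absorbs q^(1/24) and 500 clears D. The
    reciprocal is covered by the series for 1/(q;q). *)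
Lemma laurent_unit_eta (A B D : Z) : (0 < A)%Z -> (0 < D)%Z -> (D | 500)%Z ->
  laurent_unit (A * (500 / D)) (fun tau => eta (mob A B 0 D tau)).
Proof.
  intros HA HD Hdvd. destruct (dvd_500_pos D Hdvd HD) as [P E].
  set (e := (500 / D)%Z) in *.
  assert (INR (Z.to_nat (24 * A * e)) * IZR D = 12000 * IZR A)%R as Em.
  { rewrite INR_IZR_INZ, Z2Nat.id by nia. rewrite <- !mult_IZR. f_equal. nia. }
  assert (IZR D * IZR e = 500)%R as Er by (rewrite <- mult_IZR; f_equal; auto).
  assert (0 < Z.to_nat (24 * A * e))%nat as Hm by (assert (0 < 24 * A * e)%Z by nia; lia).
  split.
  - apply (laurent_affine A B D _ _ _ _ (/ 24) HD Hm disc_series_qpoch); [|exact Em].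
    rewrite mult_IZR. transitivity (IZR A * (IZR D * IZR e))%R; [ring|rewrite Er; field].
  - eapply laurent_ext; [|apply (laurent_affine A B D (- (A * e)) _ _ _ (- / 24) HD Hm disc_series_qpoch_inv); [|exact Em]].
    + intros tau Ht. cbv beta. unfold eta.
      replace (qpow (- / 24) (mob A B 0 D tau)) with (/ qpow (/ 24) (mob A B 0 D tau)).
      * assert (UHP (mob A B 0 D tau)) as Hu by (apply UHP_mob; auto; nia).
        pose proof (qpow_neq_0 (/ 24) (mob A B 0 D tau)).
        destruct (qpoch_inv _ (Cmod_q_lt_1 _ Hu)) as [N _]. field. auto.
      * unfold qpow. rewrite <- Cexp_opp. f_equal. rewrite RtoC_opp. ring.
    + rewrite opp_IZR, mult_IZR. transitivity (- (IZR A * (IZR D * IZR e)))%R; [ring|rewrite Er; field].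
Qed.

Lemma logder_Cpowz f u (r : Z) : logder f u -> logder (fun z => Cpowz (f z) r) (fun z => IZR r * u z).
Proof.
  intros H. destruct r as [|p|p]; simpl Cpowz.
  - eapply logder_ext_r; [|apply (logder_pow f u 0 H)]. intros; simpl; ring.
  - eapply logder_ext_r; [|apply (logder_pow f u (Pos.to_nat p) H)]. intros; cbv beta.
    rewrite INR_IZR_INZ, positive_nat_Z. auto.
  - eapply logder_ext_r; [|apply logder_inv, (logder_pow f u (Pos.to_nat p) H)]. intros; cbv beta.
    rewrite INR_IZR_INZ, positive_nat_Z. replace (IZR (Z.neg p)) with (- IZR (Z.pos p))%R by (rewrite <- opp_IZR; auto).
    rewrite RtoC_opp. ring.
Qed.

(* 12000 times the order in q of eta(delta * m tau), for an integral matrix m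
   of determinant n with first column (a, c). *)
Definition etaord (delta a c n : Z) : Z :=
  let A := Z.gcd (delta * a) c in (A * (500 / (delta * n / A)))%Z.

(** The comparison is made between logarithmic derivatives, so no multiplier and no square root of
    cz + d appear. The excess c / (2 (cz + d)) does not depend on delta, hence cancels in quotients
    of weight 0. *)
Lemma eta_expansion (delta a b c d n : Z) : (a * d - b * c = n)%Z -> (0 < n)%Z ->
  (0 < delta)%Z -> (delta * n | 500)%Z -> exists phi v, logder phi v /\
  logder (fun z => eta (IZR delta * mob a b c d z)) (fun z => v z + IZR c / (2 * (IZR c * z + IZR d))) /\
  laurent_unit (etaord delta a c n) phi.
Proof.
  intros Hdet Hn Hd Hdvd. unfold etaord. set (A := Z.gcd (delta * a) c).
  assert (0 < A)%Z as HA.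
  { assert (A <> 0)%Z; [|pose proof (Z.gcd_nonneg (delta * a) c); fold A in H0; lia].
    intros E. apply Z.gcd_eq_0 in E. destruct E as [E ->]. assert (a = 0)%Z by nia. subst a. lia. }
  destruct (Z.gcd_divide_l (delta * a) c) as [p Hp]. destruct (Z.gcd_divide_r (delta * a) c) as [r Hr].
  fold A in Hp, Hr. destruct (Z.gcd_bezout (delta * a) c A eq_refl) as [y [x' Hb]].
  fold A in Hb. clearbody A.
  assert (y * p + x' * r = 1)%Z as Hu.
  { apply (Z.mul_reg_r _ _ A); [lia|]. rewrite Z.mul_1_l.
    transitivity (y * (delta * a) + x' * c)%Z; [rewrite Hp, Hr; ring|exact Hb]. }
  (* Bezout completes the primitive column (p, r) to (p x; r y) in SL(2,Z), and (delta a, delta b;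
     c, d) = (p x; r y)(A B; 0 D). *)
  set (x := (- x')%Z). assert (p * y - x * r = 1)%Z as Hdet1 by (unfold x; lia).
  set (B := (y * (delta * b) - x * d)%Z). set (D := (p * d - r * (delta * b))%Z).
  assert (A * D = delta * n)%Z as HAD.
  { transitivity ((p * A) * d - (r * A) * (delta * b))%Z; [unfold D; ring|].
    rewrite <- Hp, <- Hr, <- Hdet. ring. }
  assert (0 < D)%Z as HD by (assert (0 < delta * n)%Z by nia; nia).
  assert (p * B + x * D = delta * b)%Z as EB.
  { transitivity ((p * y - x * r) * (delta * b))%Z; [unfold B, D; ring|]. rewrite Hdet1. ring. }
  assert (r * B + y * D = d)%Z as ED.
  { transitivity ((p * y - x * r) * d)%Z; [unfold B, D; ring|]. rewrite Hdet1. ring. }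
  assert (forall z, UHP z -> IZR delta * mob a b c d z = mob p x r y (mob A B 0 D z)) as Em.
  { intros z Hz. rewrite mob_mob by (auto; nia).
    replace (p * A + x * 0)%Z with (delta * a)%Z by lia.
    rewrite EB, ED. replace (r * A + y * 0)%Z with c by lia.
    unfold mob. rewrite !mult_IZR, !RtoC_mult. unfold Cdiv. ring. }
  exists (fun z => eta (mob A B 0 D z)), (fun z => dlog_eta (mob A B 0 D z) *
     (IZR (A * D - B * 0) / ((IZR 0 * z + IZR D) * (IZR 0 * z + IZR D)))).
  split; [|split].
  - apply (logder_comp eta dlog_eta). apply logder_eta. intros; apply UHP_mob; auto; nia.
    intros; apply cder_mob; auto; nia.
  - apply (logder_ext_l (fun z => eta (mob (delta * a) (delta * b) c d z))).
    { intros z Hz. f_equal. unfold mob. rewrite !mult_IZR, !RtoC_mult. unfold Cdiv. ring. }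
    eapply logder_ext_r; [|apply (logder_comp eta dlog_eta (mob (delta * a) (delta * b) c d)
      (fun z => IZR (delta * a * d - delta * b * c) / ((IZR c * z + IZR d) * (IZR c * z + IZR d)))
      logder_eta)].
    + intros z Hz. cbv beta.
      assert (mob (delta * a) (delta * b) c d z = mob p x r y (mob A B 0 D z)) as ->.
      { rewrite <- Em by auto. unfold mob. rewrite !mult_IZR, !RtoC_mult. unfold Cdiv. ring. }
      rewrite dlog_eta_SL2Z by (auto; apply UHP_mob; auto; nia).
      set (L := dlog_eta (mob A B 0 D z)).
      replace (delta * a * d - delta * b * c)%Z with (A * D)%Z by nia.
      replace (A * D - B * 0)%Z with (A * D)%Z by ring.
      assert (RtoC (IZR D) <> 0) as ND.
      { intros E. apply RtoC_inj in E. apply eq_IZR in E. lia. }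
      assert (IZR c * z + IZR d <> 0) as Nc by (apply (mob_den_neq_0 a b c d z); auto; lia).
      assert (IZR r * mob A B 0 D z + IZR y = (IZR c * z + IZR d) / IZR D) as ->.
      { unfold mob. rewrite <- ED, Hr, plus_IZR, !mult_IZR, RtoC_plus, !RtoC_mult. field. auto. }
      assert (RtoC (IZR c) = IZR r * IZR A) as Ec by (rewrite Hr, mult_IZR, RtoC_mult; auto).
      rewrite mult_IZR, RtoC_mult. set (t := IZR c * z + IZR d) in *.
      rewrite Ec. field. auto.
    + intros; apply UHP_mob; auto; nia.
    + intros; apply cder_mob; auto; nia.
  - rewrite <- HAD. replace (A * D / A)%Z with D by (rewrite Z.mul_comm, Z.div_mul; lia).
    apply laurent_unit_eta; auto. eapply Z.divide_trans; [|exact Hdvd]. exists A. lia.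
Qed.

Fixpoint etaq (l : list (Z * Z)) tau : C :=
  match l with
  | nil => 1
  | (delta, r) :: l' => Cpowz (eta (IZR delta * tau)) r * etaq l' tau
  end.

Fixpoint etaq_weight (l : list (Z * Z)) : Z :=
  match l with nil => 0 | (_, r) :: l' => r + etaq_weight l' end%Z.

Fixpoint etaq_ord (l : list (Z * Z)) (a c n : Z) : Z :=
  match l with nil => 0 | (delta, r) :: l' => r * etaord delta a c n + etaq_ord l' a c n end%Z.

Definition etaq_level (l : list (Z * Z)) (N : Z) : Prop :=
  Forall (fun p => 0 < fst p /\ (fst p | N))%Z l.

Lemma etaq_expansion (l : list (Z * Z)) (a b c d n N : Z) : (a * d - b * c = n)%Z -> (0 < n)%Z ->
  etaq_level l N -> (N * n | 500)%Z -> exists phi v, logder phi v /\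
  logder (fun z => etaq l (mob a b c d z))
    (fun z => v z + IZR (etaq_weight l) * (IZR c / (2 * (IZR c * z + IZR d)))) /\
  laurent_unit (etaq_ord l a c n) phi.
Proof.
  intros Hdet Hn HL HN. induction HL as [|[delta r] l [H1 H2] _ IH].
  - exists (fun _ => 1), (fun _ => 0). assert (logder (fun _ => RtoC 1) (fun _ => RtoC 0)) as K.
    { apply logder_const. intros E; apply RtoC_inj in E; lra. }
    split; [|split]; auto. 2: apply (laurent_unit_const 1).
    eapply logder_ext_r; [|exact K]. intros; cbv beta. simpl. ring.
  - destruct IH as [phi [v [K1 [K2 K3]]]].
    destruct (eta_expansion delta a b c d n Hdet Hn H1) as [phi1 [v1 [L1 [L2 L3]]]].
    { eapply Z.divide_trans; [|exact HN]. apply Z.mul_divide_mono_r. exact H2. }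
    exists (fun z => Cpowz (phi1 z) r * phi z), (fun z => IZR r * v1 z + v z).
    split; [|split].
    + apply logder_mult; auto. apply logder_Cpowz; auto.
    + simpl etaq. eapply logder_ext_r; [|apply logder_mult; [apply logder_Cpowz, L2|exact K2]].
      intros z _; cbv beta. simpl etaq_weight. rewrite plus_IZR, RtoC_plus. ring.
    + simpl etaq_ord. apply laurent_unit_mult; auto. apply laurent_unit_Cpowz; auto.
Qed.

(** In weight 0 the logarithmic derivatives coincide, and the undetermined constant factor does not
    change the order. *)
Lemma etaq_LU (l : list (Z * Z)) (a b c d n N : Z) : (a * d - b * c = n)%Z -> (0 < n)%Z ->
  etaq_level l N -> (N * n | 500)%Z -> etaq_weight l = 0%Z ->
  laurent_unit (etaq_ord l a c n) (fun z => etaq l (mob a b c d z)).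
Proof.
  intros Hdet Hn HL HN HW. destruct (etaq_expansion l a b c d n N Hdet Hn HL HN) as [phi [v [K1 [K2 K3]]]].
  assert (logder (fun z => etaq l (mob a b c d z)) v) as K2'.
  { eapply logder_ext_r; [|exact K2]. intros z _. cbv beta. rewrite HW. ring. }
  destruct (logder_same _ _ _ K2' K1) as [k [_ K]].
  apply (laurent_unit_ext _ (fun z => k * phi z)). { intros; rewrite K; auto. }
  apply (laurent_unit_mult 0 _ _ _ (laurent_unit_const k) K3).
Qed.

(** * Averages over shifts *)

Lemma laurent_cder M f tau : laurent M f -> UHP tau -> exists l : C, cder f l tau.
Proof.
  intros [b [F [H K]]] Ht.
  destruct (disc_series_cder b F (qpow (/ 12000) tau) H) as [D [_ HD]].
  { apply Cmod_qpow_lt_1; auto. lra. }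
  eexists. apply (cder_UHP_ext (fun t => qpow (IZR M / 12000) t * F (qpow (/ 12000) t))); auto.
  { intros; symmetry; auto. }
  apply cder_mult. apply cder_qpow. apply (cder_comp F); [exact HD|apply cder_qpow].
Qed.

Lemma has_qexp_ext W f g M a : (forall tau, UHP tau -> f tau = g tau) ->
  has_qexp W f M a -> has_qexp W g M a.
Proof. intros E H tau Ht. rewrite <- E by auto. apply H; auto. Qed.

Lemma has_qexp_csum W f M a : has_qexp W f M a <-> forall tau, UHP tau ->
  csum (fun l => a (M + Z.of_nat l)%Z * qpow (IZR (M + Z.of_nat l) / IZR W) tau) (f tau).
Proof.
  split; intros H tau Ht; apply csum_is_series, H, Ht.
Qed.

Lemma laurent_has_qexp M f : laurent M f -> exists a, has_qexp 12000 f M a.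
Proof.
  intros [b [F [H K]]]. exists (fun n => b (Z.to_nat (n - M))).
  apply has_qexp_csum. intros tau Ht. rewrite K by auto.
  destruct (H (qpow (/ 12000) tau)) as [_ S]. { apply Cmod_qpow_lt_1; auto. lra. }
  eapply csum_ext; [|apply csum_scal, S]. intros l; cbv beta.
  replace (M + Z.of_nat l - M)%Z with (Z.of_nat l) by ring. rewrite Nat2Z.id, qpow_pow.
  replace (IZR (M + Z.of_nat l) / 12000)%R with (IZR M / 12000 + INR l * / 12000)%R.
  rewrite qpow_plus. ring. rewrite plus_IZR, <- INR_IZR_INZ. field.
Qed.

Lemma Cexp_Ci_neq_1 (x : R) : (0 < x < 2 * PI)%R -> Cexp (Ci * x) <> 1.
Proof.
  intros H E. rewrite Cexp_Ci in E. injection E; intros _ E1.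
  replace x with (2 * (x / 2))%R in E1 by field. rewrite cos_2a_sin in E1.
  assert (0 < sin (x / 2))%R by (apply sin_gt_0; lra). nra.
Qed.

Lemma root_of_unity_sum (K : nat) (n : Z) : (0 < K)%nat ->
  psum (fun k => Cexp (2 * PI * Ci * (IZR n * INR k / INR K)%R)) K =
  if (n mod Z.of_nat K =? 0)%Z then RtoC (INR K) else 0.
Proof.
  intros HK. assert (0 < INR K)%R as PK by (apply lt_0_INR; auto).
  set (om := Cexp (2 * PI * Ci * (IZR n / INR K)%R)).
  rewrite (psum_ext _ (fun k => om ^ k)).
  2: { intros k _. unfold om. rewrite Cexp_pow. f_equal.
       replace (IZR n * INR k / INR K)%R with (INR k * (IZR n / INR K))%R by (field; lra).
       rewrite RtoC_mult. ring. }
  pose proof (Z.div_mod n (Z.of_nat K) ltac:(lia)) as E.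
  pose proof (Z.mod_pos_bound n (Z.of_nat K) ltac:(lia)) as B.
  assert (om = Cexp (Ci * (2 * PI * (IZR (n mod Z.of_nat K) / INR K))%R)) as Eom.
  { unfold om. rewrite E at 1. rewrite plus_IZR, mult_IZR, <- INR_IZR_INZ.
    replace ((INR K * IZR (n / Z.of_nat K) + IZR (n mod Z.of_nat K)) / INR K)%R with
      (IZR (n / Z.of_nat K) + IZR (n mod Z.of_nat K) / INR K)%R by (field; lra).
    rewrite RtoC_plus, Cmult_plus_distr_l, Cexp_plus, Cexp_2PI_Z, Cmult_1_l. f_equal.
    rewrite !RtoC_mult. ring. }
  destruct (Z.eqb_spec (n mod Z.of_nat K) 0) as [E0|E0].
  - rewrite E0 in Eom. assert (om = 1) as ->.
    { rewrite Eom. unfold Rdiv. rewrite Rmult_0_l, Rmult_0_r, Cmult_0_r. apply Cexp_0. }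
    clear. induction K. simpl. auto. cbn [psum]. rewrite IHK, Cpow_1_l, S_INR, RtoC_plus. auto.
  - assert (om <> 1) as N.
    { rewrite Eom. apply Cexp_Ci_neq_1. pose proof PI_RGT_0.
      assert (0 < IZR (n mod Z.of_nat K) < INR K)%R as [B1 B2].
      { rewrite INR_IZR_INZ. split; apply IZR_lt; lia. }
      assert (0 < IZR (n mod Z.of_nat K) / INR K)%R by (apply Rdiv_lt_0_compat; auto).
      assert (IZR (n mod Z.of_nat K) / INR K < 1)%R.
      { apply Rmult_lt_reg_r with (INR K); auto. unfold Rdiv. rewrite Rmult_assoc, Rinv_l; lra. }
      split; nra. }
    assert (om ^ K = 1) as E1.
    { unfold om. rewrite Cexp_pow.
      replace (INR K * (2 * PI * Ci * (IZR n / INR K)%R)) with (2 * PI * Ci * IZR n).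
      apply Cexp_2PI_Z. rewrite RtoC_div by lra. field. intros E2; apply RtoC_inj in E2; lra. }
    assert (forall m, (om - 1) * psum (fun k => om ^ k) m = om ^ m - 1) as G.
    { induction m; simpl. ring. rewrite Cmult_plus_distr_l, IHm. ring. }
    specialize (G K). rewrite E1 in G. replace (1 - 1) with (RtoC 0) in G by ring.
    assert (om - 1 <> 0) as N1.
    { intros E2. apply N. replace om with (om - 1 + 1) by ring. rewrite E2. ring. }
    replace (psum (fun k => om ^ k) K) with (/ (om - 1) * ((om - 1) * psum (fun k => om ^ k) K))
      by (field; auto). rewrite G. ring.
Qed.

Definition shift_average (K : nat) (w : R) f tau : C :=
  / INR K * psum (fun k => f (tau + (INR k * w)%R)) K.

Lemma csum_psum (f : nat -> nat -> C) (S : nat -> C) n : (forall k, csum (f k) (S k)) ->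
  csum (fun l => psum (fun k => f k l) n) (psum S n).
Proof.
  intros H. induction n.
  - apply (csum_finite (fun _ => RtoC 0) 0). auto.
  - cbn [psum]. apply csum_plus; auto.
Qed.

(* Averaging over the shifts by multiples of w keeps the exponents in (1/w) Z. *)
Lemma qexp_average (K : nat) (w : Z) f M a : (0 < K)%nat -> (0 < w)%Z ->
  has_qexp (Z.of_nat K * w) f M a ->
  has_qexp w (shift_average K (IZR w) f) (- ((- M) / Z.of_nat K)) (fun m => a (Z.of_nat K * m)%Z).
Proof.
  intros HK Hw H. rewrite has_qexp_csum in H. apply has_qexp_csum. intros tau Ht.
  assert (0 < INR K)%R as PK by (apply lt_0_INR; auto).
  assert (0 < IZR w)%R as Pw by (apply IZR_lt; auto).
  assert (RtoC (INR K) <> 0) as NK by (intros E; apply RtoC_inj in E; lra).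
  set (Kz := Z.of_nat K) in *. assert (IZR Kz = INR K) as EK by (unfold Kz; rewrite INR_IZR_INZ; auto).
  set (m0 := (- ((- M) / Kz))%Z).
  (* s counts the exponents below the first multiple of K; the average annihilates them, so the new
     series may start at that multiple. *)
  assert (exists s : nat, Kz * m0 = M + Z.of_nat s /\ Z.of_nat s < Kz)%Z as [s [Es Ls]].
  { exists (Z.to_nat (- M mod Kz)). unfold m0.
    pose proof (Z.div_mod (- M) Kz ltac:(lia)). pose proof (Z.mod_pos_bound (- M) Kz ltac:(lia)).
    rewrite Z2Nat.id by lia. lia. }
  set (term := fun n : Z => a n * qpow (IZR n / IZR (Kz * w)) tau).
  assert (csum (fun l => if ((M + Z.of_nat l) mod Kz =? 0)%Z then term (M + Z.of_nat l)%Z else 0)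
    (shift_average K (IZR w) f tau)) as S1.
  { unfold shift_average.
    eapply csum_ext; [|apply csum_scal, (csum_psum
      (fun k l => a (M + Z.of_nat l)%Z * qpow (IZR (M + Z.of_nat l) / IZR (Kz * w)) (tau + (INR k * IZR w)%R)))].
    2: { intros k. apply H, UHP_shift, Ht. }
    intros l; cbv beta. set (n := (M + Z.of_nat l)%Z).
    rewrite (psum_ext _ (fun k => term n * Cexp (2 * PI * Ci * (IZR n * INR k / INR K)%R))).
    - rewrite psum_scal, root_of_unity_sum by auto. fold Kz.
      destruct (n mod Kz =? 0)%Z; [field; auto|ring].
    - intros k _. rewrite qpow_shift. unfold term. 
      replace (IZR n / IZR (Kz * w) * (INR k * IZR w))%R with (IZR n * INR k / INR K)%R. ring.
      rewrite mult_IZR, EK. field. lra. }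
  apply (csum_shift _ _ s) in S1.
  assert (psum (fun l => if ((M + Z.of_nat l) mod Kz =? 0)%Z then term (M + Z.of_nat l)%Z else 0) s = 0) as E0.
  { rewrite (psum_ext _ (fun _ => 0)). apply psum_0. intros l Hl.
    destruct (Z.eqb_spec ((M + Z.of_nat l) mod Kz) 0) as [E|E]; auto. exfalso.
    pose proof (Z.div_mod (M + Z.of_nat l) Kz ltac:(lia)). rewrite E in H0.
    set (t := ((M + Z.of_nat l) / Kz)%Z) in *.
    assert (Kz * (m0 - t) = Z.of_nat s - Z.of_nat l)%Z as E1 by lia.
    clearbody m0 t Kz. destruct (Z_le_gt_dec (m0 - t) 0); nia. }
  rewrite E0 in S1. replace (shift_average K (IZR w) f tau - 0) with (shift_average K (IZR w) f tau) in S1 by ring.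
  apply (csum_sparse_inv K); auto. eapply csum_ext; [|exact S1]. intros l; cbv beta.
  replace (M + Z.of_nat (s + l))%Z with (Kz * m0 + Z.of_nat l)%Z by lia.
  rewrite Z.add_comm, Z.mul_comm, Z.mod_add, Z.mul_comm, Z.add_comm by lia.
  unfold Kz at 1. rewrite <- Nat2Z.inj_mod.
  destruct (Nat.eqb_spec (l mod K) 0) as [E|E].
  - rewrite E. cbn [Z.of_nat Z.eqb].
    assert (Kz * m0 + Z.of_nat l = Kz * (m0 + Z.of_nat (l / K)))%Z as ->.
    { pose proof (Nat.div_mod_eq l K). unfold Kz. lia. }
    unfold term. f_equal. f_equal. rewrite !mult_IZR, EK. field. lra.
  - destruct (Z.eqb_spec (Z.of_nat (l mod K)) 0); auto. lia.
Qed.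

Lemma psum_const (c : C) n : psum (fun _ => c) n = INR n * c.
Proof. induction n. simpl; ring. cbn [psum]. rewrite IHn, S_INR, RtoC_plus. ring. Qed.

Lemma shift_average_periodic (K : nat) (w : R) f tau : (0 < K)%nat ->
  (forall tau, UHP tau -> f (tau + w) = f tau) -> UHP tau -> shift_average K w f tau = f tau.
Proof.
  intros HK Hp Ht. unfold shift_average.
  rewrite (psum_ext _ (fun _ => f tau)).
  - rewrite psum_const. field. intros E; apply RtoC_inj in E.
    assert (0 < INR K)%R by (apply lt_0_INR; auto). lra.
  - intros k _. induction k.
    + f_equal. simpl. rewrite Rmult_0_l. ring.
    + rewrite S_INR. replace (tau + ((INR k + 1) * w)%R) with (tau + (INR k * w)%R + w).
      rewrite Hp; auto. apply UHP_shift; auto. rewrite !RtoC_mult, RtoC_plus. ring.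
Qed.

(** A periodic function equals its average over 12000 / w shifts, and the average retains only
    exponents in (1/w) Z. The starting exponent is rounded up, so nonnegativity survives. *)
Lemma laurent_periodic_qexp M f (w : Z) : laurent M f -> (0 < w)%Z -> (w | 12000)%Z ->
  (forall tau, UHP tau -> f (tau + IZR w) = f tau) ->
  exists a (m : Z), has_qexp w f m a /\ ((0 <= M)%Z -> (0 <= m)%Z).
Proof.
  intros HS Hw [K EK] Hp. destruct (laurent_has_qexp M f HS) as [a Ha].
  assert (0 < K)%Z as PK by lia.
  rewrite EK, <- (Z2Nat.id K) in Ha by lia.
  apply qexp_average in Ha; [|lia|auto]. rewrite (Z2Nat.id K) in Ha by lia.
  eexists. eexists. split.
  - eapply has_qexp_ext; [|exact Ha]. intros; apply shift_average_periodic; auto. lia.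
  - intros HM. pose proof (Z.div_mod (- M) K ltac:(lia)).
    pose proof (Z.mod_pos_bound (- M) K ltac:(lia)). nia.
Qed.

(** * The operator U_5 as an average, and leading exponents *)

Definition U5avg f tau : C := / 5 * psum (fun k => f ((tau + INR k) / 5)) 5.

Lemma UHP_div_5 tau : UHP tau -> UHP (tau / 5).
Proof.
  intros H. replace (tau / 5) with (RtoC (/ 5) * tau). apply UHP_scale; auto; lra.
  rewrite RtoC_inv by lra. unfold Cdiv. ring.
Qed.

(** As a function of tau, f(tau / 5) has exponents in (1/5) Z, and its average over the shifts 0,
    ..., 4 keeps the integral ones. *)
Lemma U5avg_qexp f M a : has_qexp 1 f M a ->
  has_qexp 1 (U5avg f) (- ((- M) / 5)) (fun m => a (5 * m)%Z).
Proof.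
  intros H.
  assert (has_qexp (Z.of_nat 5 * 1) (fun tau => f (tau / 5)) M a) as H5.
  { apply has_qexp_csum. rewrite has_qexp_csum in H. intros tau Ht.
    eapply csum_ext; [|apply H, UHP_div_5, Ht]. intros l; cbv beta.
    f_equal. unfold qpow. f_equal. change (Z.of_nat 5 * 1)%Z with 5%Z.
    rewrite !RtoC_div by lra. field. }
  apply qexp_average in H5; [|lia|lia]. eapply has_qexp_ext; [|exact H5].
  intros tau Ht. unfold shift_average, U5avg.
  replace (INR 5) with 5%R by (simpl; lra). f_equal. apply psum_ext.
  intros k _. rewrite Rmult_1_r. auto.
Qed.

(** [is_U5] chooses an expansion of f; this shows that g depends on f alone. *)
Lemma is_U5_avg f g : is_U5 f g -> forall tau, UHP tau -> g tau = U5avg f tau.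
Proof.
  intros [M [a [H1 H2]]] tau Ht. apply U5avg_qexp in H1.
  rewrite has_qexp_csum in H1, H2. eapply csum_unique. apply H2; auto. apply H1; auto.
Qed.

Lemma is_U5_exists M f : laurent M f -> (forall tau, UHP tau -> f (tau + 1) = f tau) ->
  exists g, is_U5 f g.
Proof.
  intros H Hp. destruct (laurent_periodic_qexp M f 1 H ltac:(lia) ltac:(exists 12000%Z; lia) Hp) as [a [m [Ha _]]].
  exists (U5avg f), m, a. split; auto. apply U5avg_qexp, Ha.
Qed.

Lemma has_qexp_drop (w : Z) f M a (s : nat) : has_qexp w f M a ->
  (forall l, (l < s)%nat -> a (M + Z.of_nat l)%Z = 0) -> has_qexp w f (M + Z.of_nat s) a.
Proof.
  intros H Hz. rewrite has_qexp_csum in H. apply has_qexp_csum. intros tau Ht.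
  pose proof (csum_shift _ _ s (H tau Ht)) as K.
  rewrite (psum_ext _ (fun _ => 0)), psum_0 in K.
  - replace (f tau - 0) with (f tau) in K by ring.
    eapply csum_ext; [|exact K]. intros l; cbv beta.
    replace (M + Z.of_nat (s + l))%Z with (M + Z.of_nat s + Z.of_nat l)%Z by lia. auto.
  - intros l Hl. rewrite Hz by auto. ring.
Qed.

(** Excluded middle decides whether some coefficient is nonzero; if so, the least such index gives
    the order. *)
Lemma qexp_order (w : Z) f M a : has_qexp w f M a ->
  (forall tau, UHP tau -> f tau = 0) \/ exists n, (M <= n)%Z /\ has_qexp w f n a /\ a n <> 0.
Proof.
  intros H. destruct (Classical_Prop.classic (exists l, a (M + Z.of_nat l)%Z <> 0)) as [E|E].
  - right.
    destruct (Wf_nat.dec_inh_nat_subset_has_unique_least_element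
      (fun l => a (M + Z.of_nat l)%Z <> 0)) as [l [[H1 H2] _]]; auto.
    { intros n. destruct (Ceq_dec (a (M + Z.of_nat n)%Z) 0); auto. }
    exists (M + Z.of_nat l)%Z. split; [lia|split; auto]. apply has_qexp_drop; auto.
    intros k Hk. destruct (Ceq_dec (a (M + Z.of_nat k)%Z) 0) as [|N]; auto.
    apply H2 in N. lia.
  - left. intros tau Ht. rewrite has_qexp_csum in H.
    eapply csum_unique. apply H; auto.
    apply (csum_ext (fun _ => 0)).
    + intros k. destruct (Ceq_dec (a (M + Z.of_nat k)%Z) 0) as [->|N]. ring.
      exfalso. eauto.
    + apply (csum_finite (fun _ => RtoC 0) 0). auto.
Qed.

(** * The functions T, H, G and A *)

Definition lT : list (Z * Z) := [(1, 2); (4, 2); (10, 8); (5, -2); (20, -10)]%Z.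
Definition lH : list (Z * Z) := [(4, 1); (5, 5); (1, -1); (20, -5)]%Z.
Definition lG : list (Z * Z) := [(4, 4); (10, 2); (2, -2); (20, -4)]%Z.
Definition lA : list (Z * Z) := [(1, -3); (2, 5); (4, -2); (25, 3); (50, -5); (100, 2)]%Z.

Lemma Cinv_mult z w : / (z * w) = / z * / w.
Proof.
  destruct (Ceq_dec z 0) as [->|N1]. { rewrite Cmult_0_l, !Cinv_0. ring. }
  destruct (Ceq_dec w 0) as [->|N2]. { rewrite Cmult_0_r, !Cinv_0. ring. }
  field. auto.
Qed.

Ltac eval_exponents := repeat match goal with |- context [Pos.to_nat ?p] =>
  let n := eval compute in (Pos.to_nat p) in change (Pos.to_nat p) with n end.

Lemma fT_etaq tau : fT tau = etaq lT tau.
Proof.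
  unfold fT, lT, etaq, Cpowz, Cdiv. rewrite Cinv_mult, Cmult_1_l. eval_exponents. ring.
Qed.

Lemma fH_etaq tau : fH tau = etaq lH tau.
Proof.
  unfold fH, lH, etaq, Cpowz, Cdiv. rewrite Cinv_mult, Cmult_1_l. eval_exponents.
  replace (eta tau ^ 1) with (eta tau) by ring. ring.
Qed.

Lemma fG_etaq tau : fG tau = etaq lG tau.
Proof.
  unfold fG, lG, etaq, Cpowz, Cdiv. rewrite Cinv_mult. eval_exponents. ring.
Qed.

Lemma Cprod_n_ext (u v : nat -> C) n : (forall k, u k = v k) -> Cprod_n u n = Cprod_n v n.
Proof. intros H. induction n; simpl; auto. rewrite IHn, H; auto. Qed.

Lemma qpoch_pow z (m : nat) : (0 < m)%nat -> (Cmod z < 1)%R -> qpoch z m m = qpoch (z ^ m) 1 1.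
Proof.
  intros Hm H. destruct m as [|m]; [lia|].
  destruct (qpoch_cvg _ (Cmod_pow_S_lt_1 z m H)) as [K _].
  unfold qpoch at 1. apply Clim_seq_cvg. eapply cvg_ext; [|exact K].
  intros n. apply Cprod_n_ext. intros k. rewrite <- Cpow_mult_r. do 2 f_equal. lia.
Qed.

Lemma q_pow (m : nat) tau : q tau ^ m = q (INR m * tau).
Proof.
  unfold q. rewrite qpow_pow. unfold qpow. f_equal. rewrite Rmult_1_r. ring.
Qed.

(** The powers of q hidden in the etas of [cq] amount to (5 * 2 - 3 - 2 * 4) / 24 = - 1 / 24. *)
Lemma Cq_cq tau : UHP tau -> Cq (q tau) = qpow (/ 24) tau * cq tau.
Proof.
  intros H. pose proof (Cmod_q_lt_1 tau H) as Hq. unfold Cq, cq.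
  rewrite (qpoch_pow _ 2), (qpoch_pow _ 4) by (auto; lia). rewrite !q_pow.
  replace (INR 2) with 2%R by (simpl; lra). replace (INR 4) with 4%R by (simpl; lra).
  unfold eta.
  assert (qpoch (q tau) 1 1 <> 0) by (apply qpoch_inv; auto).
  assert (qpoch (q (4 * tau)) 1 1 <> 0) by (apply qpoch_inv, Cmod_q_lt_1, UHP_scale; auto; lra).
  assert (qpow (/ 24) (2 * tau) = qpow (/ 24) tau ^ 2) as ->.
  { rewrite qpow_pow. unfold qpow. f_equal. rewrite RtoC_mult. simpl (INR 2). rewrite RtoC_plus. ring. }
  assert (qpow (/ 24) (4 * tau) = qpow (/ 24) tau ^ 4) as ->.
  { rewrite qpow_pow. unfold qpow. f_equal. rewrite RtoC_mult. simpl (INR 4). rewrite !RtoC_plus. ring. }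
  pose proof (qpow_neq_0 (/ 24) tau). field. auto.
Qed.

Lemma cq_neq_0 tau : UHP tau -> cq tau <> 0.
Proof.
  intros H. unfold cq. apply Cmult_neq_0. apply Cpow_nz, eta_scale_neq_0; auto; lra.
  apply Cinv_neq_0, Cmult_neq_0; apply Cpow_nz. apply eta_neq_0; auto.
  apply eta_scale_neq_0; auto; lra.
Qed.

(** The factor q in A compensates exactly for q^(1/24) / q^(25/24). *)
Lemma fA_cq tau : UHP tau -> fA tau = cq tau / cq (25 * tau).
Proof.
  intros H. assert (UHP (25 * tau)) as H25 by (apply UHP_scale; auto; lra).
  unfold fA. rewrite q_pow. replace (INR 25) with 25%R by (simpl; lra).
  rewrite !Cq_cq by auto.
  assert (qpow (/ 24) (25 * tau) = q tau * qpow (/ 24) tau) as ->.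
  { unfold q. rewrite <- qpow_plus. unfold qpow. f_equal. rewrite RtoC_plus, RtoC_inv by lra. field. }
  pose proof (cq_neq_0 _ H25). pose proof (qpow_neq_0 (/ 24) tau). pose proof (qpow_neq_0 1 tau).
  unfold q in *. field. auto.
Qed.

Lemma fA_etaq tau : UHP tau -> fA tau = etaq lA tau.
Proof.
  intros H. rewrite fA_cq by auto. unfold cq, lA, etaq, Cpowz, Cdiv. rewrite !Cmult_1_l.
  eval_exponents.
  replace (2 * (25 * tau)) with (50 * tau) by ring. replace (4 * (25 * tau)) with (100 * tau) by ring.
  rewrite !Cinv_mult, !Cinv_involutive. ring.
Qed.

(** * Invariance *)

Lemma mob_scale (delta a b c1 d : Z) tau : 
  IZR delta * mob a b (delta * c1) d tau = mob a (delta * b) c1 d (IZR delta * tau).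
Proof.
  unfold mob. rewrite !mult_IZR, !RtoC_mult. unfold Cdiv.
  replace (IZR delta * IZR c1 * tau + IZR d) with (IZR c1 * (IZR delta * tau) + IZR d) by ring. ring.
Qed.

Lemma eta_sqr_scale (delta a b c1 d : Z) tau : (0 < delta)%Z -> (a * d - b * (delta * c1) = 1)%Z ->
  UHP tau -> eta (IZR delta * mob a b (delta * c1) d tau) ^ 2 =
  zeta24 (2 * e12 a (delta * b) c1 d) * (IZR (delta * c1) * tau + IZR d) * eta (IZR delta * tau) ^ 2.
Proof.
  intros H D Ht. rewrite mob_scale, eta_sqr_SL2Z.
  - rewrite mult_IZR, RtoC_mult. f_equal. f_equal. ring.
  - lia.
  - apply UHP_scale; auto. apply IZR_lt; auto.
Qed.

Lemma eta_sqr_unscaled (a b c d : Z) tau : (a * d - b * c = 1)%Z -> UHP tau ->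
  eta (mob a b c d tau) ^ 2 = zeta24 (2 * e12 a (1 * b) c d) * (IZR c * tau + IZR d) * eta tau ^ 2.
Proof. intros. rewrite Z.mul_1_l. apply eta_sqr_SL2Z; auto. Qed.

Definition invariant (N : Z) f : Prop := forall a b k d, (a * d - b * (N * k) = 1)%Z ->
  forall tau, UHP tau -> f (mob a b (N * k) d tau) = f tau.

Lemma fT_invariant : invariant 20 fT.
Proof.
  intros a b k d D tau H. pose proof (mob_den_neq_0 a b (20 * k) d tau ltac:(lia) H) as N.
  assert (forall x y : C, x ^ 8 = (x ^ 2) ^ 4 /\ y ^ 10 = (y ^ 2) ^ 5) as P by (intros; split; ring).
  unfold fT. rewrite !(proj1 (P (eta (10 * _)) 1)), !(proj2 (P 1 (eta (20 * _)))).
  rewrite (eta_sqr_unscaled a b (20 * k) d) by auto.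
  pose proof (eta_sqr_scale 4 a b (5 * k) d tau ltac:(lia) ltac:(lia) H) as E4.
  pose proof (eta_sqr_scale 5 a b (4 * k) d tau ltac:(lia) ltac:(lia) H) as E5.
  pose proof (eta_sqr_scale 10 a b (2 * k) d tau ltac:(lia) ltac:(lia) H) as E10.
  pose proof (eta_sqr_scale 20 a b k d tau ltac:(lia) ltac:(lia) H) as E20.
  replace (4 * (5 * k))%Z with (20 * k)%Z in E4 by ring.
  replace (5 * (4 * k))%Z with (20 * k)%Z in E5 by ring.
  replace (10 * (2 * k))%Z with (20 * k)%Z in E10 by ring.
  rewrite E4, E5, E10, E20.
  set (e1 := e12 a (1 * b) (20 * k) d). set (e4 := e12 a (4 * b) (5 * k) d).
  set (e5 := e12 a (5 * b) (4 * k) d). set (e10 := e12 a (10 * b) (2 * k) d).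
  set (e20 := e12 a (20 * b) k d).
  assert (zeta24 (2 * e1) * zeta24 (2 * e4) * zeta24 (2 * e10) ^ 4 =
    zeta24 (2 * e5) * zeta24 (2 * e20) ^ 5) as Ez.
  { rewrite !zeta24_pow, <- !zeta24_add. apply zeta24_cong.
    assert (congr 12 (e1 + e4 + 4 * e10 - e5 - 5 * e20) 0) as [t Et].
    { unfold e1, e4, e10, e5, e20. congr_enum 12%nat (fun a b k d : Z => a * d - b * (20 * k) - 1)%Z
       (fun a b k d : Z => e12 a (1 * b) (20 * k) d + e12 a (4 * b) (5 * k) d + 4 * e12 a (10 * b) (2 * k) d
         - e12 a (5 * b) (4 * k) d - 5 * e12 a (20 * b) k d)%Z a b k d. lia. }
    exists t. lia. }
  pose proof (zeta24_neq_0 (2 * e5)). pose proof (zeta24_neq_0 (2 * e20)).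
  assert (eta (5 * tau) <> 0) by (apply eta_scale_neq_0; auto; lra).
  assert (eta (20 * tau) <> 0) by (apply eta_scale_neq_0; auto; lra).
  set (u := IZR (20 * k) * tau + IZR d) in *.
  transitivity ((zeta24 (2 * e1) * zeta24 (2 * e4) * zeta24 (2 * e10) ^ 4) /
    (zeta24 (2 * e5) * zeta24 (2 * e20) ^ 5) *
    (eta tau ^ 2 * eta (4 * tau) ^ 2 * (eta (10 * tau) ^ 2) ^ 4 / (eta (5 * tau) ^ 2 * (eta (20 * tau) ^ 2) ^ 5))).
  - field. auto.
  - rewrite Ez. field. auto.
Qed.

Lemma fG_invariant : invariant 20 fG.
Proof.
  intros a b k d D tau H. pose proof (mob_den_neq_0 a b (20 * k) d tau ltac:(lia) H) as N.
  assert (forall x : C, x ^ 4 = (x ^ 2) ^ 2) as P by (intros; ring).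
  unfold fG. rewrite !(P (eta _)).
  pose proof (eta_sqr_scale 4 a b (5 * k) d tau ltac:(lia) ltac:(lia) H) as E4.
  pose proof (eta_sqr_scale 2 a b (10 * k) d tau ltac:(lia) ltac:(lia) H) as E2.
  pose proof (eta_sqr_scale 10 a b (2 * k) d tau ltac:(lia) ltac:(lia) H) as E10.
  pose proof (eta_sqr_scale 20 a b k d tau ltac:(lia) ltac:(lia) H) as E20.
  replace (4 * (5 * k))%Z with (20 * k)%Z in E4 by ring.
  replace (2 * (10 * k))%Z with (20 * k)%Z in E2 by ring.
  replace (10 * (2 * k))%Z with (20 * k)%Z in E10 by ring.
  rewrite E4, E2, E10, E20.
  set (e4 := e12 a (4 * b) (5 * k) d).
  set (e2 := e12 a (2 * b) (10 * k) d). set (e10 := e12 a (10 * b) (2 * k) d).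
  set (e20 := e12 a (20 * b) k d).
  assert (zeta24 (2 * e4) ^ 2 * zeta24 (2 * e10) = zeta24 (2 * e2) * zeta24 (2 * e20) ^ 2) as Ez.
  { rewrite !zeta24_pow, <- !zeta24_add. apply zeta24_cong.
    assert (congr 12 (2 * e4 + e10 - e2 - 2 * e20) 0) as [t Et].
    { unfold e4, e10, e2, e20. congr_enum 12%nat (fun a b k d : Z => a * d - b * (20 * k) - 1)%Z
       (fun a b k d : Z => 2 * e12 a (4 * b) (5 * k) d + e12 a (10 * b) (2 * k) d
         - e12 a (2 * b) (10 * k) d - 2 * e12 a (20 * b) k d)%Z a b k d. lia. }
    exists t. lia. }
  pose proof (zeta24_neq_0 (2 * e2)). pose proof (zeta24_neq_0 (2 * e20)).
  assert (eta (2 * tau) <> 0) by (apply eta_scale_neq_0; auto; lra).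
  assert (eta (20 * tau) <> 0) by (apply eta_scale_neq_0; auto; lra).
  set (u := IZR (20 * k) * tau + IZR d) in *.
  transitivity ((zeta24 (2 * e4) ^ 2 * zeta24 (2 * e10)) / (zeta24 (2 * e2) * zeta24 (2 * e20) ^ 2) *
    ((eta (4 * tau) ^ 2) ^ 2 * eta (10 * tau) ^ 2 / (eta (2 * tau) ^ 2 * (eta (20 * tau) ^ 2) ^ 2))).
  - field. auto.
  - rewrite Ez. field. auto.
Qed.

Lemma fH_hq tau : UHP tau -> fH tau = hq tau / hq (5 * tau) ^ 5.
Proof.
  intros H. unfold fH, hq. replace (4 * (5 * tau)) with (20 * tau) by ring.
  pose proof (eta_neq_0 tau H).
  assert (eta (5 * tau) <> 0) by (apply eta_scale_neq_0; auto; lra).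
  assert (eta (20 * tau) <> 0) by (apply eta_scale_neq_0; auto; lra).
  field. auto.
Qed.

Lemma fH_invariant : invariant 20 fH.
Proof.
  intros a b k d D tau H. assert (UHP (5 * tau)) as H5 by (apply UHP_scale; auto; lra).
  rewrite !fH_hq by (auto; apply UHP_mob; auto; lia).
  replace (20 * k)%Z with (5 * (4 * k))%Z by ring. rewrite (mob_scale 5).
  rewrite (hq_Gamma0_4 a (5 * b) k d) by (auto; lia).
  replace (5 * (4 * k))%Z with (4 * (5 * k))%Z by ring.
  rewrite (hq_Gamma0_4 a b (5 * k) d) by (auto; lia).
  (* The terms in k d agree because of the fifth power, and those in b d differ by 72 b d, a
     multiple of 24. *)
  assert (zeta24 (eh a b (5 * k) d) = zeta24 (eh a (5 * b) k d) ^ 5) as ->.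
  { rewrite zeta24_pow. apply zeta24_cong. exists (- 3 * b * d)%Z. unfold eh. simpl Z.of_nat. ring. }
  pose proof (zeta24_neq_0 (eh a (5 * b) k d)). pose proof (hq_neq_0 _ H5).
  field. auto.
Qed.

Lemma fA_invariant : invariant 100 fA.
Proof.
  intros a b k d D tau H. assert (UHP (25 * tau)) as H5 by (apply UHP_scale; auto; lra).
  rewrite !fA_cq by (auto; apply UHP_mob; auto; lia).
  replace (100 * k)%Z with (25 * (4 * k))%Z by ring. rewrite (mob_scale 25).
  rewrite (cq_Gamma0_4 a (25 * b) k d) by (auto; lia).
  replace (25 * (4 * k))%Z with (4 * (25 * k))%Z by ring.
  rewrite (cq_Gamma0_4 a b (25 * k) d) by (auto; lia).
  (* The factor 25, attached to k or to b, is 1 modulo 24. *)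
  rewrite (zeta24_cong (ec a b (25 * k) d) (ec a (25 * b) k d)).
  2: { exists (9 * (4 * k * d + b * d) - 16 * (- (b * d) - 25 * b * d * k * k + k * (a + d)))%Z.
       unfold ec. ring. }
  pose proof (zeta24_neq_0 (ec a (25 * b) k d)). pose proof (cq_neq_0 _ H5).
  field. auto.
Qed.

Lemma invariant_shift N f tau (n : Z) : invariant N f -> UHP tau -> f (tau + IZR n) = f tau.
Proof.
  intros H Ht. rewrite <- (H 1 n 0 1)%Z with (tau := tau); auto; [|lia].
  rewrite Z.mul_0_r. f_equal. unfold mob. field.
Qed.

(** An affine map permutes the residues modulo 5. Only v = 1 and v = -1 are needed, since v will be
    a square prime to 5. *)
Lemma psum_residues_5 (phi : Z -> C) (u v : Z) : (forall x n, phi (x + 5 * n) = phi x)%Z ->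
  (v mod 5 = 1 \/ v mod 5 = 4)%Z ->
  psum (fun r => phi (u + v * Z.of_nat r)%Z) 5 = psum (fun r => phi (Z.of_nat r)) 5.
Proof.
  intros Hp Hv.
  assert (forall x y, (x - y) mod 5 = 0 -> phi x = phi y)%Z as Hc.
  { intros x y E. pose proof (Z.div_mod (x - y) 5 ltac:(lia)).
    replace x with (y + 5 * ((x - y) / 5))%Z by lia. apply Hp. }
  pose proof (Z.div_mod u 5 ltac:(lia)). pose proof (Z.mod_pos_bound u 5 ltac:(lia)).
  pose proof (Z.div_mod v 5 ltac:(lia)).
  assert (forall r s t : Z, (s = u mod 5 -> (s + (v mod 5) * r - t) mod 5 = 0 -> phi (u + v * r) = phi t))%Z as Hr.
  { intros r s t -> E. apply Hc.
    replace (u + v * r - t)%Z with ((u mod 5 + v mod 5 * r - t) + (u / 5 + v / 5 * r) * 5)%Z by lia.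
    rewrite Z.mod_add by lia. exact E. }
  cbn [psum Z.of_nat].
  assert (exists s, s = u mod 5 /\ (s = 0 \/ s = 1 \/ s = 2 \/ s = 3 \/ s = 4))%Z as [s [Es Cs]].
  { exists (u mod 5)%Z. split; auto. lia. }
  assert (forall x y t, (s = x -> v mod 5 = y -> forall r, (x + y * r - t) mod 5 = 0 -> phi (u + v * r) = phi t))%Z as Hq.
  { intros x y t Ex Ey r E. apply (Hr r s); auto. rewrite Ex, Ey. auto. }
  cbn. 
  destruct Hv as [Ev|Ev]; destruct Cs as [C|[C|[C|[C|C]]]];
  specialize (fun t => Hq _ _ t C Ev);
  repeat match goal with |- context [phi (u + v * ?r)%Z] =>
    first [ rewrite (Hq 0%Z r) by reflexivity | rewrite (Hq 1%Z r) by reflexivity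
          | rewrite (Hq 2%Z r) by reflexivity | rewrite (Hq 3%Z r) by reflexivity
          | rewrite (Hq 4%Z r) by reflexivity ] end; ring.
Qed.

Lemma U5avg_invariant f : invariant 100 f -> invariant 20 (U5avg f).
Proof.
  intros Hf a b k d D tau H.
  set (phi := fun r : Z => f ((tau + IZR r) / 5)).
  assert (forall r : Z, UHP ((tau + IZR r) / 5)) as HU by (intros; apply UHP_div_5, UHP_shift, H).
  assert (forall x n, phi (x + 5 * n) = phi x)%Z as Hp.
  { intros x n. unfold phi. rewrite <- (invariant_shift 100 f _ n Hf (HU x)). f_equal.
    rewrite plus_IZR, mult_IZR, RtoC_plus, RtoC_mult. field. }
  assert (forall r : Z, f ((mob a b (20 * k) d tau + IZR r) / 5) = phi (d * b + (d * d) * r)%Z) as Hr.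
  { intros r. set (s := (b + r * d)%Z).
    replace (d * b + d * d * r)%Z with (d * s)%Z by (unfold s; ring).
    unfold phi. set (c := (20 * k)%Z) in *.
    (* Solves (1 r; 0 5) g = g' (1 t; 0 5) with lower left entry 5c = 100 k in g'. As (a + r c) d =
       1 + c s, the choice t = d s leaves - c s^2 / 5 as upper right entry, an integer because 20 |
       c. This is how level 100 drops to level 20. *)
    rewrite <- (Hf (a + r * c) (- 4 * k * (s * s)) k (d - d * s * c))%Z with (tau := (tau + IZR (d * s)) / 5).
    2: { transitivity ((a * d - b * c) - (a * d - b * c - 1) * c * s)%Z; [unfold s, c; ring|].
         rewrite D. ring. }
    2: { apply HU. }
    f_equal. replace (100 * k)%Z with (5 * c)%Z by (unfold c; ring).
    assert ((mob a b c d tau + IZR r) / 5 = mob 1 r 0 5 (mob a b c d tau)) as ->.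
    { set (w := mob a b c d tau). unfold mob. unfold Cdiv.
      replace (0 * w + 5) with (RtoC 5) by ring. rewrite Cmult_1_l. reflexivity. }
    assert ((tau + IZR (d * s)) / 5 = mob 1 (d * s) 0 5 tau) as ->.
    { unfold mob. unfold Cdiv.
      replace (0 * tau + 5) with (RtoC 5) by ring. rewrite Cmult_1_l. reflexivity. }
    assert ((a + r * c) * (d - d * s * c) - - 4 * k * (s * s) * (5 * c) = 1)%Z as D2.
    { transitivity ((a * d - b * c) - (a * d - b * c - 1) * c * s)%Z; [unfold s, c; ring|].
      rewrite D. ring. }
    rewrite !mob_mob by (auto; lia). f_equal; try (unfold s, c; ring).
    transitivity (s * (a * d - b * c))%Z.
    - rewrite D. unfold s. ring.
    - unfold s, c. ring. }
  unfold U5avg. f_equal.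
  rewrite (psum_ext _ (fun r => phi (d * b + d * d * Z.of_nat r)%Z)).
  2: { intros r _. rewrite <- Hr, INR_IZR_INZ. auto. }
  (* The determinant condition makes d prime to 5, so d^2 is 1 or 4 modulo 5. *)
  rewrite (psum_residues_5 phi) by (auto; clear - D;
    assert (forall m, (m mod 5 = 0 \/ m mod 5 = 1 \/ m mod 5 = 2 \/ m mod 5 = 3 \/ m mod 5 = 4)%Z) as M
      by (intros m; pose proof (Z.mod_pos_bound m 5); lia);
    rewrite Z.mul_mod by lia; destruct (M d) as [E|[E|[E|[E|E]]]]; rewrite E; auto;
    exfalso; pose proof (Z.div_mod d 5 ltac:(lia)); lia).
  apply psum_ext. intros r _. unfold phi. rewrite INR_IZR_INZ. auto.
Qed.

(** * Orders at the cusps *)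

Lemma gcd_mul_coprime (delta a c : Z) : Z.gcd a c = 1%Z -> Z.gcd (delta * a) c = Z.gcd delta c.
Proof.
  intros H. apply Z.divide_antisym_nonneg; try apply Z.gcd_nonneg.
  - apply Z.gcd_greatest; [|apply Z.gcd_divide_r].
    apply (Z.gauss _ a). { rewrite Z.mul_comm. apply Z.gcd_divide_l. }
    assert (Z.gcd (Z.gcd (delta * a) c) a | 1)%Z as K.
    { rewrite <- H. apply Z.gcd_greatest. apply Z.gcd_divide_r.
      eapply Z.divide_trans; [apply Z.gcd_divide_l|apply Z.gcd_divide_r]. }
    apply Z.divide_1_r_nonneg in K; auto. apply Z.gcd_nonneg.
  - apply Z.gcd_greatest; [|apply Z.gcd_divide_r]. apply Z.divide_mul_l, Z.gcd_divide_l.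
Qed.

Lemma gcd_cong_100 (delta x y : Z) : (delta | 100)%Z -> (100 | x - y)%Z -> Z.gcd delta x = Z.gcd delta y.
Proof.
  assert (forall x y, (delta | 100) -> (100 | x - y) -> (Z.gcd delta x | Z.gcd delta y))%Z as K.
  { intros u v H1 H2. apply Z.gcd_greatest. apply Z.gcd_divide_l.
    replace v with (u - (u - v))%Z by ring. apply Z.divide_sub_r. apply Z.gcd_divide_r.
    eapply Z.divide_trans; [apply Z.gcd_divide_l|]. eapply Z.divide_trans; eauto. }
  intros H1 H2. apply Z.divide_antisym_nonneg; try apply Z.gcd_nonneg; apply K; auto.
  replace (y - x)%Z with (- (x - y))%Z by ring. apply Z.divide_opp_r. auto.
Qed.

Lemma coprime_bezout (x y u v : Z) : (x * u - y * v = 1)%Z -> Z.gcd x y = 1%Z.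
Proof. intros H. apply Z.bezout_1_gcd. exists u, (- v)%Z. lia. Qed.

(* [etaq_ord], with the dependence on the matrix reduced to the gcds. *)
Fixpoint gcd_ord (l : list (Z * Z)) (h : Z -> Z) (n : Z) : Z :=
  match l with
  | nil => 0
  | (delta, r) :: l' => r * (h delta * (500 / (delta * n / h delta))) + gcd_ord l' h n
  end%Z.

Lemma etaq_ord_gcd l a c n h : etaq_level l 100 ->
  (forall delta, (delta | 100)%Z -> Z.gcd (delta * a) c = h delta) ->
  etaq_ord l a c n = gcd_ord l h n.
Proof.
  intros HL Hh. induction HL as [|[delta r] l [H1 H2] _ IH]; simpl; auto.
  unfold etaord. rewrite Hh, IH by auto. auto.
Qed.

Definition Gk_ord (k : nat) (X : list (Z * Z) -> Z) : Z :=
  match k with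
  | 1%nat => X lG
  | 2%nat => Z.min (X lH) (X lG)
  | 3%nat => 2 * X lG
  | 4%nat => 2 * Z.min (X lH) (X lG)
  | _ => 0
  end%Z.

(** t is the order of T at the cusp, X the orders after (1 r; 0 5). The factors 2, 5 and m_k of t
    are the parts of [mexp]; the two entries with X lT treat j = 1 and j = -1, from which all j
    follow by scaling. *)
Definition orders_ok (t : Z) (X : list (Z * Z) -> Z) : bool :=
  forallb (Z.leb 0) [t; 2 * t + X lA; 5 * t + X lT; 5 * t - X lT; 2 * t + Gk_ord 1 X;
    3 * t + Gk_ord 2 X; 4 * t + Gk_ord 3 X; 6 * t + Gk_ord 4 X]%Z.

Lemma orders_ok_spec t X (i : nat) (j : Z) (k : nat) : orders_ok t X = true ->
  (i <= 1)%nat -> (k <= 4)%nat ->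
  (0 <= mexp i j k * t /\
   0 <= mexp i j k * t + (Z.of_nat i * X lA + j * X lT + Gk_ord k X))%Z.
Proof.
  intros H Hi Hk. unfold orders_ok in H. cbn [forallb] in H.
  rewrite !Bool.andb_true_iff, !Z.leb_le in H.
  destruct H as [H1 [H2 [H3 [H4 [H5 [H6 [H7 [H8 _]]]]]]]].
  assert (0 <= mk k * t + Gk_ord k X /\ 0 <= mk k)%Z as [HG HM].
  { do 5 (destruct k as [|k]; [simpl in *; lia|]). lia. }
  assert (0 <= 5 * Z.abs j * t + j * X lT)%Z as HT.
  { destruct (Z_le_gt_dec 0 j).
    - rewrite Z.abs_eq by lia. replace (5 * j * t + j * X lT)%Z with (j * (5 * t + X lT))%Z by ring.
      apply Z.mul_nonneg_nonneg; lia.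
    - rewrite Z.abs_neq by lia. replace (5 * - j * t + j * X lT)%Z with (- j * (5 * t - X lT))%Z by ring.
      apply Z.mul_nonneg_nonneg; lia. }
  assert (0 <= 2 * Z.of_nat i * t + Z.of_nat i * X lA)%Z as HA.
  { replace (2 * Z.of_nat i * t + Z.of_nat i * X lA)%Z with (Z.of_nat i * (2 * t + X lA))%Z by ring.
    apply Z.mul_nonneg_nonneg; lia. }
  unfold mexp. split.
  - apply Z.mul_nonneg_nonneg; lia.
  - replace ((2 * Z.of_nat i + 5 * Z.abs j + mk k) * t + (Z.of_nat i * X lA + j * X lT + Gk_ord k X))%Z
     with ((2 * Z.of_nat i * t + Z.of_nat i * X lA) + (5 * Z.abs j * t + j * X lT) +
       (mk k * t + Gk_ord k X))%Z by ring. lia.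
Qed.

(* The orders depend only on c modulo 100.  The two alternatives are those of
   (1 r; 0 5) g, according to whether 5 divides a + r c. *)
Definition order_check (c : Z) : bool :=
  if (c mod 20 =? 0)%Z then true else
  let t := gcd_ord lT (fun delta => Z.gcd delta c) 1 in
  andb (orders_ok t (fun l => gcd_ord l (fun delta => Z.gcd delta (5 * c)) 5))
  (if (c mod 5 =? 0)%Z then true else
   orders_ok t (fun l => gcd_ord l (fun delta => 5 * Z.gcd delta c)%Z 5)).

Lemma order_check_all : all_below 100 order_check = true.
Proof. vm_compute. reflexivity. Qed.

Lemma levels : etaq_level lT 100 /\ etaq_level lH 100 /\ etaq_level lG 100 /\ etaq_level lA 100.
Proof.
  repeat split; repeat constructor; simpl; try lia;
  match goal with |- (?x | 100)%Z => exists (100 / x)%Z; reflexivity end.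
Qed.

Lemma Gk_ord_ext k X Y : (forall l, In l [lH; lG] -> X l = Y l) -> Gk_ord k X = Gk_ord k Y.
Proof.
  intros H. do 5 (destruct k as [|k]; [simpl; rewrite ?H by (simpl; auto); reflexivity|]). reflexivity.
Qed.

Lemma total_order_nonneg (i : nat) (j : Z) (k : nat) (a b c d r : Z) :
  (i <= 1)%nat -> (k <= 4)%nat -> (a * d - b * c = 1)%Z -> ~ (20 | c)%Z ->
  let X := fun l => etaq_ord l (a + r * c) (5 * c) 5 in
  (0 <= mexp i j k * etaq_ord lT a c 1 /\
   0 <= mexp i j k * etaq_ord lT a c 1 + (Z.of_nat i * X lA + j * X lT + Gk_ord k X))%Z.
Proof.
  intros Hi Hk D Hc X. destruct levels as [LT [LH [LG LA]]].
  set (c0 := (c mod 100)%Z). pose proof (Z.mod_pos_bound c 100 ltac:(lia)) as B. fold c0 in B.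
  pose proof (Z.div_mod c 100 ltac:(lia)) as E. fold c0 in E.
  pose proof (all_below_spec 100 _ c0 order_check_all B) as K. unfold order_check in K.
  assert (c0 mod 20 <> 0)%Z as N20.
  { intros E0. apply Hc. pose proof (Z.div_mod c0 20 ltac:(lia)).
    exists (5 * (c / 100) + c0 / 20)%Z. lia. }
  destruct (Z.eqb_spec (c0 mod 20) 0); [contradiction|].
  apply Bool.andb_true_iff in K. destruct K as [K1 K2].
  assert (etaq_ord lT a c 1 = gcd_ord lT (fun delta => Z.gcd delta c0) 1) as ET.
  { apply etaq_ord_gcd; auto. intros delta Hd.
    rewrite gcd_mul_coprime by (apply (coprime_bezout a c d b); lia).
    apply gcd_cong_100; auto. exists (c / 100)%Z. lia. }
  rewrite ET. set (t := gcd_ord lT (fun delta => Z.gcd delta c0) 1) in *.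
  assert (Z.gcd (a + r * c) c = 1)%Z as G1 by (apply (coprime_bezout _ _ d (b + r * d)); lia).
  assert (forall h, (forall delta, (delta | 100) -> Z.gcd (delta * (a + r * c)) (5 * c) = h delta)%Z ->
    orders_ok t (fun l => gcd_ord l h 5) = true ->
    (0 <= mexp i j k * t /\
     0 <= mexp i j k * t + (Z.of_nat i * X lA + j * X lT + Gk_ord k X))%Z) as Fin.
  { intros h Hh Ho. unfold X. rewrite (etaq_ord_gcd lA _ _ _ h), (etaq_ord_gcd lT _ _ _ h) by auto.
    rewrite (Gk_ord_ext k _ (fun l => gcd_ord l h 5)).
    - apply (orders_ok_spec t (fun l => gcd_ord l h 5)); auto.
    - intros l [<-|[<-|[]]]; apply etaq_ord_gcd; auto. }
  (* If 5 divides a + r c, the first column (a + r c, 5c) has content 5 and 5 does not divide c;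
     otherwise the column is primitive. *)
  destruct (Z.eq_dec ((a + r * c) mod 5) 0) as [E5|E5].
  - pose proof (Z.div_mod (a + r * c) 5 ltac:(lia)) as E6. rewrite E5 in E6.
    set (a2 := ((a + r * c) / 5)%Z) in *.
    assert (Z.gcd a2 c = 1)%Z as G2.
    { apply (coprime_bezout _ _ (5 * d) (b + r * d)). lia. }
    assert (c0 mod 5 <> 0)%Z as N5.
    { intros E7. pose proof (Z.div_mod c0 5 ltac:(lia)).
      assert (5 | 1)%Z as K3.
      { rewrite <- G1. apply Z.gcd_greatest. exists a2. lia. exists (20 * (c / 100) + c0 / 5)%Z. lia. }
      destruct K3 as [m Hm]. lia. }
    destruct (Z.eqb_spec (c0 mod 5) 0); [contradiction|].
    apply (Fin (fun delta => 5 * Z.gcd delta c0)%Z); auto. intros delta Hd.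
    replace (delta * (a + r * c))%Z with (5 * (delta * a2))%Z by lia.
    rewrite Z.gcd_mul_mono_l_nonneg by lia. f_equal. rewrite gcd_mul_coprime by auto.
    apply gcd_cong_100; auto. exists (c / 100)%Z. lia.
  - apply (Fin (fun delta => Z.gcd delta (5 * c0))%Z); auto. intros delta Hd.
    rewrite gcd_mul_coprime.
    + apply gcd_cong_100; auto. exists (5 * (c / 100))%Z. lia.
    + apply Z.bezout_1_gcd. apply Z.gcd_bezout in G1. destruct G1 as [u [v Huv]].
      pose proof (Z.div_mod (a + r * c) 5 ltac:(lia)) as E6.
      pose proof (Z.mod_pos_bound (a + r * c) 5 ltac:(lia)).
      set (x := (a + r * c)%Z) in *.
      (* The Bezout identities of x with 5 and of x with c are multiplied to give one of x with
         5c. *)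
      assert (exists s w' : Z, s * x + w' * 5 = 1)%Z as [s [w' Hs]].
      { assert ((x mod 5 = 1 \/ x mod 5 = 2 \/ x mod 5 = 3 \/ x mod 5 = 4)%Z) as [C|[C|[C|C]]] by lia.
        - exists 1%Z, (- (x / 5))%Z. lia.
        - exists 3%Z, (- (3 * (x / 5)) - 1)%Z. lia.
        - exists 2%Z, (- (2 * (x / 5)) - 1)%Z. lia.
        - exists 4%Z, (- (4 * (x / 5)) - 3)%Z. lia. }
      exists (u * (s * x + w' * 5) + v * c * s)%Z, (v * w')%Z.
      transitivity ((u * x + v * c) * (s * x + w' * 5))%Z; [ring|]. rewrite Huv, Hs. ring.
Qed.

Section Theorem10.
Variables (i : nat) (j : Z) (k : nat).
Hypothesis (Hi : (i <= 1)%nat) (Hk : (k <= 4)%nat).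

Let f tau := fA tau ^ i * Cpowz (fT tau) j * Gk k tau.

Lemma laurent_Gk (X : list (Z * Z) -> Z) (m : C -> C) :
  laurent_unit (X lG) (fun z => fG (m z)) -> laurent_unit (X lH) (fun z => fH (m z)) ->
  laurent (Gk_ord k X) (fun z => Gk k (m z)).
Proof.
  intros HG HH.
  assert (laurent (Z.min (X lH) (X lG)) (fun z => fH (m z) - fG (m z))) as HM.
  { apply (laurent_ext _ (fun z => fH (m z) + (-1) * fG (m z))). intros; ring.
    apply laurent_plus. eapply laurent_mono; [apply Z.le_min_l|apply HH].
    apply laurent_scal. eapply laurent_mono; [apply Z.le_min_r|apply HG]. }
  destruct k as [|[|[|[|[|n]]]]]; cbn [Gk_ord Gk].
  - apply laurent_const.
  - apply HG.
  - apply HM.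
  - apply (laurent_ext _ (fun z => fG (m z) * fG (m z))). intros; ring.
    replace (2 * X lG)%Z with (X lG + X lG)%Z by ring. apply laurent_mult; apply HG.
  - apply (laurent_ext _ (fun z => (fH (m z) - fG (m z)) * (fH (m z) - fG (m z)))). intros; ring.
    replace (2 * Z.min (X lH) (X lG))%Z with (Z.min (X lH) (X lG) + Z.min (X lH) (X lG))%Z by ring.
    apply laurent_mult; apply HM.
  - apply laurent_const.
Qed.

Lemma laurent_unit_fT (a b c d n : Z) : (a * d - b * c = n)%Z -> (0 < n)%Z -> (n | 5)%Z ->
  laurent_unit (etaq_ord lT a c n) (fun z => fT (mob a b c d z)).
Proof.
  intros D Hn Hd. destruct levels as [LT _].
  eapply laurent_unit_ext; [intros; symmetry; apply fT_etaq|].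
  apply (etaq_LU lT a b c d n 100); auto.
  replace 500%Z with (100 * 5)%Z by ring. apply Z.mul_divide_mono_l, Hd.
Qed.

Lemma laurent_f (a b c d n : Z) : (a * d - b * c = n)%Z -> (0 < n)%Z -> (n | 5)%Z ->
  let X := fun l => etaq_ord l a c n in
  laurent (Z.of_nat i * X lA + j * X lT + Gk_ord k X) (fun z => f (mob a b c d z)).
Proof.
  intros D Hn Hd X. destruct levels as [LT [LH [LG LA]]].
  assert (100 * n | 500)%Z as H500.
  { replace 500%Z with (100 * 5)%Z by ring. apply Z.mul_divide_mono_l, Hd. }
  unfold f. apply laurent_mult.
  - refine (proj1 (laurent_unit_mult _ _ _ _ (laurent_unit_pow _ _ _ _) (laurent_unit_Cpowz _ _ _ (laurent_unit_fT a b c d n D Hn Hd)))).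
    eapply laurent_unit_ext; [|apply (etaq_LU lA a b c d n 100); auto].
    intros z Hz. cbv beta. rewrite fA_etaq; auto. apply UHP_mob; auto. lia.
  - apply (laurent_Gk X (mob a b c d)).
    + eapply laurent_unit_ext; [intros; symmetry; apply fG_etaq|]. apply (etaq_LU lG a b c d n 100); auto.
    + eapply laurent_unit_ext; [intros; symmetry; apply fH_etaq|]. apply (etaq_LU lH a b c d n 100); auto.
Qed.

Lemma f_invariant : invariant 100 f.
Proof.
  intros a b m d D tau H. unfold f. rewrite fA_invariant by auto.
  assert (forall h, invariant 20 h -> h (mob a b (100 * m) d tau) = h tau) as K.
  { intros h Hh. replace (100 * m)%Z with (20 * (5 * m))%Z by ring. apply Hh; auto. lia. }
  rewrite (K fT fT_invariant).
  assert (Gk k (mob a b (100 * m) d tau) = Gk k tau) as ->; auto.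
  pose proof (K fG fG_invariant) as KG. pose proof (K fH fH_invariant) as KH.
  destruct k as [|[|[|[|[|n]]]]]; cbn [Gk]; rewrite ?KG, ?KH; auto.
Qed.

Lemma laurent_psum (h : nat -> C -> C) (M : nat -> Z) N n :
  (forall r, (r < n)%nat -> (N <= M r)%Z /\ laurent (M r) (h r)) -> (0 < n)%nat ->
  laurent N (fun z => psum (fun r => h r z) n).
Proof.
  intros H Hn. induction n; [lia|]. destruct n as [|n].
  - simpl. apply (laurent_ext _ (h O)). intros; ring.
    destruct (H O ltac:(lia)) as [L K]. eapply laurent_mono; eauto.
  - cbn [psum]. cbn [psum] in IHn. apply laurent_plus.
    + apply IHn; [|lia]. intros; apply H; lia.
    + destruct (H (S n) ltac:(lia)) as [L K]. eapply laurent_mono; eauto.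
Qed.

Lemma exists_lower_bound (M : nat -> Z) n : exists N, forall r, (r < n)%nat -> (N <= M r)%Z.
Proof.
  induction n as [|n [N H]]. exists 0%Z; intros; lia.
  exists (Z.min N (M n)). intros r Hr. destruct (Nat.eq_dec r n) as [->|]. lia.
  specialize (H r ltac:(lia)). lia.
Qed.

(** A single bound valid for all five summands controls their sum, whatever cancellation occurs
    among them. *)
Lemma laurent_U5avg (a b c d : Z) : (a * d - b * c = 1)%Z -> exists N,
  laurent N (fun z => Cpowz (fT (mob a b c d z)) (mexp i j k) * U5avg f (mob a b c d z)) /\
  (~ (20 | c)%Z -> (0 <= N)%Z).
Proof.
  intros D. set (t := (mexp i j k * etaq_ord lT a c 1)%Z).
  set (M := fun r : nat => let X := fun l => etaq_ord l (a + Z.of_nat r * c) (5 * c) 5 in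
     (Z.of_nat i * X lA + j * X lT + Gk_ord k X)%Z).
  assert (exists N, (forall r, (r < 5)%nat -> (N <= M r)%Z) /\ (~ (20 | c)%Z -> (0 <= t + N)%Z)) as [N [H1 H2]].
  { destruct (Znumtheory.Zdivide_dec 20 c) as [Hc|Hc].
    - destruct (exists_lower_bound M 5) as [N HN]. exists N. split; auto. tauto.
    (* Each summand has order at least - t, so multiplication by the power of T, of order t, brings
       the bound to 0. *)
    - exists (- t)%Z. split; [|intros; lia]. intros r Hr.
      destruct (total_order_nonneg i j k a b c d (Z.of_nat r) Hi Hk D Hc) as [_ K].
      unfold M, t. lia. }
  exists (t + N)%Z. split; auto. apply laurent_mult.
  - apply laurent_unit_Cpowz, (laurent_unit_fT a b c d 1); auto. lia. exists 5%Z. lia.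
  - unfold U5avg. apply laurent_scal.
    apply (laurent_psum (fun r z => f ((mob a b c d z + INR r) / 5)) M); [|lia].
    intros r Hr. split; auto.
    apply (laurent_ext _ (fun z => f (mob (a + Z.of_nat r * c) (b + Z.of_nat r * d) (5 * c) (5 * d) z))).
    + intros z Hz. f_equal. rewrite INR_IZR_INZ.
      pose proof (mob_den_neq_0 a b c d z ltac:(lia) Hz) as N0.
      unfold mob. rewrite !plus_IZR, !mult_IZR, !RtoC_plus, !RtoC_mult. field. split; auto.
      replace (5 * IZR c * z + 5 * IZR d) with (5 * (IZR c * z + IZR d)) by ring.
      apply Cmult_neq_0; auto. intros E; apply RtoC_inj in E; lra.
    + apply laurent_f. lia. lia. exists 1%Z. lia.
Qed.

Lemma f_LS : laurent (Z.of_nat i * etaq_ord lA 1 0 1 + j * etaq_ord lT 1 0 1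
   + Gk_ord k (fun l => etaq_ord l 1 0 1)) f.
Proof.
  eapply laurent_ext; [|apply (laurent_f 1 0 0 1 1); try lia].
  - intros z _; cbv beta. rewrite mob_id. auto.
  - exists 5%Z. lia.
Qed.

Lemma f_U5_exists : exists g, is_U5 f g.
Proof.
  apply (is_U5_exists _ f f_LS). intros tau H. apply (invariant_shift 100 f tau 1 f_invariant H).
Qed.

Let F (g : C -> C) tau := Cpowz (fT tau) (mexp i j k) * g tau.

Lemma F_invariant : invariant 20 (F (U5avg f)).
Proof.
  intros a b m d D tau H. unfold F.
  rewrite fT_invariant, (U5avg_invariant f f_invariant) by auto. auto.
Qed.

(** The last clause, N | c^2 w, says that g T^w g^(-1) lies in Gamma0(N); this is what makes w a
    period at the cusp. *)
Lemma cusp_width_facts (N : Z) (g : SL2Z) : N = 20%Z -> (0 < cusp_width N g)%Z /\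
  (cusp_width N g | 12000)%Z /\ exists m, (gc g * gc g * cusp_width N g = N * m)%Z.
Proof.
  intros ->. unfold cusp_width. set (G := Z.gcd (gc g * gc g) 20).
  destruct (Z.gcd_divide_r (gc g * gc g) 20) as [s Hs]. fold G in Hs.
  destruct (Z.gcd_divide_l (gc g * gc g) 20) as [m Hm]. fold G in Hm.
  assert (0 < G)%Z as HG.
  { pose proof (Z.gcd_nonneg (gc g * gc g) 20) as P. fold G in P.
    destruct (Z.eq_dec G 0) as [E|]; [rewrite E in Hs|]; lia. }
  assert (20 / G = s)%Z as -> by (rewrite Hs at 1; apply Z.div_mul; lia).
  split; [nia|split].
  - exists (600 * G)%Z. lia.
  - exists m. rewrite Hm. rewrite Hs. ring.
Qed.

Lemma F_cusp (g : C -> C) (h : SL2Z) : (forall tau, UHP tau -> g tau = U5avg f tau) ->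
  exists o, cusp_order 20 (F g) h o /\ (~ (20 | gc h)%Z -> order_nonneg o).
Proof.
  intros Hg. destruct h as [a b c d D]. destruct (laurent_U5avg a b c d D) as [N [HN HN0]].
  destruct (cusp_width_facts 20 (mkSL2Z a b c d D) eq_refl) as [W1 [W2 [m Hm]]].
  set (w := cusp_width 20 (mkSL2Z a b c d D)) in *. simpl gc in *.
  assert (forall tau, UHP tau -> F (U5avg f) (mob a b c d (tau + IZR w)) = F (U5avg f) (mob a b c d tau)) as Hp.
  { intros tau Ht.
    (* The matrix is g T^w g^(-1), with lower left entry - c^2 w = - 20 m. *)
    rewrite <- (F_invariant (1 - w * a * c) (w * a * a) (- m) (1 + w * a * c))%Z with (tau := mob a b c d tau).
    - f_equal. rewrite mob_shift, mob_mob by (auto; lia). 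
      replace (20 * - m)%Z with (- (c * c * w))%Z by lia.
      f_equal.
      + transitivity (a * (1 - w * (a * c)) + w * a * (a * c))%Z; ring.
      + transitivity (b + w * a * (a * d - b * c))%Z; [rewrite D; ring|ring].
      + ring.
      + transitivity (d + w * c * (a * d - b * c))%Z; [rewrite D; ring|ring].
    - replace (20 * - m)%Z with (- (c * c * w))%Z by lia. ring.
    - apply UHP_mob; auto. lia. }
  destruct (laurent_periodic_qexp N _ w HN W1 W2 Hp) as [e [n0 [He Hn0]]].
  assert (has_qexp w (fun tau => F g (moebius (mkSL2Z a b c d D) tau)) n0 e) as Hq.
  { eapply has_qexp_ext; [|exact He]. intros tau Ht. cbv beta. unfold F.
    rewrite <- Hg by (apply UHP_mob; auto; lia). reflexivity. }
  destruct (qexp_order _ _ _ _ Hq) as [Z0|[n [Hn [Hqn Hen]]]].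
  - exists None. split; [|simpl; auto]. apply cusp_order_None. intros tau Ht.
    (* The vanishing is known for the function composed with g, whereas the order None concerns the
       function itself; so it is evaluated at g^(-1) tau. *)
    rewrite <- (Z0 (mob d (- b) (- c) a tau)) by (apply UHP_mob; auto; lia).
    f_equal. change (moebius (mkSL2Z a b c d D)) with (mob a b c d).
    rewrite mob_mob by (auto; lia).
    replace (a * d + b * - c)%Z with 1%Z by lia. replace (a * - b + b * a)%Z with 0%Z by ring.
    replace (c * d + d * - c)%Z with 0%Z by ring. replace (c * - b + d * a)%Z with 1%Z by lia.
    symmetry. apply mob_id.
  - exists (Some n). split.
    + apply cusp_order_Some with (a := e); auto.
    + intros Hc. simpl. specialize (HN0 Hc). specialize (Hn0 HN0). lia.
Qed.

Lemma F_Minfty (g : C -> C) : is_U5 f g -> Minfty 20 (F g).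
Proof.
  intros H. pose proof (is_U5_avg f g H) as Hg. split; [split|].
  - intros tau Ht. destruct (laurent_U5avg 1 0 0 1 eq_refl) as [N [HN _]].
    destruct (laurent_cder N (F g) tau) as [l Hl]; auto.
    + eapply laurent_ext; [|exact HN]. intros z Hz; cbv beta. rewrite mob_id, <- Hg by auto. auto.
    + apply (cder_ex_derive _ l), Hl.
  - intros [a b c d D] [m Hm] tau Ht. simpl in Hm. subst c.
    change (moebius (mkSL2Z a b (m * 20) d D)) with (mob a b (m * 20) d).
    rewrite Z.mul_comm. unfold F. rewrite !Hg by (auto; apply UHP_mob; auto; lia).
    apply (F_invariant a b m d); auto. lia.
  - intros h. destruct (F_cusp g h Hg) as [o [Ho _]]. eauto.
  - intros h Hh. destruct (F_cusp g h Hg) as [o [Ho Hno]]. exists o. split; auto.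
    (* If 20 | c, then h belongs to Gamma0(20) and itself carries infinity to its cusp. *)
    apply Hno. intros Hc. apply Hh. exists h. split. exact Hc. reflexivity.
Qed.

End Theorem10.

Theorem theorem10 (i : nat) (j : Z) (k : nat)
    (hi : (i <= 1)%nat) (hk : (k <= 4)%nat) :
  let f := fun tau : C => fA tau ^ i * Cpowz (fT tau) j * Gk k tau in
  (exists g : C -> C, is_U5 f g) /\
  (forall g : C -> C, is_U5 f g ->
     Minfty 20 (fun tau : C => Cpowz (fT tau) (mexp i j k) * g tau)).
Proof.
  split.
  - exact (f_U5_exists i j k hi hk).
  - exact (F_Minfty i j k hi hk).
Qed.
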